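(* Let $\sigma:\Omega\to\Omega$ be an invertible, ergodic, measure-preserving transformation of a probability space $(\Omega,\mathcal{F},\mathbb{P})$, and let $(\mathcal{T},\sigma)$, $\mathcal{T}=(T_\omega)_{\omega\in\Omega}$, be an admissible Blaschke product cocycle. Let $m$ denote the (normalized) Lebesgue measure on $\mathbb{T}$. Then there exists a unique random absolutely continuous invariant measure $\mu$ for $\mathcal{T}$, with disintegration $\{\mu_\omega\}_{\omega\in\Omega}$ with respect to $\mathbb{P}$, such that: (i) There exists a measurable map $x:\Omega\to D$ such that for $\mathbb{P}$-a.e. $\omega\in\Omega$, $x_\omega=\lim_{n\to\infty}T^{(n)}_{\sigma^{-n}\omega}(z)$ for all $z\in D$, and $$h_\omega:=\frac{d\mu_\omega}{dm}=P_{x_\omega},\qquad P_{x_\omega}(z)=\frac{1-|x_\omega|^2}{|z-x_\omega|^2},\quad z\in\mathbb{T}.$$ Moreover, $\mathcal{L}_\omega h_\omega=h_{\sigma\omega}$ for $\mathbb{P}$-a.e. $\omega\in\Omega$; and (ii) For $\mathbb{P}$-a.e. $\omega\in\Omega$ and any $h_*$ such that $\|h_*\|_1=1$ and $h_*$ is of bounded variation, there exist $n_0(\omega)\in\mathbb{N}$ and $\rho<1$ such that for all $n\ge n_0(\omega)$, $$\|\mathcal{L}^{(n)}_{\sigma^{-n}\omega}h_*-h_\omega\|_\infty\le\rho^n.$$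
   Context: $D=\{z\in\mathbb{C}:|z|<1\}$, $\mathbb{T}=\{z\in\mathbb{C}:|z|=1\}$, $m$ is normalized Lebesgue measure on $\mathbb{T}$ ($m(\mathbb{T})=1$). The circle is identified with $[0,1)$ via $t\mapsto e^{2\pi i t}$; the variation $\mathrm{var}$ of a function on $\mathbb{T}$ is the usual total variation (supremum over finite partitions of the interval) of the corresponding function on the interval. $\|\cdot\|_1$ and $\|\cdot\|_\infty$ are the $L^1(m)$ and $L^\infty(m)$ norms. In (ii), $h_*$ is a function on $\mathbb{T}$. Blaschke product cocycle: a pair $(\mathcal{T},\sigma)$ with $\sigma$ an invertible, ergodic, measure-preserving transformation of a probability space $(\Omega,\mathcal{F},\mathbb{P})$ and $\mathcal{T}=(T_\omega)_{\omega\in\Omega}$, where $T_\omega:\hat{\mathbb{C}}\to\hat{\mathbb{C}}$, $\hat{\mathbb{C}}=\mathbb{C}\cup\{\infty\}$, is $$T_\omega(z)=\rho_\omega\prod_{i=1}^{n_\omega}\frac{z-a_{i,\omega}}{1-\bar a_{i,\omega}z},$$ with $n:\Omega\to\mathbb{N}=\{1,2,\dots\}$ and $\rho:\Omega\to\mathbb{T}$ measurable, $a_{i,\omega}\in D$, and, for each $j\ge1$ for which $\Omega_j:=\{\omega:n_\omega=j\}$ is nonempty, $\omega\mapsto(a_{1,\omega},\dots,a_{j,\omega})\in D^j$ measurable on $\Omega_j$. Thus $n_\omega=\deg(T_\omega)$. Write $T^{(n)}_\omega=T_{\sigma^{n-1}\omega}\circ\cdots\circ T_\omega$. (The number $\rho<1$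 in (ii) is unrelated to the map $\omega\mapsto\rho_\omega$.) Admissible: the Blaschke product cocycle is admissible if (1) $\omega\mapsto\left(\inf_{z\in\mathbb{T}}|T_\omega'(z)|,\ \mathrm{var}(1/|T_\omega'|)\right)$ is measurable on $\Omega$; (2) $\int_\Omega\log\inf_{z\in\mathbb{T}}|T_\omega'(z)|\,d\mathbb{P}(\omega)>0$; (3) $\int_\Omega\frac{n_\omega}{\inf_{z\in\mathbb{T}}|T_\omega'(z)|}\,d\mathbb{P}(\omega)<\infty$; (4) $\int_\Omega\int_{\mathbb{T}}\left|\frac{T_\omega''}{(T_\omega')^2}\right|dm\,d\mathbb{P}(\omega)<\infty$. Transfer operator: for $T_\omega:\mathbb{T}\to\mathbb{T}$, $\mathcal{L}_\omega:=\mathcal{L}_{T_\omega}:L^1(m)\to L^1(m)$ is the unique operator with $\int_A\mathcal{L}_\omega f\,dm=\int_{T_\omega^{-1}(A)}f\,dm$ for all $f\in L^1(m)$ and measurable $A\subset\mathbb{T}$; $\mathcal{L}_\omega^{(n)}:=\mathcal{L}_{\sigma^{n-1}\omega}\circ\cdots\circ\mathcal{L}_\omega$. Random invariant ($\mathcal{T}$-invariant) measure: a measure $\mu$ on $\Omega\times\mathbb{T}$ with disintegration $\{\mu_\omega\}_{\omega\in\Omega}$ with respect to $\mathbb{P}$, where each $\mu_\omega$ is a probability measure on $\mathbb{T}$, $\omega\mapsto\mu_\omega$ is measurable, and $(T_\omega)_*\mu_\omega=\mu_{\sigma\omega}$ for $\mathbb{P}$-a.e. $\omega$. It is a random absolutely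 continuous invariant measure if moreover $\mu_\omega$ is absolutely continuous with respect to $m$ for $\mathbb{P}$-a.e. $\omega$.
   Formalization: In (ii), h_* is additionally assumed real-valued and nonnegative m-a.e. (a density); without this (ii) fails, e.g. for h_* = -1, and the conclusion itself forces h_* ≥ 0 a.e. *)

(* Defs.v *)
From HB Require Import structures.
From mathcomp Require Import all_boot all_order all_algebra.
From mathcomp Require Import complex.
From mathcomp Require Import all_classical all_reals all_analysis.
From mathcomp Require Import measurable_realfun.

Set Implicit Arguments.
Unset Strict Implicit.
Unset Printing Implicit Defensive.

Import Order.TTheory GRing.Theory Num.Theory.
Import ComplexField.Normc.
Import numFieldNormedType.Exports.

Local Open Scope classical_set_scope.
Local Open Scope ring_scope.
Local Open Scope charge_scope.

(* The norm topology of R[i] and its structure of normed space over itself, so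
   that [f^`()] below is the complex derivative. [normc z : R] is the modulus. *)
HB.instance Definition _ (R : realType) := NormedModule.copy R[i] R[i]^o.

Definition borelC (R : realType) := g_sigma_algebraType (@open R[i]).

Record circle (R : realType) :=
  Circle { circle_val :> R[i] ; circleP : normc circle_val == 1 }.

HB.instance Definition _ (R : realType) := [isSub for @circle_val R].
HB.instance Definition _ (R : realType) := [Choice of circle R by <:].

Section circle.
Variable R : realType.
Implicit Type t : R.

Lemma normc_cis t : normc (cos t +i* sin t)%C == 1.
Proof. by rewrite /= cos2Dsin2 sqrtr1. Qed.

Definition circle_exp : measurableTypeR R -> circle R :=
  fun t : R => Circle (normc_cis (2 * pi * t)).

HB.instance Definition _ := isPointed.Build (circle R) (circle_exp 0).

Definition circle_open : set (set (circle R)) :=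
  preimage_set_system [set: circle R] (@circle_val R) open.

HB.instance Definition _ :=
  Measurable.copy (circle R) (g_sigma_algebraType circle_open).

Lemma normc_le_ReIm (z : R[i]) : normc z <= `|complex.Re z| + `|complex.Im z|.
Proof.
case: z => a b /=; rewrite -(ger0_norm (addr_ge0 (normr_ge0 a) (normr_ge0 b))).
rewrite -sqrtr_sqr ler_wsqrtr// sqrrD !real_normK ?num_real//.
by rewrite -addrA lerD2l lerDr mulrn_wge0// mulr_ge0.
Qed.

Lemma continuous_circle_exp : continuous (fun t => circle_exp t : R[i]).
Proof.
have cc : continuous (fun t : R => cos (2 * pi * t)).
  by move=> t; apply: continuous_comp; [exact: mulrl_continuous
    |exact: continuous_cos].
have cs : continuous (fun t : R => sin (2 * pi * t)).
  by move=> t; apply: continuous_comp; [exact: mulrl_continuous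
    |exact: continuous_sin].
move=> t; apply/cvgrPdist_lt => -[e e'] /= /andP[/eqP -> e0].
have e20 : 0 < e / 2 by rewrite divr_gt0.
near=> u.
rewrite ltcE/= eqxx/=.
set a := cos _ - _; set b := sin _ - _.
apply: (le_lt_trans (normc_le_ReIm (a +i* b)%C)); rewrite [ltRHS]splitr.
apply: ltrD => /=; rewrite {}/a {}/b; near: u.
  by move: (cc t) => /cvgrPdist_lt; apply.
by move: (cs t) => /cvgrPdist_lt; apply.
Unshelve. all: end_near. Qed.

Lemma measurable_circle_exp :
  measurable_fun [set: measurableTypeR R] circle_exp.
Proof.
apply: (@measurability _ _ _ _ _ _ circle_open) => //.
move=> _ [_ [U oU <-] <-]; rewrite !setTI.
apply: open_measurable.
by move/continuousP: continuous_circle_exp; apply.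
Qed.

HB.instance Definition _ :=
  isMeasurableFun.Build _ _ (measurableTypeR R) (circle R) circle_exp
    measurable_circle_exp.

(* Normalized Lebesgue measure on the circle. *)
Definition haar : set (circle R) -> \bar R :=
  distribution (uniform_prob (@ltr01 R)) circle_exp.

HB.instance Definition _ := Probability.on haar.

(* The closed interval [0, 1] of parameters and the half-open [0, 1[ give the
   same value on continuous functions and the same functions of bounded
   variation, as circle_exp 1 = circle_exp 0. *)
Definition circle_var (f : circle R -> R) : \bar R :=
  total_variation 0 1 (f \o circle_exp).

Definition poisson (x : R[i]) (z : circle R) : R :=
  (1 - normc x ^+ 2) / normc (circle_val z - x) ^+ 2.

(* As L^1(haar) classes are represented by functions, the operator chooses a
   representative; it depends on the class of f only. *)
Definition transfer (S : circle R -> circle R) (f : circle R -> \bar R) :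
    circle R -> \bar R :=
  xget (cst 0%E) [set g | haar.-integrable [set: circle R] g /\
    forall A, measurable A ->
      (\int[haar]_(z in A) g z = \int[haar]_(z in S @^-1` A) f z)%E].

End circle.

Section dynamics.
Context d (Omega : measurableType d) (R : realType) (P : probability Omega R).

Definition invertible_mpt (sigma sigmaV : Omega -> Omega) : Prop :=
  [/\ cancel sigma sigmaV, cancel sigmaV sigma,
      measurable_fun [set: Omega] sigma, measurable_fun [set: Omega] sigmaV &
      forall A, measurable A -> P (sigma @^-1` A) = P A].

Definition ergodic (sigma : Omega -> Omega) : Prop :=
  forall A, measurable A -> sigma @^-1` A = A -> P A = 0%E \/ P A = 1%E.

(* F_(sigma^(n-1) w) \o ... \o F_w *)
Fixpoint cocycle (Y : Type) (sigma : Omega -> Omega) (F : Omega -> Y -> Y)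
    (n : nat) (w : Omega) (y : Y) : Y :=
  if n is n'.+1 then F (iter n' sigma w) (cocycle sigma F n' w y) else y.

End dynamics.

(* The zeros of T_w are [bzero w i] for i < bdeg w; the other values of
   [bzero w] are irrelevant. *)
Record blaschke_cocycle d (Omega : measurableType d) (R : realType) := {
  bdeg : Omega -> nat ;
  brot : Omega -> R[i] ;
  bzero : Omega -> nat -> R[i] ;
  bdeg_gt0 : forall w, (0 < bdeg w)%N ;
  brot_circle : forall w, normc (brot w) = 1 ;
  bzero_disk : forall w i, (i < bdeg w)%N -> normc (bzero w i) < 1 ;
  bdeg_measurable : measurable_fun [set: Omega] bdeg ;
  brot_measurable : measurable_fun [set: Omega] (brot : Omega -> borelC R) ;
  bzero_measurable : forall j,
    measurable_fun [set w | bdeg w = j]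
      (fun w => [tuple bzero w i | i < j] : j.-tuple (borelC R)) }.

Section blaschke.
Context d (Omega : measurableType d) (R : realType).
Variable B : blaschke_cocycle Omega R.
Implicit Types (w : Omega) (z : R[i]).

(* Only the values near the closed unit disk matter, where no denominator
   vanishes; at a pole this function is 0 instead of infinity. *)
Definition bmap w z : R[i] :=
  brot B w * \prod_(i < bdeg B w)
    ((z - bzero B w i) / (1 - (bzero B w i)^*%C * z)).

Lemma normc_conj z : normc z^*%C = normc z.
Proof. by case: z => a b /=; rewrite sqrrN. Qed.

Lemma normc_blaschke_factor (a z : R[i]) : normc a < 1 -> normc z = 1 ->
  normc ((z - a) / (1 - a^*%C * z)) = 1.
Proof.
move=> a1 z1.
have zz : z * z^*%C = 1 by rewrite -sqr_normc [`|z|]/(normc z)%:C%C z1 expr1n.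
have za : z != a by apply/eqP => za; move: a1; rewrite -za z1 ltxx.
rewrite normcM normcV.
have -> : 1 - a^*%C * z = z * (z - a)^*%C.
  by rewrite rmorphB/= mulrBr zz mulrC.
rewrite normcM z1 mul1r normc_conj divff//.
by apply: contra za => /eqP/eq0_normc/eqP; rewrite subr_eq0.
Qed.

Lemma normc_bmap w (z : circle R) : normc (bmap w z) == 1.
Proof.
rewrite /bmap normcM brot_circle mul1r.
apply/eqP; elim/big_rec : _ => [|i x _ x1]; first exact: normc1.
rewrite normcM x1 mulr1; apply: normc_blaschke_factor; first exact: bzero_disk.
exact/eqP/circleP.
Qed.

Definition bcircle w (z : circle R) : circle R := Circle (normc_bmap w z).

Definition inf_speed w : R :=
  inf [set normc ((bmap w)^`()%classic (circle_val z)) | z in [set: circle R]].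

Definition inv_speed w (z : circle R) : R :=
  (normc ((bmap w)^`()%classic (circle_val z)))^-1.

Definition admissible (P : probability Omega R) : Prop :=
  [/\ measurable_fun [set: Omega]
        (fun w => (inf_speed w, circle_var (inv_speed w))),
      (0 < \int[P]_w (ln (inf_speed w))%:E)%E,
      (\int[P]_w ((bdeg B w)%:R / inf_speed w)%:E < +oo)%E &
      (\int[P]_w \int[@haar R]_z
         (normc ((bmap w)^`(2)%classic (circle_val z) /
                 (bmap w)^`()%classic (circle_val z) ^+ 2))%:E < +oo)%E].

End blaschke.

Section random_measures.
Context d (Omega : measurableType d) (R : realType) (P : probability Omega R).
Variables (sigma : Omega -> Omega) (B : blaschke_cocycle Omega R).

Definition disintegration (mu : {measure set (Omega * circle R) -> \bar R})
    (mu_ : Omega -> probability (circle R) R) : Prop :=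
  (forall A, measurable A -> measurable_fun [set: Omega] (fun w => mu_ w A)) /\
  (forall A, measurable A -> mu A = \int[P]_w mu_ w (xsection A w))%E.

Definition random_acim (mu : {measure set (Omega * circle R) -> \bar R})
    (mu_ : Omega -> probability (circle R) R) : Prop :=
  [/\ disintegration mu mu_,
      {ae P, forall w, forall A, measurable A ->
        mu_ w (bcircle B w @^-1` A) = mu_ (sigma w) A} &
      {ae P, forall w, mu_ w `<< @haar R}].

Definition density (mu_ : Omega -> probability (circle R) R) (w : Omega) :
    circle R -> \bar R :=
  'd (charge_of_finite_measure (mu_ w)) '/d (@haar R).

End random_measures.

(* Main.v *)
(* A Blaschke product T maps the Poisson measure P_z m of a point z of the disk
   to P_{Tz} m, so the measures P_{x_w} m are equivariant as soon as the points
   x_w are. The defect 1 - |z|^2 grows on average close to the circle, because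
   log inf |T'| has positive integral: by the ergodic theorem, backward orbits
   that start at defect a^n reach a compact part of the disk, where maps of
   degree at least 2, which occur with positive frequency, contract the
   pseudo-hyperbolic metric. Hence they converge to x_w exponentially fast, even
   from points exponentially close to the circle. A function of bounded variation
   is bounded above by the Poisson average, at radius sqrt(1 - a^n), of a local
   majorant with almost the same integral; the transfer operators turn this
   average into a combination of Poisson kernels of points close to x_w, whence
   the rate of convergence. For uniqueness, a random absolutely continuous
   invariant measure has a density in L^1(P x m), which is approximated by
   combinations of indicators of rectangles, for which the same estimate yields
   mixing of the skew product. *)
From HB Require Import structures.
Require Import Defs.
From mathcomp Require Import all_boot all_order all_algebra.
From mathcomp Require Import complex.
From mathcomp Require Import all_classical all_reals all_analysis.
From mathcomp Require Import measurable_realfun.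
From mathcomp Require Import ring lra.

Set Implicit Arguments.
Unset Strict Implicit.
Unset Printing Implicit Defensive.

Import Order.TTheory GRing.Theory Num.Theory.
Import ComplexField.Normc.
Import numFieldNormedType.Exports.

Local Open Scope classical_set_scope.
Local Open Scope ring_scope.

(** * Ergodic sums *)

(** The zeros of [bmap B w] may approach the circle and their number may be unbounded, so the
    expansion of the defect is only available at a scale that depends on w. Fibers are therefore
    split: where all zeros keep the distance 1/(N+1) from the circle, the defect expands by almost
    [inf_speed]; elsewhere it loses at most the factor [4 * distortion], whose logarithm is
    integrable, so that these fibers stop mattering for large N. The compact part of the disk is the
    random region [kappa w <= defect z], built from the past of w so that the cocycle preserves it.
    The transfer operator is known by duality only, so each estimate bounds integrals of
    [f * (g \o T^n)] from above, for test functions g with values in [0, 1], with an error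
    proportional to the integral of g: for f and -f and all indicators g this is a bound in the sup
    norm, and it also gives the mixing of the fibers. The Poisson radius has defect a^n and the
    local majorant has width a^(n/4), so that the tail of the kernel, of order a^n / a^(n/2), decays
    exponentially together with the cost of the majorant. *)

Lemma exists_nat_gt (R : realType) (x : R) : exists k : nat, x < k%:R.
Proof.
exists (Num.bound `|x|).
exact: le_lt_trans (ler_norm _) (archi_boundP (normr_ge0 _)).
Qed.

Lemma ler_norm_maxN (R : realDomainType) (m x : R) :
  0 <= m -> `|Order.max (- m) x| <= `|x|.
Proof.
move=> m0; case: (leP x (- m)) => // xm.
by rewrite normrN (ger0_norm m0) -(normrN x) (le_trans _ (ler_norm _))// lerNr.
Qed.

(** * Integrals under an image measure *)

Section transport.
Context d1 d2 (X : measurableType d1) (Y : measurableType d2) (R : realType).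
Variables (mu : {measure set X -> \bar R}) (nu : {measure set Y -> \bar R}).
Variable phi : X -> Y.
Hypothesis mphi : measurable_fun [set: X] phi.
Hypothesis nuE : forall A, measurable A -> nu A = mu (phi @^-1` A).

Let mphi_mixin := isMeasurableFun.Build _ _ _ _ _ mphi.
Let mphi_pack : {mfun _ >-> _} := HB.pack phi mphi_mixin.

Lemma ge0_integral_transport (f : Y -> \bar R) :
  measurable_fun [set: Y] f -> (forall y, 0 <= f y)%E ->
  (\int[nu]_y f y = \int[mu]_x f (phi x))%E.
Proof.
move=> mf f0.
rewrite -(@ge0_integral_pushforward _ _ _ _ _ phi mphi mu setT f)//.
by apply: eq_measure_integral => A mA _; rewrite nuE.
Qed.

Lemma integrable_transport (f : Y -> \bar R) :
  measurable_fun [set: Y] f -> nu.-integrable [set: Y] f ->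
  mu.-integrable [set: X] (f \o phi).
Proof.
move=> mf /integrableP[_ fi]; apply/integrableP; split.
  exact: measurableT_comp.
rewrite -(ge0_integral_transport (f := fun y => `|f y|%E))//.
exact: measurableT_comp.
Qed.

Lemma integral_transport (f : Y -> \bar R) :
  measurable_fun [set: Y] f ->
  (\int[nu]_y f y = \int[mu]_x f (phi x))%E.
Proof.
move=> mf; rewrite integralE [RHS]integralE.
congr (_ - _)%E.
  rewrite (ge0_integral_transport (measurable_funepos mf))//.
  by apply: eq_integral => x _; rewrite !funeposE.
rewrite (ge0_integral_transport (measurable_funeneg mf))//.
by apply: eq_integral => x _; rewrite !funenegE.
Qed.

Lemma Rintegral_transport (f : Y -> R) :
  measurable_fun [set: Y] f ->
  \int[nu]_y f y = \int[mu]_x f (phi x).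
Proof.
move=> mf; congr fine; rewrite integral_transport//.
exact: measurableT_comp.
Qed.

End transport.

(** * Growth of ergodic sums, by a maximal function *)

Section ergodic_sums.
Context d (Omega : measurableType d) (R : realType) (P : probability Omega R).
Variable s : Omega -> Omega.
Hypothesis ms : measurable_fun [set: Omega] s.
Hypothesis sP : forall A, measurable A -> P (s @^-1` A) = P A.
Hypothesis es : ergodic P s.

Let PsE A : measurable A -> P A = P (s @^-1` A).
Proof. by move=> mA; rewrite sP. Qed.

Lemma ae_comp_mpt (Q : Omega -> Prop) :
  {ae P, forall w, Q w} -> {ae P, forall w, Q (s w)}.
Proof.
move=> [N [mN N0 QN]]; exists (s @^-1` N); split.
- by rewrite -[X in measurable X]setTI; exact: ms.
- by rewrite sP.
- by move=> w /= Qw; apply: QN.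
Qed.

Lemma ae_comp_mpt_iter (Q : Omega -> Prop) :
  {ae P, forall w, Q w} -> {ae P, forall w, forall n, Q (iter n s w)}.
Proof.
move=> aQ; apply: ae_foralln; elim => [//|n IHn].
by have := ae_comp_mpt IHn; apply: filterS => w /=; rewrite -iterSr.
Qed.

(* The running maximum of the ergodic sums of F, starting from 0. *)
Fixpoint ergodic_max (F : Omega -> R) n : Omega -> R :=
  if n is n'.+1 then fun w => Order.max 0 (F w + ergodic_max F n' (s w))
  else cst 0.

Lemma ergodic_max_ge0 F n w : 0 <= ergodic_max F n w.
Proof. by case: n => [//|n] /=; rewrite le_max lexx. Qed.

Lemma ergodic_max_nd F n w : ergodic_max F n w <= ergodic_max F n.+1 w.
Proof.
elim: n w => [|n IHn] w; first exact: ergodic_max_ge0.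
rewrite [leLHS]/= [leRHS]/= ge_max le_max lexx/= le_max; apply/orP; right.
by rewrite lerD2l; exact: IHn.
Qed.

Lemma ergodic_max_sum F n w :
  \sum_(k < n) F (iter k s w) <= ergodic_max F n w.
Proof.
elim: n w => [|n IHn] w; first by rewrite big_ord0.
rewrite big_ord_recl/= le_max lerD2l; apply/orP; right.
by under eq_bigr do rewrite -iterS iterSr; exact: IHn.
Qed.

Lemma measurable_ergodic_max F n : measurable_fun [set: Omega] F ->
  measurable_fun [set: Omega] (ergodic_max F n).
Proof.
move=> mF; elim: n => [|n IHn] //=.
apply: measurable_maxr => //; apply: measurable_funD => //.
exact: measurableT_comp.
Qed.

Lemma integrable_ergodic_max F n : P.-integrable [set: Omega] (EFin \o F) ->
  P.-integrable [set: Omega] (EFin \o ergodic_max F n).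
Proof.
move=> iF.
have mF : measurable_fun [set: Omega] F.
  by apply/measurable_EFinP; exact: measurable_int iF.
elim: n => [|n IHn] /=; first exact: finite_measure_integrable_cst.
apply: (@le_integrable _ _ _ P _ _ _
  (fun w => (EFin \o F) w + (EFin \o (ergodic_max F n \o s)) w)%E) => //.
- by apply/measurable_EFinP; exact: (measurable_ergodic_max n.+1).
- move=> w _ /=; rewrite lee_fin.
  by rewrite /Order.max; case: ifP => // _; rewrite normr0.
- apply: integrableD => //.
  apply: (integrable_transport ms PsE (f := EFin \o ergodic_max F n)) => //.
  by apply/measurable_EFinP; exact: measurable_ergodic_max.
Qed.

(* With M_n the running maximum, M_{n+1} - M_n \o s = max (- M_n \o s) F
   decreases to F where M_n is unbounded, and has nonnegative integral; so M_n
   cannot be unbounded almost everywhere when F has negative integral. *)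
Lemma ergodic_sums_bounded_above (F : Omega -> R) :
  P.-integrable [set: Omega] (EFin \o F) ->
  \int[P]_w F w < 0 ->
  {ae P, forall w, exists C : R, forall n, \sum_(k < n) F (iter k s w) <= C}.
Proof.
move=> iF F0.
have mF : measurable_fun [set: Omega] F.
  by apply/measurable_EFinP; exact: measurable_int iF.
pose A := [set w | forall m : nat, exists n, m%:R < ergodic_max F n w].
have mA : measurable A.
  have -> : A = \bigcap_m \bigcup_n [set w | m%:R < ergodic_max F n w].
    apply/seteqP; split=> w /= h m; first by move=> _; have [n] := h m; exists n.
    by have [n _] := h m I; exists n.
  apply: bigcap_measurable => // m _; apply: bigcup_measurable => n _.
  rewrite -[X in measurable X]setTI.
  by apply: (measurable_fun_ltr (f := cst m%:R) _ (measurable_ergodic_max n mF)).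
(* The invariance is exact: [ergodic_max F n.+1 w], once positive, differs from
   [ergodic_max F n (s w)] by the fixed amount [F w], so both sequences are bounded or both are
   unbounded. *)
have sA : s @^-1` A = A.
  apply/seteqP; split=> w /= h m.
    have [k mk] := exists_nat_gt (m%:R - F w).
    have [n kn] := h k; exists n.+1 => /=; rewrite lt_max; apply/orP; right.
    by rewrite -ltrBlDl (lt_trans mk).
  have [k mk] := exists_nat_gt (m%:R + `|F w|).
  have [[|n]] := h k => /=.
    move=> k0; exfalso; have : 0 <= k%:R :> R by [].
    by rewrite leNgt k0.
  rewrite lt_max => /orP[k0|kn].
    by exfalso; have : 0 <= k%:R :> R by []; rewrite leNgt k0.
  exists n; have := ler_norm (F w); lra.
have [A0|A1] := es mA sA.
  exists A; split => // w /= nC m; apply: contrapT => nn; apply: nC.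
  exists m%:R => n; apply: le_trans (ergodic_max_sum _ _ _) _.
  by rewrite leNgt; apply/negP => mn; apply: nn; exists n.
exfalso.
pose f_ n w := (ergodic_max F n.+1 w - ergodic_max F n (s w)).
have f_E n w : f_ n w = Order.max (- ergodic_max F n (s w)) (F w).
  rewrite /f_ /=; have := ergodic_max_ge0 F n (s w).
  by rewrite /Order.max; do 2 case: ifP; lra.
have mf_ n : measurable_fun [set: Omega] (f_ n).
  apply: measurable_funB; first exact: measurable_ergodic_max.
  by apply: measurableT_comp => //; exact: measurable_ergodic_max.
have f_ge0 n : 0 <= \int[P]_w f_ n w.
  have iM := integrable_ergodic_max n iF.
  rewrite RintegralB//; last 2 first.
  - exact: integrable_ergodic_max.
  - apply: (integrable_transport ms PsE (f := EFin \o ergodic_max F n)) => //.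
    by apply/measurable_EFinP; exact: measurable_ergodic_max.
  rewrite -(Rintegral_transport ms PsE (measurable_ergodic_max n mF)).
  rewrite subr_ge0; apply: le_Rintegral => //.
  - exact: integrable_ergodic_max.
  - by move=> w _; exact: ergodic_max_nd.
have Aae : {ae P, forall w, A w}.
  exists (~` A); split => //; first exact: measurableC.
  by rewrite probability_setC// A1 subee.
have cF : {ae P, forall w, [set: Omega] w ->
    (EFin \o f_ n) w @[n --> \oo] --> (EFin \o F) w}.
  apply: filterS Aae => w Aw _.
  apply: cvg_near_cst.
  have [k mk] := exists_nat_gt `|F w|.
  have [N kN] : exists n, k%:R < ergodic_max F n (s w).
    by move: (Aw); rewrite -sA => /(_ k).
  exists N => // n /= Nn.
  rewrite /= f_E; congr EFin.
  have NnM : ergodic_max F N (s w) <= ergodic_max F n (s w).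
    have /nondecreasing_seqP nd : forall j,
        ergodic_max F j (s w) <= ergodic_max F j.+1 (s w).
      by move=> j; exact: ergodic_max_nd.
    exact: nd.
  rewrite max_r// lerNl.
  by apply: le_trans NnM; rewrite ltW// (lt_trans _ kN)// (le_lt_trans _ mk)// -normrN ler_norm.
have fg : {ae P, forall w n, [set: Omega] w ->
    (`|(EFin \o f_ n) w| <= `|F w|%:E)%E}.
  apply: aeW => w n _ /=; rewrite lee_fin f_E.
  exact: ler_norm_maxN (ergodic_max_ge0 _ _ _).
have [_ _ cvI] := dominated_convergence measurableT
  (fun n => measurableT_comp (@EFin_measurable _ _) (mf_ n))
  (measurableT_comp (@EFin_measurable _ _) mF) cF (integrable_norm iF) fg.
have : ((0:R)%:E <= \int[P]_w (F w)%:E)%E.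
  rewrite -(cvg_lim (@ereal_hausdorff _) cvI).
  apply: lime_ge; first by apply/cvg_ex; eexists; exact: cvI.
  apply: nearW => n /=.
  have := f_ge0 n; rewrite -lee_fin /Rintegral fineK//.
  apply: integrable_fin_num => //.
  apply: (@le_integrable _ _ _ P _ _ _ (EFin \o F)) => //.
    exact: measurableT_comp.
  move=> w _ /=; rewrite lee_fin f_E.
  exact: ler_norm_maxN (ergodic_max_ge0 _ _ _).
move: F0; rewrite /Rintegral => F0.
by rewrite -(fineK (integrable_fin_num _ iF))// lee_fin leNgt F0.
Qed.

(** Half of the mean minus f has negative integral, so its ergodic sums are bounded above; this
    leaves half of the mean as growth rate. *)
Lemma ergodic_sums_linear_growth (f : Omega -> R) :
  P.-integrable [set: Omega] (EFin \o f) ->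
  0 < \int[P]_w f w ->
  exists2 c : R, 0 < c &
  {ae P, forall w, exists C : R, forall n,
    c * n%:R - C <= \sum_(k < n) f (iter k s w)}.
Proof.
move=> fi f0; set I0 := (X in 0 < X) in f0.
exists (I0 / 2); first by rewrite divr_gt0.
have ci : P.-integrable [set: Omega] (EFin \o cst (I0 / 2)).
  exact: finite_measure_integrable_cst.
have : {ae P, forall w, exists C : R, forall n,
    \sum_(k < n) (I0 / 2 - f (iter k s w)) <= C}.
  apply: (@ergodic_sums_bounded_above (fun w => I0 / 2 - f w)).
  - rewrite (_ : _ \o _ = ((EFin \o cst (I0 / 2)%R) \- (EFin \o f))%E)//.
    exact: integrableB.
  - rewrite RintegralB// -/I0 Rintegral_cst//
      [X in fine X](_ : _ = 1%E);
      last exact: probability_setT.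
    rewrite mulr1.
    by rewrite subr_lt0 ltr_pdivrMr// ltr_pMr// ltr1n.
apply: filterS => w [C hC]; exists C => n.
have := hC n; rewrite sumrB sumr_const card_ord -mulr_natr; lra.
Qed.

End ergodic_sums.

(** * Complex-valued measurable functions *)

Section complex_numbers.
Variable R : realType.
Implicit Types (z w a : R[i]).

Lemma sqr_normcE z : normc z ^+ 2 = complex.Re z ^+ 2 + complex.Im z ^+ 2.
Proof. by case: z => x y /=; rewrite sqr_sqrtr// addr_ge0// sqr_ge0. Qed.

Lemma normc_ge0 z : 0 <= normc z.
Proof. by case: z => x y; exact: sqrtr_ge0. Qed.

Lemma normr_Re_le z : `|complex.Re z| <= normc z.
Proof. by case: z => x y /=; rewrite -sqrtr_sqr ler_wsqrtr// lerDl sqr_ge0. Qed.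

Lemma normr_Im_le z : `|complex.Im z| <= normc z.
Proof. by case: z => x y /=; rewrite -sqrtr_sqr ler_wsqrtr// lerDr sqr_ge0. Qed.

Lemma normc_opp z : normc (- z) = normc z.
Proof. by case: z => x y /=; rewrite !sqrrN. Qed.

Lemma normc_subC z w : normc (z - w) = normc (w - z).
Proof. by rewrite -normc_opp opprB. Qed.

Lemma normcD_le z w : normc (z + w) <= normc z + normc w.
Proof.
by have := ler_normD z w; rewrite -lecR rmorphD.
Qed.

Lemma normc_real (x : R) : normc (x%:C)%C = `|x|.
Proof. by rewrite /= expr0n /= addr0 sqrtr_sqr. Qed.

Lemma normc_gt0 z : (0 < normc z) = (z != 0).
Proof.
rewrite lt_neqAle normc_ge0 andbT eq_sym.
congr (~~ _); apply/eqP/eqP => [/eq0_normc //|->]; exact: normc0.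
Qed.

Lemma normc_sub_le z w : normc z - normc w <= normc (z - w).
Proof. by rewrite lerBlDr -{1}(subrK w z) normcD_le. Qed.

(** The norm of R[i] takes its values in R[i], and so do the radii of balls. A positive complex
    number is real, which allows the real modulus [normc] instead. *)
Lemma cvg_normcP (T : Type) (F : set_system T) (FF : Filter F) (f : T -> R[i]) z :
  f @ F --> z <-> forall e : R, 0 < e -> \forall t \near F, normc (z - f t) < e.
Proof.
split=> [/cvgrPdist_lt h e e0|h].
  have := h (e%:C)%C; rewrite ltcR => /(_ e0).
  by apply: filterS => t; rewrite -ltcR.
apply/cvgrPdist_lt => -[e e'].
rewrite ltcE/= => /andP[/eqP -> e0].
by have := h e e0; apply: filterS => t; rewrite -ltcR.
Qed.

Lemma open_normcP (U : set R[i]) : open U <->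
  forall z, U z -> exists2 e : R, 0 < e & forall w, normc (z - w) < e -> U w.
Proof.
rewrite openE; split=> h z Uz.
  have /nbhs_normP[[e e']] := h z Uz.
  rewrite /= ltcE/= => /andP[/eqP -> e0] sU; exists e => // w zw.
  by apply: sU => /=; rewrite -ltcR in zw.
have [e e0 he] := h z Uz; apply/nbhs_normP.
exists (e%:C)%C; first by rewrite /= ltcR.
by move=> w /= zw; apply: he; rewrite -ltcR.
Qed.

Lemma continuous_Re : continuous (@complex.Re R : R[i] -> R).
Proof.
move=> z; apply/(@cvgrPdist_lt _ _ _ _ (nbhs_filter z)) => e e0.
have := (cvg_normcP (nbhs_filter z) id z).1 (@cvg_id _ (nbhs z)) e e0.
apply: filterS => w; apply: le_lt_trans.
by rewrite -(raddfB (@complex.Re R : Rcomplex R -> R)); exact: normr_Re_le.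
Qed.

Lemma continuous_Im : continuous (@complex.Im R : R[i] -> R).
Proof.
move=> z; apply/(@cvgrPdist_lt _ _ _ _ (nbhs_filter z)) => e e0.
have := (cvg_normcP (nbhs_filter z) id z).1 (@cvg_id _ (nbhs z)) e e0.
apply: filterS => w; apply: le_lt_trans.
by rewrite -(raddfB (@complex.Im R : Rcomplex R -> R)); exact: normr_Im_le.
Qed.

End complex_numbers.

Section complex_measurability.
Context d (T : measurableType d) (R : realType).
Implicit Types f g : T -> R[i].

(** The componentwise form reduces the algebra of measurable functions to the real case;
    [measurable_borelC] identifies it with measurability into [borelC R]. *)
Definition cmeasurable (D : set T) f :=
  measurable_fun D (fun t => complex.Re (f t)) /\
  measurable_fun D (fun t => complex.Im (f t)).

Lemma cmeasurable_cst D (z : R[i]) : cmeasurable D (cst z).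
Proof. by split; exact: measurable_cst. Qed.

Lemma cmeasurableD D f g :
  cmeasurable D f -> cmeasurable D g -> cmeasurable D (fun t => f t + g t).
Proof.
move=> [f1 f2] [g1 g2]; split.
- apply: (eq_measurable_fun (fun t => complex.Re (f t) + complex.Re (g t))).
    by move=> t _; case: (f t) (g t) => [? ?] [? ?].
  exact: measurable_funD.
- apply: (eq_measurable_fun (fun t => complex.Im (f t) + complex.Im (g t))).
    by move=> t _; case: (f t) (g t) => [? ?] [? ?].
  exact: measurable_funD.
Qed.

Lemma cmeasurableM D f g :
  cmeasurable D f -> cmeasurable D g -> cmeasurable D (fun t => f t * g t).
Proof.
move=> [f1 f2] [g1 g2]; split.
- apply: (eq_measurable_fun (fun t => complex.Re (f t) * complex.Re (g t)
    - complex.Im (f t) * complex.Im (g t))).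
    by move=> t _; case: (f t) (g t) => [? ?] [? ?].
  by apply: measurable_funB; exact: measurable_funM.
- apply: (eq_measurable_fun (fun t => complex.Re (f t) * complex.Im (g t)
    + complex.Im (f t) * complex.Re (g t))).
    by move=> t _; case: (f t) (g t) => [? ?] [? ?].
  by apply: measurable_funD; exact: measurable_funM.
Qed.

Lemma cmeasurableN D f : cmeasurable D f -> cmeasurable D (fun t => - f t).
Proof.
move=> mf; have := cmeasurableM (cmeasurable_cst D (-1)) mf.
by under [X in cmeasurable D X -> _]eq_fun do rewrite mulN1r.
Qed.

Lemma cmeasurableB D f g :
  cmeasurable D f -> cmeasurable D g -> cmeasurable D (fun t => f t - g t).
Proof. by move=> mf mg; apply: cmeasurableD => //; exact: cmeasurableN. Qed.

Lemma cmeasurable_conj D f : cmeasurable D f ->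
  cmeasurable D (fun t => (f t)^*%C).
Proof.
move=> [f1 f2]; split.
  apply: (eq_measurable_fun (fun t => complex.Re (f t))) => //.
  by move=> t _; case: (f t).
apply: (eq_measurable_fun (fun t => - complex.Im (f t))).
  by move=> t _; case: (f t).
exact: measurable_funN.
Qed.

Lemma measurable_sqr_normc D f : cmeasurable D f ->
  measurable_fun D (fun t => normc (f t) ^+ 2).
Proof.
move=> [f1 f2]; under eq_fun do rewrite sqr_normcE.
by apply: measurable_funD; exact: measurable_funX.
Qed.

Lemma measurable_funV D (h : T -> R) : measurable D -> measurable_fun D h ->
  measurable_fun D (fun t => (h t)^-1).
Proof.
move=> mD mh.
have mV : measurable_fun [set: R] (@GRing.inv R).
  rewrite -(setUv [set 0]); apply/measurable_funU => //; first exact: measurableC.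
  split; first exact: measurable_fun_set1.
  apply: open_continuous_measurable_fun.
    by rewrite openC; exact: closed_eq.
  move=> x; rewrite inE/= => /eqP x0.
  exact: inv_continuous.
exact: measurableT_comp.
Qed.

Lemma cmeasurableV D f : measurable D -> cmeasurable D f ->
  cmeasurable D (fun t => (f t)^-1).
Proof.
move=> mD mf; have mV := measurable_funV mD (measurable_sqr_normc mf).
have [f1 f2] := mf; split.
- apply: (eq_measurable_fun
    (fun t => complex.Re (f t) * (normc (f t) ^+ 2)^-1)).
    by move=> t _; rewrite sqr_normcE; case: (f t).
  exact: measurable_funM.
- apply: (eq_measurable_fun
    (fun t => - (complex.Im (f t) * (normc (f t) ^+ 2)^-1))).
    by move=> t _; rewrite sqr_normcE; case: (f t) => x y /=; rewrite ?mulNr.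
  by apply: measurable_funN; exact: measurable_funM.
Qed.

Lemma cmeasurable_prod D (I : Type) (r : seq I) (h : I -> T -> R[i]) :
  (forall i, cmeasurable D (h i)) ->
  cmeasurable D (fun t => \prod_(i <- r) h i t).
Proof.
move=> mh; elim: r => [|i r IHr].
  by under eq_fun do rewrite big_nil; exact: cmeasurable_cst.
by under eq_fun do rewrite big_cons; exact: cmeasurableM.
Qed.

Lemma cmeasurableX D f n : cmeasurable D f ->
  cmeasurable D (fun t => f t ^+ n).
Proof.
move=> mf; elim: n => [|n IHn].
  by under eq_fun do rewrite expr0; exact: cmeasurable_cst.
by under eq_fun do rewrite exprS; exact: cmeasurableM.
Qed.

Lemma cmeasurable_horner D (p : {poly R[i]}) f : cmeasurable D f ->
  cmeasurable D (fun t => p.[f t]).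
Proof.
move=> mf; elim/poly_ind: p => [|p c IHp].
  by under eq_fun do rewrite horner0; exact: cmeasurable_cst.
under eq_fun do rewrite hornerMXaddC.
by apply: cmeasurableD; [exact: cmeasurableM|exact: cmeasurable_cst].
Qed.

Lemma measurable_borelC f : measurable_fun [set: T] (f : T -> borelC R) <->
  cmeasurable [set: T] f.
Proof.
split=> [mf|[f1 f2]].
  split.
  - apply: (measurability _ (RGenOpens.measurableE R)) => _ [_ [a [b ->] <-]].
    rewrite setTI.
    rewrite (_ : _ @^-1` _ = f @^-1` (@complex.Re R @^-1` `]a, b[%classic))//.
    rewrite -[X in measurable X]setTI; apply: mf => //.
    apply: sub_sigma_algebra.
    by move/continuousP : (@continuous_Re R); apply; exact: interval_open.
  - apply: (measurability _ (RGenOpens.measurableE R)) => _ [_ [a [b ->] <-]].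
    rewrite setTI.
    rewrite (_ : _ @^-1` _ = f @^-1` (@complex.Im R @^-1` `]a, b[%classic))//.
    rewrite -[X in measurable X]setTI; apply: mf => //.
    apply: sub_sigma_algebra.
    by move/continuousP : (@continuous_Im R); apply; exact: interval_open.
apply: (@measurability _ _ T (borelC R) setT f (@open R[i])) => //.
move=> _ [U /open_normcP oU <-]; rewrite setTI.
(* An open set of the plane is the union of the countably many rational squares that it contains. *)
pose box (p q : rat) (n : nat) := [set z : R[i] |
  `|complex.Re z - ratr p| < n.+1%:R^-1 /\ `|complex.Im z - ratr q| < n.+1%:R^-1].
have -> : f @^-1` U = \bigcup_p \bigcup_q \bigcup_n
    (if `[< box p q n `<=` U >] then f @^-1` box p q n else set0).
  apply/seteqP; split=> [t /= Ut|t [p _ [q _ [n _]]]]; last first.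
    by case: asboolP => // bU /bU.
  have [e e0 he] := oU _ Ut.
  (* Two points of a square of half-side r differ by at most 2 r in each coordinate, hence by at
     most 4 r in modulus. *)
  have [n ne] : exists n : nat, n.+1%:R^-1 * 4 < e.
    have [n ne] := exists_nat_gt (4 / e); exists n.
    rewrite mulrC ltr_pdivrMr ?ltr0n// mulrC -ltr_pdivrMr//.
    by rewrite (lt_trans ne)// ltr_nat.
  have n0 : 0 < n.+1%:R^-1 :> R by rewrite invr_gt0 ltr0n.
  have approx (x : R) : exists p : rat, `|x - ratr p| < n.+1%:R^-1.
    have : x - n.+1%:R^-1 < x + n.+1%:R^-1 by rewrite ltrD2l gtrN.
    move=> /rat_in_itvoo[p]; rewrite in_itv/= => /andP[h1 h2]; exists p.
    by rewrite distrC ltr_distl h1.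
  have [p hp] := approx (complex.Re (f t)).
  have [q hq] := approx (complex.Im (f t)).
  exists p => //; exists q => //; exists n => //.
  case: asboolP => // nb; exfalso; apply: nb => z [zp zq]; apply: he.
  apply: (le_lt_trans (normc_le_ReIm _)).
  move: hp hq zp zq n0 ne; move: (n.+1%:R^-1) => r.
  case: (f t) => x y; case: z => x' y' /=.
  move: (ratr p) (ratr q) => p' q' hp hq zp zq r0 re.
  have h1 : `|x - x'| <= r + r.
    by rewrite (le_trans (ler_distD p' _ _))// lerD// ltW// distrC.
  have h2 : `|y - y'| <= r + r.
    by rewrite (le_trans (ler_distD q' _ _))// lerD// ltW// distrC.
  lra.
apply: bigcupT_measurable_rat => p; apply: bigcupT_measurable_rat => q.
apply: bigcup_measurable => n _; case: ifP => // _.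
rewrite (_ : _ @^-1` _ =
  [set t | `|complex.Re (f t) - ratr p| < n.+1%:R^-1] `&`
  [set t | `|complex.Im (f t) - ratr q| < n.+1%:R^-1])//.
apply: measurableI; rewrite -[X in measurable X]setTI.
- apply: (measurable_fun_ltr (f := fun t => `|complex.Re (f t) - ratr p|)) => //.
  by apply: measurableT_comp => //; exact: measurable_funB.
- apply: (measurable_fun_ltr (f := fun t => `|complex.Im (f t) - ratr q|)) => //.
  by apply: measurableT_comp => //; exact: measurable_funB.
Qed.

End complex_measurability.

Lemma cmeasurable_comp d d' (T : measurableType d) (T' : measurableType d')
    (R : realType) (f : T' -> R[i]) (h : T -> T') :
  cmeasurable [set: T'] f -> measurable_fun [set: T] h ->
  cmeasurable [set: T] (f \o h).
Proof.
by move=> [f1 f2] mh; split; [exact: (measurableT_comp f1 mh)|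
  exact: (measurableT_comp f2 mh)].
Qed.

Section circle_measurability.
Variable R : realType.

Lemma cmeasurable_circle_val :
  cmeasurable [set: circle R] (@circle_val R).
Proof.
apply/measurable_borelC.
apply: (@measurability _ _ _ (borelC R) setT _ (@open R[i])) => //.
move=> _ [U oU <-]; rewrite setTI; apply: sub_sigma_algebra.
by exists U => //; rewrite setTI.
Qed.

Lemma measurable_circleP d (T : measurableType d) (f : T -> circle R) :
  measurable_fun [set: T] f <->
  cmeasurable [set: T] (fun t => circle_val (f t)).
Proof.
split=> [mf|/measurable_borelC mf].
  exact: (cmeasurable_comp cmeasurable_circle_val).
apply: (@measurability _ _ _ _ _ _ (@circle_open R)) => //.
move=> _ [_ [U oU <-] <-]; rewrite !setTI -[X in measurable X]setTI.
by apply: mf => //; exact: sub_sigma_algebra.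
Qed.

Lemma circle_val_inj : injective (@circle_val R).
Proof. exact: val_inj. Qed.

Lemma normc_circle (z : circle R) : normc (circle_val z) = 1.
Proof. exact/eqP/circleP. Qed.

End circle_measurability.

Lemma bounded_integrable d (T : measurableType d) (R : realType)
    (mu : {finite_measure set T -> \bar R}) (f : T -> R) (M : R) :
  measurable_fun [set: T] f -> (forall x, `|f x| <= M) ->
  mu.-integrable [set: T] (EFin \o f).
Proof.
move=> mf fM; apply: measurable_bounded_integrable => //.
  by rewrite -ge0_fin_numE//; exact: fin_num_measure.
exists M; split; first exact: num_real.
by move=> x Mx y _; exact: le_trans (fM y) (ltW Mx).
Qed.

Lemma normr_Rintegral_le d (T : measurableType d) (R : realType)
    (P : probability T R) (f : T -> R) (M : R) :
  measurable_fun [set: T] f -> (forall x, `|f x| <= M) ->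
  `|\int[P]_x f x| <= M.
Proof.
move=> mf fM; have fi := bounded_integrable P mf fM.
apply: (le_trans (le_normr_Rintegral measurableT fi)).
have -> : M = \int[P]_x (cst M x).
  rewrite Rintegral_cst// [X in fine X](_ : _ = 1%E) ?mulr1//.
  exact: probability_setT.
apply: le_Rintegral => //; first exact: integrable_norm.
exact: finite_measure_integrable_cst.
Qed.

Lemma geometric_lt (R : realType) (r e : R) :
  0 <= r -> r < 1 -> 0 < e -> exists n : nat, r ^+ n < e.
Proof.
move=> r0 r1 e0.
have : r ^+ n @[n --> \oo] --> 0 by apply: cvg_expr; rewrite ger0_norm.
move=> /cvgrPdist_lt/(_ e e0)[n _ /(_ n (leqnn _))].
by rewrite sub0r normrN ger0_norm ?exprn_ge0// => rn; exists n.
Qed.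

(** * Lebesgue measure on the circle and the integrals of monomials *)

Section haar_integral.
Variable R : realType.
Local Notation m := (@haar R).

Lemma ge0_integral_haar (f : circle R -> \bar R) :
  measurable_fun [set: circle R] f -> (forall z, 0 <= f z)%E ->
  (\int[m]_z f z =
   \int[@lebesgue_measure R]_(t in `[0%R, 1%R]) f (circle_exp t))%E.
Proof.
move=> mf f0.
rewrite (ge0_integral_transport (mu := uniform_prob (@ltr01 R))
  (@measurable_circle_exp R) _ mf f0)//.
rewrite integral_uniform//; first by rewrite subr0 invr1 mul1e.
by apply: measurableT_comp => //; exact: measurable_circle_exp.
Qed.

Lemma Rintegral_haar_cst (c : R) : \int[m]_z c = c.
Proof.
rewrite Rintegral_cst// [X in fine X](_ : _ = 1%E) ?mulr1//.
exact: probability_setT.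
Qed.

Lemma circle_expX (t : R) n :
  (circle_exp t : R[i]) ^+ n = circle_exp (n%:R * t).
Proof.
elim: n => [|n IHn].
  by rewrite expr0 /circle_exp/= mul0r mulr0 cos0 sin0.
have E : 2 * pi * (n.+1%:R * t) = 2 * pi * t + 2 * pi * (n%:R * t).
  by rewrite -natr1; ring.
rewrite exprS IHn /circle_exp/= E cosD sinD.
by apply/eqP; rewrite eq_complex; apply/andP; split; apply/eqP => /=; ring.
Qed.

Let cX (z : circle R) n : `|complex.Re (circle_val z ^+ n)| <= 1.
Proof.
apply: le_trans (normr_Re_le _) _.
elim: n => [|n IHn]; first by rewrite expr0 normc1.
by rewrite exprS normcM normc_circle mul1r.
Qed.

Let sX (z : circle R) n : `|complex.Im (circle_val z ^+ n)| <= 1.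
Proof.
apply: le_trans (normr_Im_le _) _.
elim: n => [|n IHn]; first by rewrite expr0 normc1.
by rewrite exprS normcM normc_circle mul1r.
Qed.

Let mX n : cmeasurable [set: circle R] (fun z => circle_val z ^+ n).
Proof. by apply: cmeasurableX; exact: cmeasurable_circle_val. Qed.

Let circle_exp_nat n : (circle_exp n%:R : R[i]) = 1.
Proof.
have : (circle_exp 1 : R[i]) ^+ n = circle_exp (n%:R * 1) by exact: circle_expX.
rewrite mulr1 => <-.
rewrite (_ : (circle_exp 1 : R[i]) = 1) ?expr1n//.
by rewrite /circle_exp/= mulr1 mulr_natl cos2pi sin2pi.
Qed.

Let cos_2pin n : cos (2 * pi * n%:R) = 1 :> R.
Proof. by have /(congr1 (@complex.Re R)) := circle_exp_nat n. Qed.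

Let sin_2pin n : sin (2 * pi * n%:R) = 0 :> R.
Proof. by have /(congr1 (@complex.Im R)) := circle_exp_nat n. Qed.

(** The formula [ge0_integral_haar] concerns nonnegative functions, hence the detour by [1 + f],
    with primitive [t + F t]: its integral is 1 because F takes the same value at both ends. *)
Let Rintegral_by_FTC (f : circle R -> R) (F : R -> R) :
  measurable_fun [set: circle R] f -> (forall z, `|f z| <= 1) ->
  continuous (fun t : R => f (circle_exp t)) ->
  (forall t : R, is_derive t 1 F (f (circle_exp t))) ->
  F 1 = F 0 -> \int[m]_z f z = 0.
Proof.
move=> mf f1 cf dF F10.
have if1 := bounded_integrable m mf f1.
have i1 : m.-integrable [set: circle R] (EFin \o cst 1).
  exact: finite_measure_integrable_cst.
have dG (t : R) : is_derive t 1 (fun u : R => u + F u) (1 + f (circle_exp t)).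
  exact: is_deriveD.
have E : (\int[m]_z (1 + f z)%:E = 1)%E.
  rewrite ge0_integral_haar; last 2 first.
  - by apply/measurable_EFinP; exact: measurable_funD.
  - by move=> z; rewrite lee_fin; have := f1 z; rewrite ler_norml; lra.
  have cG : continuous (fun u : R => u + F u).
    move=> t; apply: differentiable_continuous; apply/derivable1_diffP.
    by have [] := dG t.
  rewrite (@continuous_FTC2 _ (fun t => 1 + f (circle_exp t)) (fun u => u + F u))//.
  - by rewrite -EFinB add0r F10 -addrA subrr addr0.
  - apply: continuous_subspaceT => t; apply: continuousD; last exact: cf.
    exact: cvg_cst.
  - split.
    + by move=> t _; have [] := dG t.
    + by apply: cvg_at_right_filter; exact: cG.
    + by apply: cvg_at_left_filter; exact: cG.
  - by move=> t _; rewrite derive1E; have [_] := dG t.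
have : \int[m]_z (1 + f z) = 1 by rewrite /Rintegral E.
rewrite RintegralD// Rintegral_haar_cst => /eqP.
by rewrite -subr_eq0 addrAC subrr add0r => /eqP.
Qed.

Lemma Rintegral_Re_circleX n : (0 < n)%N ->
  \int[m]_z complex.Re (circle_val z ^+ n) = 0.
Proof.
move=> n0.
have pn0 : 2 * pi * n%:R != 0 :> R.
  by rewrite mulf_neq0 ?pnatr_eq0 -?lt0n// mulf_neq0 ?pnatr_eq0// gt_eqF ?pi_gt0.
apply: (@Rintegral_by_FTC _ (fun t => (2 * pi * n%:R)^-1 * sin (2 * pi * n%:R * t))).
- by have [] := mX n.
- exact: (cX ^~ n).
- move=> t; under eq_fun do rewrite circle_expX/= mulrA.
  apply: continuous_comp; last exact: continuous_cos.
  exact: mulrl_continuous.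
- move=> t; rewrite circle_expX/= mulrA; apply: is_derive_eq.
  by rewrite /GRing.scale/= mulr1; move: pn0; move: (2 * pi * n%:R) => k k0; field.
- by rewrite mulr1 mulr0 sin0 sin_2pin.
Qed.

Lemma Rintegral_Im_circleX n : (0 < n)%N ->
  \int[m]_z complex.Im (circle_val z ^+ n) = 0.
Proof.
move=> n0.
have pn0 : 2 * pi * n%:R != 0 :> R.
  by rewrite mulf_neq0 ?pnatr_eq0 -?lt0n// mulf_neq0 ?pnatr_eq0// gt_eqF ?pi_gt0.
apply: (@Rintegral_by_FTC _ (fun t => - (2 * pi * n%:R)^-1 * cos (2 * pi * n%:R * t))).
- by have [] := mX n.
- exact: (sX ^~ n).
- move=> t; under eq_fun do rewrite circle_expX/= mulrA.
  apply: continuous_comp; last exact: continuous_sin.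
  exact: mulrl_continuous.
- move=> t; rewrite circle_expX/= mulrA; apply: is_derive_eq.
  by rewrite /GRing.scale/= mulr1; move: pn0; move: (2 * pi * n%:R) => k k0; field.
- by rewrite mulr1 mulr0 cos0 cos_2pin.
Qed.

End haar_integral.

(** * The disc algebra *)

Section disc_algebra.
Variable R : realType.
Local Notation C := R[i].
Local Notation m := (@haar R).
Implicit Types F G : C -> C.

(** Uniform approximation by polynomials is the form of holomorphy used throughout: it makes the
    mean value property a statement about monomials, and it passes to products, compositions and
    geometric series. *)
Definition disc_algebra F : Prop := forall e : R, 0 < e ->
  exists p : {poly C}, forall z, normc z <= 1 -> normc (F z - p.[z]) <= e.

Lemma horner_bounded (p : {poly C}) :
  exists M : R, forall z, normc z <= 1 -> normc p.[z] <= M.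
Proof.
elim/poly_ind: p => [|p c [M hM]].
  by exists 0 => z _; rewrite horner0 normc0.
exists (M + normc c) => z z1; rewrite hornerMXaddC.
apply: le_trans (normcD_le _ _) _; rewrite lerD2r normcM.
have M0 := le_trans (normc_ge0 _) (hM z z1).
apply: le_trans (hM z z1).
by rewrite ler_piMr// normc_ge0.
Qed.

Lemma disc_algebra_bounded F : disc_algebra F ->
  exists2 M : R, 0 < M & forall z, normc z <= 1 -> normc (F z) <= M.
Proof.
move=> /(_ 1 ltr01)[p hp]; have [M hM] := horner_bounded p.
exists (1 + `|M|); first by rewrite ltr_wpDr.
move=> z z1; rewrite -(subrK p.[z] (F z)).
apply: le_trans (normcD_le _ _) _; apply: lerD; first exact: hp.
exact: le_trans (hM z z1) (ler_norm _).
Qed.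

Lemma disc_algebra_poly (p : {poly C}) : disc_algebra (fun z => p.[z]).
Proof. by move=> e e0; exists p => z _; rewrite subrr normc0 ltW. Qed.

Lemma disc_algebra_cst (c : C) : disc_algebra (cst c).
Proof.
by move=> e e0; exists c%:P => z _; rewrite hornerC subrr normc0 ltW.
Qed.

Lemma disc_algebra_id : disc_algebra id.
Proof.
by move=> e e0; exists 'X => z _; rewrite hornerX subrr normc0 ltW.
Qed.

Lemma disc_algebraD F G : disc_algebra F -> disc_algebra G ->
  disc_algebra (fun z => F z + G z).
Proof.
move=> hF hG e e0; have e20 : 0 < e / 2 by rewrite divr_gt0.
have [p hp] := hF _ e20; have [q hq] := hG _ e20.
exists (p + q) => z z1; rewrite hornerD.
rewrite (_ : _ - _ = (F z - p.[z]) + (G z - q.[z])); last by ring.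
apply: le_trans (normcD_le _ _) _; rewrite [leRHS]splitr.
by apply: lerD; [exact: hp|exact: hq].
Qed.

Lemma disc_algebraM F G : disc_algebra F -> disc_algebra G ->
  disc_algebra (fun z => F z * G z).
Proof.
move=> hF hG e e0.
have [M M0 hM] := disc_algebra_bounded hF.
have [q hq] := hG (e / 2 / M) (divr_gt0 (divr_gt0 e0 (ltr0Sn _ _)) M0).
have [N N0 hN] := disc_algebra_bounded (disc_algebra_poly q).
have [p hp] := hF (e / 2 / N) (divr_gt0 (divr_gt0 e0 (ltr0Sn _ _)) N0).
exists (p * q) => z z1; rewrite hornerM.
rewrite (_ : _ - _ = F z * (G z - q.[z]) + (F z - p.[z]) * q.[z]); last by ring.
apply: le_trans (normcD_le _ _) _; rewrite [leRHS]splitr !normcM.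
apply: lerD.
  rewrite -[leRHS](divfK (lt0r_neq0 M0)) mulrC.
  by apply: ler_pM (hq _ z1) (hM _ z1); exact: normc_ge0.
rewrite -[leRHS](divfK (lt0r_neq0 N0)).
by apply: ler_pM (hp _ z1) (hN _ z1); exact: normc_ge0.
Qed.

Lemma disc_algebraX F n : disc_algebra F -> disc_algebra (fun z => F z ^+ n).
Proof.
move=> hF; elim: n => [|n IHn].
  by under eq_fun do rewrite expr0; exact: disc_algebra_cst.
by under eq_fun do rewrite exprS; exact: disc_algebraM.
Qed.

Lemma disc_algebra_sum (I : Type) (r : seq I) (H : I -> C -> C) :
  (forall i, disc_algebra (H i)) -> disc_algebra (fun z => \sum_(i <- r) H i z).
Proof.
move=> hH; elim: r => [|i r IHr].
  by under eq_fun do rewrite big_nil; exact: disc_algebra_cst.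
by under eq_fun do rewrite big_cons; exact: disc_algebraD.
Qed.

Lemma disc_algebra_prod (I : eqType) (r : seq I) (H : I -> C -> C) :
  {in r, forall i, disc_algebra (H i)} ->
  disc_algebra (fun z => \prod_(i <- r) H i z).
Proof.
elim: r => [|i r IHr] hH.
  by under eq_fun do rewrite big_nil; exact: disc_algebra_cst.
under eq_fun do rewrite big_cons; apply: disc_algebraM.
  by apply: hH; rewrite mem_head.
by apply: IHr => j jr; apply: hH; rewrite in_cons jr orbT.
Qed.

Lemma disc_algebra_closed F :
  (forall e : R, 0 < e -> exists2 G, disc_algebra G &
    forall z, normc z <= 1 -> normc (F z - G z) <= e) -> disc_algebra F.
Proof.
move=> hF e e0; have e20 : 0 < e / 2 by rewrite divr_gt0.
have [G hG FG] := hF _ e20; have [p hp] := hG _ e20.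
exists p => z z1; rewrite -(subrKA (G z)).
apply: le_trans (normcD_le _ _) _; rewrite [leRHS]splitr.
by apply: lerD; [exact: FG|exact: hp].
Qed.

Lemma disc_algebra_comp F G : disc_algebra F -> disc_algebra G ->
  (forall z, normc z <= 1 -> normc (G z) <= 1) -> disc_algebra (F \o G).
Proof.
move=> hF hG G1; apply: disc_algebra_closed => e e0.
have [p hp] := hF e e0; exists (fun z => p.[G z]); last first.
  by move=> z z1; apply: hp; exact: G1.
elim/poly_ind: p {hp} => [|p c IHp].
  by under eq_fun do rewrite horner0; exact: disc_algebra_cst.
under eq_fun do rewrite hornerMXaddC.
by apply: disc_algebraD; [exact: disc_algebraM|exact: disc_algebra_cst].
Qed.

Lemma normc_1B_gt0 (u : C) : normc u < 1 -> 0 < normc (1 - u).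
Proof.
move=> u1; apply: lt_le_trans (normc_sub_le _ _).
by rewrite normc1 subr_gt0.
Qed.

Lemma normcX (u : C) n : normc (u ^+ n) = normc u ^+ n.
Proof.
by elim: n => [|n IHn]; rewrite ?expr0 ?normc1// !exprS normcM IHn.
Qed.

(** The remainder of the geometric series after n terms is [F z ^+ n / (1 - F z)], at most r^n / (1
    - r). All the denominators of Moebius maps and Poisson kernels enter the disc algebra in this
    way. *)
Lemma disc_algebra_geometric F (r : R) : disc_algebra F -> r < 1 ->
  (forall z, normc z <= 1 -> normc (F z) <= r) ->
  disc_algebra (fun z => (1 - F z)^-1).
Proof.
move=> hF r1 Fr; apply: disc_algebra_closed => e e0.
have r0 : 0 <= r by rewrite (le_trans (normc_ge0 (F 0)))// Fr// normc0.
have s0 : 0 < 1 - r by rewrite subr_gt0.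
have [n rn] := geometric_lt r0 r1 (mulr_gt0 e0 s0).
exists (fun z => \sum_(k < n) F z ^+ k).
  have := disc_algebra_sum (index_enum 'I_n) (fun i => disc_algebraX i hF).
  by [].
move=> z z1; have Fz := Fr z z1.
have n0 : 0 < normc (1 - F z) by apply: normc_1B_gt0; exact: le_lt_trans r1.
rewrite (_ : _ - _ = F z ^+ n / (1 - F z)); last first.
  have u0 : 1 - F z != 0 by rewrite -normc_gt0.
  have S : (1 - F z) * \sum_(k < n) F z ^+ k = 1 - F z ^+ n.
    by rewrite -opprB mulNr -subrX1 opprB.
  by apply: (mulIf u0); rewrite mulrBl mulVf// divfK// [X in _ - X]mulrC S subKr.
rewrite normcM normcV normcX ler_pdivrMr//.
apply: le_trans (_ : r ^+ n <= _); first by rewrite lerXn2r// nnegrE normc_ge0.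
apply: le_trans (ltW rn) _; rewrite ler_pM2l//.
apply: le_trans (normc_sub_le _ _); rewrite normc1; lra.
Qed.

Lemma cmeasurable_disc_algebra F : disc_algebra F ->
  cmeasurable [set: circle R] (fun z => F (circle_val z)).
Proof.
move=> hF.
have /choice[p hp] : forall n, exists p : {poly C},
    forall z, normc z <= 1 -> normc (F z - p.[z]) <= n.+1%:R^-1.
  by move=> n; apply: hF; rewrite invr_gt0 ltr0n.
have mp n : cmeasurable [set: circle R] (fun z => (p n).[circle_val z]).
  by apply: cmeasurable_horner; exact: cmeasurable_circle_val.
have cp (f : C -> R) : (forall z w, `|f z - f w| <= normc (z - w)) ->
    forall z : circle R, [set: circle R] z ->
    f ((p n).[circle_val z]) @[n --> \oo] --> f (F (circle_val z)).
  move=> hf z _; apply/cvgrPdist_le => e e0.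
  near=> n; apply: le_trans (hf _ _) _.
  apply: le_trans (hp _ _ _) _; first by rewrite normc_circle.
  by apply/ltW; near: n; exact: (near_infty_natSinv_lt (PosNum e0)).
split.
- apply: (measurable_fun_cvg (h := fun n z => complex.Re (p n).[circle_val z])).
    by move=> n; have [] := mp n.
  apply: cp => z w; rewrite -(raddfB (@complex.Re R : Rcomplex R -> R)).
  exact: normr_Re_le.
- apply: (measurable_fun_cvg (h := fun n z => complex.Im (p n).[circle_val z])).
    by move=> n; have [] := mp n.
  apply: cp => z w; rewrite -(raddfB (@complex.Im R : Rcomplex R -> R)).
  exact: normr_Im_le.
Unshelve. all: end_near. Qed.

Lemma integrable_Re_disc_algebra F : disc_algebra F ->
  m.-integrable [set: circle R] (fun z => (complex.Re (F (circle_val z)))%:E).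
Proof.
move=> hF; have [M _ hM] := disc_algebra_bounded hF.
apply: (bounded_integrable m (M := M)).
  by have [] := cmeasurable_disc_algebra hF.
move=> z; apply: le_trans (normr_Re_le _) _.
by apply: hM; rewrite normc_circle.
Qed.

Lemma ReD (z w : C) : complex.Re (z + w) = complex.Re z + complex.Re w.
Proof. by case: z w => [? ?] [? ?]. Qed.

Lemma ReB (z w : C) : complex.Re (z - w) = complex.Re z - complex.Re w.
Proof. by case: z w => [? ?] [? ?]. Qed.

Lemma ReM (z w : C) : complex.Re (z * w) =
  complex.Re z * complex.Re w - complex.Im z * complex.Im w.
Proof. by case: z w => [? ?] [? ?]. Qed.

Let Rintegral_ReD F G : disc_algebra F -> disc_algebra G ->
  \int[m]_z complex.Re (F (circle_val z) + G (circle_val z)) =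
  \int[m]_z complex.Re (F (circle_val z)) +
  \int[m]_z complex.Re (G (circle_val z)).
Proof.
move=> hF hG; rewrite -RintegralD//; last 2 first.
- exact: integrable_Re_disc_algebra.
- exact: integrable_Re_disc_algebra.
by apply: eq_Rintegral => z _; rewrite ReD.
Qed.

Let Rintegral_Re_monomial (c : C) n : (0 < n)%N ->
  \int[m]_z complex.Re (c * circle_val z ^+ n) = 0.
Proof.
move=> n0.
have [m1 m2] := cmeasurableX n (cmeasurable_circle_val R).
have b (z : circle R) : normc (circle_val z ^+ n) = 1.
  by rewrite normcX normc_circle expr1n.
have i1 : m.-integrable setT (fun z => (complex.Re (circle_val z ^+ n))%:E).
  by apply: (bounded_integrable m m1 (M := 1)) => z; rewrite -(b z) normr_Re_le.
have i2 : m.-integrable setT (fun z => (complex.Im (circle_val z ^+ n))%:E).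
  by apply: (bounded_integrable m m2 (M := 1)) => z; rewrite -(b z) normr_Im_le.
under eq_Rintegral do rewrite ReM.
rewrite RintegralB//; last 2 first.
- exact: (integrableZl measurableT (complex.Re c) i1).
- exact: (integrableZl measurableT (complex.Im c) i2).
rewrite !RintegralZl// Rintegral_Re_circleX// Rintegral_Im_circleX//.
by rewrite !mulr0 subrr.
Qed.

Lemma mean_value_poly (p : {poly C}) :
  \int[m]_z complex.Re p.[circle_val z] = complex.Re p.[0].
Proof.
have zero (q : {poly C}) k : (0 < k)%N ->
    \int[m]_z complex.Re (q.[circle_val z] * circle_val z ^+ k) = 0.
  elim/poly_ind: q k => [|q c IHq] k k0.
    under eq_Rintegral do rewrite horner0 mul0r.
    by rewrite Rintegral_haar_cst.
  under eq_Rintegral do rewrite hornerMXaddC mulrDl -mulrA -exprS.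
  rewrite (Rintegral_ReD (F := fun z => q.[z] * z ^+ k.+1)
    (G := fun z => c * z ^+ k)) ?IHq ?Rintegral_Re_monomial ?addr0//.
  - apply: disc_algebraM; first exact: disc_algebra_poly.
    by apply: disc_algebraX; exact: disc_algebra_id.
  - apply: disc_algebraM; first exact: disc_algebra_cst.
    by apply: disc_algebraX; exact: disc_algebra_id.
elim/poly_ind: p => [|p c _].
  under eq_Rintegral do rewrite horner0.
  by rewrite Rintegral_haar_cst horner0.
under eq_Rintegral do rewrite hornerMXaddC.
rewrite (Rintegral_ReD (F := fun z => p.[z] * z) (G := cst c)); last 2 first.
- by apply: disc_algebraM; [exact: disc_algebra_poly|exact: disc_algebra_id].
- exact: disc_algebra_cst.
by rewrite (zero p 1)// Rintegral_haar_cst add0r hornerMXaddC mulr0 add0r.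
Qed.

Theorem mean_value F : disc_algebra F ->
  \int[m]_z complex.Re (F (circle_val z)) = complex.Re (F 0).
Proof.
move=> hF; apply/eqP; rewrite -subr_eq0 -normr_le0.
apply/ler_addgt0Pr => e e0; rewrite add0r.
have e20 : 0 < e / 2 by rewrite divr_gt0.
have [p hp] := hF _ e20.
rewrite -(subrKA (complex.Re p.[0])) (le_trans (ler_normD _ _))//.
rewrite [leRHS]splitr; apply: lerD; last first.
  by rewrite -ReB (le_trans (normr_Re_le _))// normc_subC hp// normc0.
rewrite -mean_value_poly -RintegralB//; last 2 first.
- exact: integrable_Re_disc_algebra.
- by apply: integrable_Re_disc_algebra; exact: disc_algebra_poly.
apply: normr_Rintegral_le.
  apply: measurable_funB; first by have [] := cmeasurable_disc_algebra hF.
  by have [] := cmeasurable_disc_algebra (disc_algebra_poly p).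
move=> z; rewrite -ReB (le_trans (normr_Re_le _))// hp//.
by rewrite normc_circle.
Qed.

End disc_algebra.

(** * Poisson kernels *)

Section bounded_Fubini.
Context d1 d2 (X : measurableType d1) (Y : measurableType d2) (R : realType).
Variables (m1 : {finite_measure set X -> \bar R})
  (m2 : {finite_measure set Y -> \bar R}).
Variables (f : X * Y -> R) (M : R).
Hypotheses (mf : measurable_fun [set: X * Y] f) (fM : forall p, `|f p| <= M).

Let intf : (m1 \x m2)%E.-integrable [set: X * Y] (EFin \o f).
Proof.
apply: measurable_bounded_integrable => //.
  rewrite -setXTT [X in (X < _)%E](_ : _ = m1 setT * m2 setT)%E.
    by rewrite lte_mul_pinfty// ?fin_num_measure// -ge0_fin_numE// fin_num_measure.
  exact: product_measure1E.
exists M; split; first exact: num_real.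
by move=> x Mx y _; exact: le_trans (fM y) (ltW Mx).
Qed.

Lemma measurable_Rintegral1 :
  measurable_fun [set: X] (fun x => \int[m2]_y f (x, y)).
Proof.
exact: (measurableT_comp (fine_measurable measurableT)
  (measurable_fubini_F intf)).
Qed.

Lemma measurable_Rintegral2 :
  measurable_fun [set: Y] (fun y => \int[m1]_x f (x, y)).
Proof.
exact: (measurableT_comp (fine_measurable measurableT)
  (measurable_fubini_G intf)).
Qed.

Lemma Rintegral_Fubini :
  \int[m1]_x \int[m2]_y f (x, y) = \int[m2]_y \int[m1]_x f (x, y).
Proof.
have E1 x : (\int[m2]_y (f (x, y))%:E = (\int[m2]_y f (x, y))%:E)%E.
  rewrite /Rintegral fineK//; apply: integrable_fin_num => //.
  apply: (bounded_integrable m2 (M := M)) => //.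
  exact: (measurableT_comp mf).
have E2 y : (\int[m1]_x (f (x, y))%:E = (\int[m1]_x f (x, y))%:E)%E.
  rewrite /Rintegral fineK//; apply: integrable_fin_num => //.
  apply: (bounded_integrable m1 (M := M)) => //.
  exact: (measurableT_comp mf).
have := Fubini intf.
under eq_integral do rewrite /= E1.
under [X in _ = X -> _]eq_integral do rewrite /= E2.
by move=> /(congr1 fine).
Qed.

End bounded_Fubini.

Section poisson_kernel.
Variable R : realType.
Local Notation C := R[i].
Local Notation m := (@haar R).
Implicit Types (w c : C) (z y : circle R).

Lemma normc_sub_circle_gt0 w z : normc w < 1 -> 0 < normc (circle_val z - w).
Proof.
move=> w1; apply: lt_le_trans (normc_sub_le _ _).
by rewrite normc_circle subr_gt0.
Qed.

Lemma sqr_normc_lt1 w : normc w < 1 -> 0 < 1 - normc w ^+ 2.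
Proof. by move=> w1; rewrite subr_gt0 expr_lt1// normc_ge0. Qed.

Lemma poisson_ge0 w z : normc w < 1 -> 0 <= poisson w z.
Proof.
by move=> w1; rewrite divr_ge0 ?exprn_ge0 ?normc_ge0// ltW// sqr_normc_lt1.
Qed.

Lemma poisson_le w z : normc w < 1 -> poisson w z <= 4 / (1 - normc w ^+ 2).
Proof.
move=> w1; have d0 := sqr_normc_lt1 w1; have n0 := normc_ge0 w.
have z0 := normc_sub_circle_gt0 z w1.
rewrite /poisson ler_pdivrMr ?exprn_gt0// mulrAC ler_pdivlMr//.
have h : 1 - normc w <= normc (circle_val z - w).
  by rewrite -(normc_circle z) normc_sub_le.
have h2 : 1 - normc w ^+ 2 <= 2 * normc (circle_val z - w).
  by apply: le_trans (_ : 2 * (1 - normc w) <= _); nra.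
rewrite -expr2 (_ : 4 * _ = (2 * normc (circle_val z - w)) ^+ 2); last by ring.
by rewrite lerXn2r// nnegrE ltW// mulr_gt0.
Qed.

Lemma poisson_ge w z : normc w < 1 -> (1 - normc w ^+ 2) / 4 <= poisson w z.
Proof.
move=> w1; have d0 := sqr_normc_lt1 w1.
rewrite /poisson ler_pM2l// lef_pV2 ?posrE ?exprn_gt0 ?normc_sub_circle_gt0//.
rewrite (_ : 4 = 2 ^+ 2 :> R); last by ring.
rewrite lerXn2r// ?nnegrE ?normc_ge0//.
apply: le_trans (normcD_le _ _) _; rewrite normc_circle normc_opp; lra.
Qed.

Lemma normr_poisson_le w z : normc w < 1 ->
  `|poisson w z| <= 4 / (1 - normc w ^+ 2).
Proof. by move=> w1; rewrite ger0_norm ?poisson_ge0 ?poisson_le. Qed.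

Lemma measurable_poisson2 d (T : measurableType d) (f : T -> C)
    (g : T -> circle R) :
  cmeasurable [set: T] f -> measurable_fun [set: T] g ->
  measurable_fun [set: T] (fun t => poisson (f t) (g t)).
Proof.
move=> mf /measurable_circleP mg; apply: measurable_funM.
  by apply: measurable_funB => //; exact: measurable_sqr_normc.
apply: measurable_funV => //; apply: measurable_sqr_normc.
exact: cmeasurableB.
Qed.

Lemma measurable_poisson w : measurable_fun [set: circle R] (poisson w).
Proof.
by apply: measurable_poisson2; [exact: cmeasurable_cst|exact: measurable_id].
Qed.

Lemma integrable_poisson (mu : {finite_measure set (circle R) -> \bar R}) w :
  normc w < 1 -> mu.-integrable [set: circle R] (EFin \o poisson w).
Proof.
move=> w1; apply: (bounded_integrable mu (M := 4 / (1 - normc w ^+ 2))).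
  exact: measurable_poisson.
by move=> z; exact: normr_poisson_le.
Qed.

(** This is [Re ((1 + u) / (1 - u))] with u the product of z and the conjugate of w: on the circle
    the kernel is the real part of a function of the disc algebra. *)
Lemma poissonE w z : normc w < 1 ->
  poisson w z = 2 * complex.Re (1 - w^*%C * circle_val z)^-1 - 1.
Proof.
move=> w1; have := normc_sub_circle_gt0 z w1; rewrite /poisson.
have : normc (circle_val z) ^+ 2 = 1 by rewrite normc_circle expr1n.
move=> + /lt0r_neq0 d0; have {d0} : normc (circle_val z - w) ^+ 2 != 0.
  by rewrite expf_neq0.
rewrite !sqr_normcE.
case: (circle_val z) w w1 => x y [a b] _ /= d0 zz.
(* The two denominators agree on the circle, since in general their squared moduli differ by (1 -
   |z|^2) (1 - |w|^2). *)
have E : (1 + - (a * x - - b * y)) ^+ 2 + (0 + - (a * y + - b * x)) ^+ 2 =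
         (x + - a) ^+ 2 + (y + - b) ^+ 2.
  apply/eqP; rewrite -subr_eq0; apply/eqP.
  transitivity ((1 - (x ^+ 2 + y ^+ 2)) * (1 - (a ^+ 2 + b ^+ 2))); first by ring.
  by rewrite zz subrr mul0r.
rewrite E; apply: (mulIf d0); rewrite divfK// mulrBl -mulrA divfK// mul1r.
move: zz => /eqP; rewrite -subr_eq0 => /eqP zz.
by apply/eqP; rewrite -subr_eq0 -[X in _ == X]zz; apply/eqP; ring.
Qed.

(** Composing the analytic expression of the kernel with S stays in the disc algebra, so the
    integral is the value at 0. *)
Lemma Rintegral_poisson_comp (S : C -> C) (Sc : circle R -> circle R) w :
  disc_algebra S -> (forall z : C, normc z <= 1 -> normc (S z) <= 1) ->
  (forall z, circle_val (Sc z) = S (circle_val z)) -> normc w < 1 ->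
  \int[m]_z poisson w (Sc z) = 2 * complex.Re (1 - w^*%C * S 0)^-1 - 1.
Proof.
move=> hS S1 ScE w1.
have hF : disc_algebra (fun z : C => 2 * (1 - w^*%C * S z)^-1 - 1).
  apply: disc_algebraD; last exact: disc_algebra_cst.
  apply: disc_algebraM; first exact: disc_algebra_cst.
  apply: (@disc_algebra_geometric _ _ (normc w)) => //.
    by apply: disc_algebraM => //; exact: disc_algebra_cst.
  move=> z z1; rewrite normcM normc_conj.
  by rewrite ler_piMr ?normc_ge0// S1.
have E (u : C) : complex.Re (2 * u - 1) = 2 * complex.Re u - 1.
  by rewrite (_ : 2 * u - 1 = u + u - 1); [case: u => x y /=|]; ring.
have := mean_value hF; rewrite E => <-.
by apply: eq_Rintegral => z _; rewrite poissonE// ScE E.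
Qed.

Lemma normcM_lt1 w c : normc w < 1 -> normc c <= 1 -> normc (w^*%C * c) < 1.
Proof.
move=> w1 c1; rewrite normcM normc_conj.
by apply: le_lt_trans w1; rewrite ler_piMr// normc_ge0.
Qed.

(* On the circle, 1/(1-u) + 1/(1-v) - 1 = (1-uv)/((1-u)(1-v)) with
   u = conj w * z, v = c * conj z turns the product of the two kernels into the
   real part of a function of the disc algebra. *)
Lemma Rintegral_poissonM w c : normc w < 1 -> normc c < 1 ->
  \int[m]_z (poisson w z * poisson c z) =
  2 * complex.Re (1 - w^*%C * c)^-1 - 1.
Proof.
move=> w1 c1; pose k : C := (1 - w^*%C * c)^-1.
pose G (w z : C) : C := (1 - w^*%C * z)^-1.
have hG v : normc v < 1 -> disc_algebra (G v).
  move=> v1; apply: (@disc_algebra_geometric _ _ (normc v)) => //.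
    by apply: disc_algebraM; [exact: disc_algebra_cst|exact: disc_algebra_id].
  by move=> z z1; rewrite normcM normc_conj ler_piMr// normc_ge0.
(* Expand the product of the kernels with 4 Re a Re b = 2 Re (a b) + 2 Re (a conj b), for a =
   [G w z] and b = [G c z]. By [kz] below, a conj b = k (a + conj b - 1), and k conj b has the same
   real part as b conj k. *)
pose F (z : C) : C := 2 * (G w z * G c z) + 2 * k * G w z + 2 * k^*%C * G c z
  + (1 - 2 * k) + (-2) * G w z + (-2) * G c z.
have hF : disc_algebra F.
  have hw := hG w w1; have hc := hG c c1.
  have hk (e : C) v : normc v < 1 -> disc_algebra (fun z : C => e * G v z).
    by move=> v1; apply: disc_algebraM; [exact: disc_algebra_cst|exact: hG].
  do 2 (apply: disc_algebraD; last exact: hk).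
  apply: disc_algebraD; last exact: disc_algebra_cst.
  do 2 (apply: disc_algebraD; last exact: hk).
  by apply: disc_algebraM; [exact: disc_algebra_cst|exact: disc_algebraM].
have := mean_value hF.
have -> : complex.Re (F 0) = 2 * complex.Re k - 1.
  rewrite /F /G !mulr0 subr0 invr1 !mulr1.
  rewrite (_ : _ + _ = k^*%C + k^*%C - 1); last by ring.
  by move: (k) => [x y] /=; ring.
rewrite -/k => <-; apply: eq_Rintegral => z _; rewrite !poissonE//.
have kz : k * (G w (circle_val z) + (G c (circle_val z))^*%C - 1) =
    G w (circle_val z) * (G c (circle_val z))^*%C.
  have zz : circle_val z * (circle_val z)^*%C = 1.
    by rewrite -sqr_normc [`|_|]/(normc _)%:C%C normc_circle expr1n.
  have n1 : 1 - w^*%C * c != 0.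
    by rewrite -normc_gt0 normc_1B_gt0// normcM_lt1// ltW.
  have n2 : 1 - w^*%C * circle_val z != 0.
    by rewrite -normc_gt0 normc_1B_gt0// normcM_lt1// normc_circle.
  have n3 : 1 - c * (circle_val z)^*%C != 0.
    rewrite -normc_gt0 normc_1B_gt0// -[c]conjcK normcM_lt1// normc_conj//.
    by rewrite normc_circle.
  have -> : (G c (circle_val z))^*%C = (1 - c * (circle_val z)^*%C)^-1.
    rewrite /G conjc_inv rmorphB rmorphM rmorph1/=.
    by case: (c) => p q /=; rewrite opprK.
  rewrite /k /G; apply: (mulfI n1); apply: (mulfI n2); apply: (mulfI n3).
  have E u v e : e != 0 -> u != 0 -> v != 0 ->
      v * (u * (e * (e^-1 * (u^-1 + v^-1 - 1)))) = u + v - u * v :> C.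
    by move=> e0 u0 v0; field; rewrite u0 v0 e0.
  rewrite E//.
  have E' u v e : u != 0 -> v != 0 ->
      v * (u * (e * (u^-1 * v^-1))) = e :> C.
    by move=> u0 v0; field; rewrite u0 v0.
  rewrite E'//.
  rewrite (_ : _ + _ - _ = 1 - w^*%C * c * (circle_val z * (circle_val z)^*%C));
    last by ring.
  by rewrite zz mulr1.
rewrite -!/(G _ _) /F.
move: (circle_val z) kz => {}z.
move: (G w z) (G c z) (k) => [a1 b1] [a2 b2] [a3 b3] E; move: E.
by move=> /(congr1 (@complex.Re R)) /=; lra.
Qed.

Lemma Rintegral_poisson w : normc w < 1 -> \int[m]_z poisson w z = 1.
Proof.
move=> w1; have := @Rintegral_poissonM w 0 w1.
rewrite normc0 mulr0 subr0 invr1 mulr1/= => /(_ ltr01).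
rewrite (_ : 2 - 1 = 1); last by ring.
move=> <-; apply: eq_Rintegral => z _.
by rewrite /poisson normc0 expr0n subr0 subr0 normc_circle expr1n divr1 mulr1.
Qed.

End poisson_kernel.

(** * Averages against Poisson kernels of a fixed radius *)

Section poisson_approximation.
Variable R : realType.
Local Notation C := R[i].
Local Notation m := (@haar R).
Implicit Types (w c : C) (z y : circle R) (r : R).

Definition radial r y : C := (r%:C)%C * circle_val y.

Lemma normc_radial r y : 0 <= r -> normc (radial r y) = r.
Proof. by move=> r0; rewrite normcM normc_real normc_circle mulr1 ger0_norm. Qed.

Lemma cmeasurable_radial r : cmeasurable [set: circle R] (radial r).
Proof.
by apply: cmeasurableM; [exact: cmeasurable_cst|exact: cmeasurable_circle_val].
Qed.

(** Both denominators are 1 + r^2 - 2 r Re (y conj z). By this symmetry an average over y of the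
    kernels based at [radial r y] is the Poisson extension evaluated at [radial r z]. *)
Lemma poisson_radialC r y z : poisson (radial r y) z = poisson (radial r z) y.
Proof.
rewrite /poisson; congr (_ / _).
  by rewrite !normcM !normc_circle.
have : normc (circle_val z) ^+ 2 = 1 by rewrite normc_circle expr1n.
have : normc (circle_val y) ^+ 2 = 1 by rewrite normc_circle expr1n.
rewrite !sqr_normcE /radial; case: (circle_val z) (circle_val y) => a b [a' b'] /=.
move=> h1 h2; rewrite !mul0r !subr0 !addr0.
transitivity ((a ^+ 2 + b ^+ 2) + r ^+ 2 * (a' ^+ 2 + b' ^+ 2)
  - 2 * r * (a * a' + b * b')); first by ring.
by rewrite h1 h2; transitivity ((a' ^+ 2 + b' ^+ 2) + r ^+ 2 * (a ^+ 2 + b ^+ 2)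
  - 2 * r * (a * a' + b * b')); [rewrite h1 h2|ring].
Qed.

(** Since |y - r y| = 1 - r is at most |z - r y|, the distance |y - z| is at most twice |z - r y|;
    the 4 is the square of this 2. *)
Lemma poisson_tail r eta y z : 0 <= r -> r < 1 -> 0 < eta ->
  eta <= normc (circle_val y - circle_val z) ->
  poisson (radial r y) z <= 4 * (1 - r ^+ 2) / eta ^+ 2.
Proof.
move=> r0 r1 e0 yz.
have ry1 : normc (radial r y) < 1 by rewrite normc_radial.
have n0 := normc_sub_circle_gt0 z ry1.
have r20 : 0 < 1 - r ^+ 2 by rewrite subr_gt0 expr_lt1.
rewrite /poisson normc_radial// ler_pdivrMr ?exprn_gt0//.
rewrite mulrAC ler_pdivlMr ?exprn_gt0//.
have h1 : 1 - r <= normc (circle_val z - radial r y).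
  apply: le_trans (normc_sub_le _ _).
  by rewrite normc_circle normc_radial.
have h2 : normc (circle_val y - circle_val z) <=
    2 * normc (circle_val z - radial r y).
  rewrite normc_subC -(subrKA (radial r y)).
  apply: le_trans (normcD_le _ _) _.
  suff : normc (radial r y - circle_val y) = 1 - r by lra.
  rewrite normc_subC /radial -{1}(mul1r (circle_val y)) -mulrBl normcM normc_circle.
  rewrite mulr1 -[1]/((1%:C)%C) -(rmorphB (real_complex R)) normc_real.
  by rewrite ger0_norm// subr_ge0 ltW.
have h3 : eta ^+ 2 <= 4 * normc (circle_val z - radial r y) ^+ 2.
  rewrite (_ : 4 * _ = (2 * normc (circle_val z - radial r y)) ^+ 2); last by ring.
  rewrite lerXn2r ?nnegrE ?(ltW e0)//; first by rewrite mulr_ge0// ltW.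
  exact: le_trans yz h2.
by rewrite mulrC [leRHS]mulrAC ler_pM2r.
Qed.

Lemma measurable_poisson_radial r :
  measurable_fun [set: circle R * circle R] (fun p => poisson (radial r p.2) p.1).
Proof.
apply: measurable_poisson2; last exact: measurable_fst.
exact: (cmeasurable_comp (cmeasurable_radial r) measurable_snd).
Qed.

Definition local_majorant eta (f fp : circle R -> R) : Prop :=
  forall y z, normc (circle_val y - circle_val z) < eta -> f z <= fp y.

Lemma integrable_mul_poisson r (f : circle R -> R) (M : R) z :
  0 <= r -> r < 1 -> measurable_fun [set: circle R] f ->
  (forall y, `|f y| <= M) ->
  m.-integrable [set: circle R] (EFin \o (fun y => f y * poisson (radial r y) z)).
Proof.
move=> r0 r1 mf fM.
apply: (bounded_integrable m (M := M * (4 / (1 - r ^+ 2)))).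
  apply: measurable_funM => //.
  by apply: measurable_poisson2; [exact: cmeasurable_radial|exact: measurable_cst].
move=> y; rewrite normrM ler_pM//.
by have := @normr_poisson_le _ (radial r y) z; rewrite normc_radial//; apply.
Qed.

(** The kernel has mean 1 in y, so the difference of both sides is an average of [f z - fp y]. This
    is nonpositive for y within eta of z, and elsewhere at most 2 M, against a kernel bounded by the
    tail; hence 8 = 2 * 4. *)
Lemma le_poisson_integral (f fp : circle R -> R) (M eta r : R) z :
  measurable_fun [set: circle R] fp -> (forall y, `|f y| <= M) ->
  (forall y, `|fp y| <= M) -> 0 < eta -> local_majorant eta f fp ->
  0 <= r -> r < 1 ->
  f z <= \int[m]_y (fp y * poisson (radial r y) z)
         + 8 * M * (1 - r ^+ 2) / eta ^+ 2.
Proof.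
move=> mfp fM fpM e0 ffp r0 r1.
have M0 : 0 <= M by exact: le_trans (fM z).
pose t := 4 * (1 - r ^+ 2) / eta ^+ 2.
have t0 : 0 <= t.
  by rewrite divr_ge0 ?exprn_ge0 ?mulr_ge0// ?subr_ge0 ?expr_le1// ltW.
have -> : 8 * M * (1 - r ^+ 2) / eta ^+ 2 = 2 * M * t.
  by rewrite /t; field; rewrite gt_eqF.
rewrite -lerBlDr.
have ip : m.-integrable setT (EFin \o poisson (radial r z)).
  by apply: (integrable_poisson m); rewrite normc_radial.
have ifp := integrableZl measurableT (f z) ip.
have -> : f z - 2 * M * t =
    \int[m]_y (f z * poisson (radial r z) y - 2 * M * t).
  rewrite RintegralB//; last first.
    exact: finite_measure_integrable_cst.
  rewrite Rintegral_haar_cst RintegralZl//.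
  by rewrite Rintegral_poisson ?mulr1// normc_radial.
apply: le_Rintegral => //.
- apply: (@integrableB _ _ _ m _ measurableT
    (EFin \o (fun y => f z * poisson (radial r z) y)) (EFin \o cst (2 * M * t))).
    exact: ifp.
  exact: finite_measure_integrable_cst.
- exact: (integrable_mul_poisson _ r0 r1 mfp fpM).
move=> y _; rewrite poisson_radialC.
have P0 : 0 <= poisson (radial r y) z by rewrite poisson_ge0 ?normc_radial.
have := fM z; have := fpM y; rewrite !ler_norml => /andP[h1 h2] /andP[h3 h4].
have [yz|yz] := ltP (normc (circle_val y - circle_val z)) eta.
  have := ffp _ _ yz => ffyz.
  have : f z * poisson (radial r y) z <= fp y * poisson (radial r y) z.
    by rewrite ler_wpM2r.
  have : 0 <= 2 * M * t by rewrite mulr_ge0// mulr_ge0.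
  lra.
have := poisson_tail r0 r1 e0 yz; rewrite -/t => Pt.
rewrite lerBlDr -lerBlDl -mulrBl.
apply: le_trans (_ : (2 * M) * poisson (radial r y) z <= _).
  by rewrite ler_wpM2r//; lra.
by rewrite ler_wpM2l// mulr_ge0.
Qed.

Lemma Rintegral_poisson_exchange (nu : {finite_measure set (circle R) -> \bar R})
    (f g : circle R -> R) (M N r : R) :
  measurable_fun [set: circle R] f -> measurable_fun [set: circle R] g ->
  (forall y, `|f y| <= M) -> (forall y, `|g y| <= N) -> 0 <= r -> r < 1 ->
  measurable_fun [set: circle R]
    (fun z => \int[m]_y (f y * poisson (radial r y) z)) /\
  \int[nu]_z (g z * \int[m]_y (f y * poisson (radial r y) z)) =
  \int[m]_y (f y * \int[nu]_z (g z * poisson (radial r y) z)).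
Proof.
move=> mf mg fM gN r0 r1.
have b z y : `|poisson (radial r y) z| <= 4 / (1 - r ^+ 2).
  by have := @normr_poisson_le _ (radial r y) z; rewrite normc_radial//; apply.
pose K (p : circle R * circle R) := f p.2 * poisson (radial r p.2) p.1.
have mK : measurable_fun [set: circle R * circle R] K.
  apply: measurable_funM; last exact: measurable_poisson_radial.
  exact: (measurableT_comp mf measurable_snd).
have KM p : `|K p| <= M * (4 / (1 - r ^+ 2)) by rewrite normrM ler_pM.
split; first exact: (measurable_Rintegral1 nu m mK KM).
have mH : measurable_fun [set: circle R * circle R] (fun p => g p.1 * K p).
  apply: measurable_funM => //.
  exact: (measurableT_comp mg measurable_fst).
have HN p : `|g p.1 * K p| <= N * (M * (4 / (1 - r ^+ 2))).
  by rewrite normrM ler_pM.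
have := Rintegral_Fubini nu m mH HN; rewrite /K /=.
under eq_Rintegral.
  move=> z _; rewrite RintegralZl//; last exact: (integrable_mul_poisson _ r0 r1 mf fM).
  over.
move=> ->; apply: eq_Rintegral => y _.
under eq_Rintegral do rewrite mulrCA.
rewrite RintegralZl//.
apply: (bounded_integrable nu (M := N * (4 / (1 - r ^+ 2)))).
  by apply: measurable_funM => //; exact: measurable_poisson.
by move=> z; rewrite normrM ler_pM.
Qed.

End poisson_approximation.

Section lipschitz_functions.
Variable R : realType.
Local Notation C := R[i].

Definition chord_lipschitz (K : R) (f : circle R -> R) : Prop :=
  forall y z, `|f y - f z| <= K * normc (circle_val y - circle_val z).

Lemma open_lipschitz_approx (U : set C) : open U ->
  exists f : nat -> circle R -> R,
  [/\ forall n, measurable_fun [set: circle R] (f n),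
      forall n z, 0 <= f n z <= 1,
      forall n, chord_lipschitz n%:R (f n) &
      forall z, f n z @[n --> \oo] --> (\1_(@circle_val R @^-1` U) z : R)].
Proof.
move=> /open_normcP oU.
(* The infimum of this set is the minimum of 1 and n times the distance from z to the complement of
   U; the element 1 also keeps the set nonempty when U is the whole plane. *)
pose S n z := [set (1 : R)] `|` [set n%:R * normc (z - v) | v in ~` U].
have S0 n z : has_inf (S n z).
  split; first by exists 1; left.
  exists 0 => _ [-> //|[v _ <-]].
  by rewrite mulr_ge0 ?normc_ge0.
pose f n z := inf (S n z).
have f0 n z : 0 <= f n z.
  apply: lb_le_inf; first by have [] := S0 n z.
  by move=> _ [-> //|[v _ <-]]; rewrite mulr_ge0 ?normc_ge0.
have f1 n z : f n z <= 1 by apply: ge_inf; [have [] := S0 n z|left].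
have fL n z w : f n z - f n w <= n%:R * normc (z - w).
  rewrite lerBlDr addrC -lerBlDr; apply: lb_le_inf; first by have [] := S0 n w.
  have nz0 : 0 <= n%:R * normc (z - w) by rewrite mulr_ge0 ?normc_ge0.
  move=> _ [->|[v Uv <-]]; first by have := f1 n z; lra.
  rewrite lerBlDr -mulrDr.
  apply: le_trans (_ : n%:R * normc (z - v) <= _).
    by apply: ge_inf; [have [] := S0 n z|right; exists v].
  by rewrite ler_wpM2l// [leRHS]addrC -[z - v](subrKA w) normcD_le.
have fLa n z w : `|f n z - f n w| <= n%:R * normc (z - w).
  by rewrite ler_norml fL andbT lerNl opprB normc_subC fL.
exists (fun n z => f n (circle_val z)); split.
- move=> n; apply: (measurability _ (RGenOpens.measurableE R)) => _ [_ [a [b ->] <-]].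
  rewrite setTI.
  have -> : (fun z : circle R => f n (circle_val z)) @^-1` `]a, b[%classic =
     @circle_val R @^-1` (f n @^-1` `]a, b[%classic) by [].
  apply: sub_sigma_algebra; exists (f n @^-1` `]a, b[%classic); last by rewrite setTI.
  apply/open_normcP => z /=; rewrite in_itv/= => /andP[az zb].
  have e0 : 0 < Order.min (f n z - a) (b - f n z) by rewrite lt_min !subr_gt0 az.
  exists (Order.min (f n z - a) (b - f n z) / n.+1%:R).
    by rewrite divr_gt0.
  move=> w; rewrite ltr_pdivlMr// mulrC => zw.
  have : `|f n z - f n w| < Order.min (f n z - a) (b - f n z).
    apply: le_lt_trans zw; apply: le_trans (fLa _ _ _) _.
    by rewrite ler_wpM2r ?normc_ge0// ler_nat.
  rewrite in_itv/= lt_min !ltr_norml => /andP[/andP[h1 h2] /andP[h3 h4]].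
  by apply/andP; split; lra.
- by move=> n z; rewrite f0 f1.
- by move=> n y z; exact: fLa.
- move=> z; rewrite indicE; have [Uz|nUz] := pselect (U (circle_val z)).
    rewrite mem_set//=; have [e e0 he] := oU _ Uz.
    have [k ke] := exists_nat_gt e^-1.
    apply: cvg_near_cst; exists k => // n /= kn.
    apply/eqP; rewrite eq_le f1/=; apply: lb_le_inf; first by have [] := S0 n (circle_val z).
    move=> _ [-> //|[v Uv <-]].
    have ev : e <= normc (circle_val z - v).
      by rewrite leNgt; apply/negP => /he.
    have en : e^-1 <= n%:R :> R by apply: le_trans (ltW ke) _; rewrite ler_nat.
    rewrite -[leLHS](mulVf (lt0r_neq0 e0)).
    by apply: ler_pM; [rewrite invr_ge0 ltW|exact: ltW|exact: en|exact: ev].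
  rewrite memNset//=; apply: cvg_near_cst; apply: nearW => n.
  apply/eqP; rewrite eq_le f0 andbT.
  apply: ge_inf; first by have [] := S0 n (circle_val z).
  by right; exists (circle_val z) => //; rewrite subrr normc0 mulr0.
Qed.

End lipschitz_functions.

Lemma bounded_convergence d (T : measurableType d) (R : realType)
    (nu : {finite_measure set T -> \bar R}) (f : nat -> T -> R) (g : T -> R)
    (M : R) :
  (forall n, measurable_fun [set: T] (f n)) -> measurable_fun [set: T] g ->
  (forall n x, `|f n x| <= M) ->
  {ae nu, forall x, f n x @[n --> \oo] --> g x} ->
  \int[nu]_x f n x @[n --> \oo] --> \int[nu]_x g x.
Proof.
move=> mf mg fM fg.
have [ig _ cv] : [/\ nu.-integrable setT (EFin \o g),
    ([sequence \int[nu]_x `|(EFin \o f n) x - (EFin \o g) x|]_n @ \oo --> 0)%E &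
    ([sequence \int[nu]_x (EFin \o f n) x]_n @ \oo --> \int[nu]_x (EFin \o g) x)%E].
  apply: (@dominated_convergence _ _ _ nu setT measurableT
    (fun n => EFin \o f n) (EFin \o g) (cst M%:E)) => //.
  - by move=> n; exact/measurable_EFinP.
  - exact/measurable_EFinP.
  - by apply: filterS fg => x fx _; apply: cvg_EFin => //; exact: nearW.
  - exact: finite_measure_integrable_cst.
  - by apply: aeW => x n _ /=; rewrite lee_fin.
apply: fine_cvg; rewrite fineK//; exact: integrable_fin_num.
Qed.

Lemma Rintegral_indic d (T : measurableType d) (R : realType)
    (nu : {finite_measure set T -> \bar R}) (A : set T) :
  measurable A -> \int[nu]_x (\1_A x) = fine (nu A).
Proof. by move=> mA; rewrite /Rintegral integral_indic// setIT. Qed.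

Lemma radius_close_to_1 (R : realType) (e : R) : 0 < e ->
  exists r : R, [/\ 0 <= r, r < 1 & 1 - r ^+ 2 <= e].
Proof.
move=> e0; exists (1 - Order.min e 1 / 2).
have m0 : 0 < Order.min e 1 by rewrite lt_min e0 ltr01.
have m1 : Order.min e 1 <= 1 by rewrite ge_min lexx orbT.
have me : Order.min e 1 <= e by rewrite ge_min lexx.
by split; nra.
Qed.

(** * Poisson integrals determine a measure on the circle *)

Section measures_on_the_circle.
Variable R : realType.
Local Notation C := R[i].
Local Notation m := (@haar R).

(** A Lipschitz function is uniformly close to a Poisson average G of [f + K * eta]. By Fubini, the
    integral of G involves a measure only through its Poisson integrals, where both measures
    agree. *)
Let le_Rintegral_lipschitz (nu1 nu2 : {finite_measure set (circle R) -> \bar R})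
    (f : circle R -> R) (K : R) :
  (forall w : C, normc w < 1 ->
    \int[nu1]_z poisson w z = \int[nu2]_z poisson w z) ->
  0 <= K -> measurable_fun [set: circle R] f ->
  (forall z, 0 <= f z <= 1) -> chord_lipschitz K f ->
  \int[nu1]_z f z <= \int[nu2]_z f z.
Proof.
move=> nuE K0 mf f01 fK.
pose t := fine (nu2 setT).
have t0 : 0 <= t by rewrite fine_ge0.
have t1E : fine (nu1 setT) = t.
  have := nuE 0; rewrite normc0 => /(_ ltr01).
  have E : poisson (0 : C) = cst (1 : R).
    apply/funext => z; rewrite /poisson normc0 expr0n subr0 subr0.
    by rewrite normc_circle expr1n divr1.
  by rewrite E !Rintegral_cst// !mul1r.
apply/ler_addgt0Pr => e e0.
(* Half of e is for the oscillation [2 * K * eta * t], where t is the common total mass; then r is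
   chosen so that the two errors [err * t] fill the other half. *)
pose eta := Order.min 1 (e / (4 * K * t + 1)).
have D0 : 0 < 4 * K * t + 1 by rewrite ltr_wpDl// !mulr_ge0.
have eta0 : 0 < eta by rewrite lt_min ltr01 divr_gt0.
have eta1 : eta <= 1 by rewrite ge_min lexx.
have etae : 4 * K * t * eta <= e.
  apply: le_trans (_ : (4 * K * t + 1) * eta <= _).
    by rewrite ler_wpM2r ?(ltW eta0)// lerDl.
  by rewrite mulrC -ler_pdivlMr// ge_min lexx orbT.
pose M := 1 + 2 * K.
have M0 : 0 < M by rewrite ltr_pwDl// mulr_ge0.
have D1 : 0 < 32 * M * (t + 1) by rewrite !mulr_gt0// ltr_wpDl.
have [r [r0 r1 re]] := @radius_close_to_1 R (e * eta ^+ 2 / (32 * M * (t + 1)))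
  (divr_gt0 (mulr_gt0 e0 (exprn_gt0 2 eta0)) D1).
pose fp z := f z + K * eta.
have mfp : measurable_fun setT fp by exact: measurable_funD.
have Keta : 0 <= K * eta by rewrite mulr_ge0// ltW.
have KetaK : K * eta <= K by rewrite ler_piMr.
have fM z : `|f z| <= M.
  by have /andP[h1 h2] := f01 z; rewrite ger0_norm// /M; lra.
have fpM z : `|fp z| <= M.
  by have /andP[h1 h2] := f01 z; rewrite ger0_norm /fp /M; lra.
pose err := 8 * M * (1 - r ^+ 2) / eta ^+ 2.
have errt : 2 * err * t <= e / 2.
  have : err * (4 * (t + 1)) <= e.
    rewrite /err mulrAC ler_pdivrMr ?exprn_gt0//.
    rewrite (_ : _ * _ * _ = (1 - r ^+ 2) * (32 * M * (t + 1))); last by ring.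
    by rewrite -ler_pdivlMr.
  have : 0 <= err.
    by rewrite /err divr_ge0 ?exprn_ge0 ?(ltW eta0)// !mulr_ge0 ?(ltW M0)//
      subr_ge0 expr_le1// ltW.
  nra.
have lo z : f z <= \int[m]_y (fp y * poisson (radial r y) z) + err.
  apply: le_poisson_integral => // y z' yz.
  have := fK y z'; rewrite ler_norml /fp => /andP[h _].
  have := ler_wpM2l K0 (ltW yz); lra.
have hi z : \int[m]_y (fp y * poisson (radial r y) z) <= f z + 2 * (K * eta) + err.
  have : - (f z) - 2 * (K * eta) <=
      \int[m]_y (- fp y * poisson (radial r y) z) + err.
    apply: (@le_poisson_integral _ (fun z => - (f z) - 2 * (K * eta))) => //.
    - exact: measurable_funN.
    - move=> y; have /andP[h1 h2] := f01 y; rewrite ler_norml /M; lra.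
    - by move=> y; rewrite normrN.
    - move=> y z' yz.
      have := fK y z'; rewrite ler_norml /fp => /andP[_ h].
      have := ler_wpM2l K0 (ltW yz); lra.
  under eq_Rintegral do rewrite mulNr -mulN1r.
  rewrite RintegralZl//; last exact: (integrable_mul_poisson _ r0 r1 mfp fpM).
  lra.
have mone : measurable_fun [set: circle R] (cst (1 : R)) by exact: measurable_cst.
have oneM (z : circle R) : `|cst (1 : R) z| <= 1 by rewrite /= normr1.
have [mG E1] := Rintegral_poisson_exchange nu1 mfp mone fpM oneM r0 r1.
have [_ E2] := Rintegral_poisson_exchange nu2 mfp mone fpM oneM r0 r1.
set G := (fun z => \int[m]_y _) in mG E1 E2.
have GM z : `|G z| <= M + 2 * (K * eta) + err + err.
  have := lo z; have := hi z; have := fM z.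
  rewrite !ler_norml -/(G z) => /andP[h1 h2] h3 h4.
  have /andP[h5 h6] := f01 z.
  have : 0 <= err.
    by rewrite /err divr_ge0 ?exprn_ge0 ?(ltW eta0)// !mulr_ge0 ?(ltW M0)//
      subr_ge0 expr_le1// ltW.
  by move: M0 Keta h3 h4; rewrite -/(G z); lra.
have E : \int[nu1]_z G z = \int[nu2]_z G z.
  transitivity (\int[nu1]_z (cst 1 z * G z)).
    by apply: eq_Rintegral => z _; rewrite mul1r.
  rewrite E1; transitivity (\int[nu2]_z (cst 1 z * G z)); last first.
    by apply: eq_Rintegral => z _; rewrite mul1r.
  rewrite E2; apply: eq_Rintegral => y _; congr (_ * _).
  under eq_Rintegral do rewrite mul1r.
  by under [RHS]eq_Rintegral do rewrite mul1r; rewrite nuE// normc_radial.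
have iG (nu : {finite_measure set (circle R) -> \bar R}) :
  nu.-integrable setT (EFin \o G) by exact: bounded_integrable GM.
have if_ (nu : {finite_measure set (circle R) -> \bar R}) :
  nu.-integrable setT (EFin \o f) by exact: bounded_integrable fM.
have icst (nu : {finite_measure set (circle R) -> \bar R}) (c : R) :
  nu.-integrable setT (EFin \o cst c) by exact: finite_measure_integrable_cst.
have L1 : \int[nu1]_z f z <= \int[nu1]_z G z + err * t.
  rewrite -t1E -Rintegral_cst// -RintegralD; [|exact: measurableT|exact: iG|exact: icst].
  apply: le_Rintegral => //.
  - exact: if_.
  - exact: (integrableD measurableT (iG nu1) (icst nu1 err)).
  - by move=> z _; exact: lo.
have L2 : \int[nu2]_z G z <= \int[nu2]_z f z + (2 * (K * eta) + err) * t.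
  rewrite /t -Rintegral_cst// -RintegralD; [|exact: measurableT|exact: if_|exact: icst].
  apply: le_Rintegral => //.
  - exact: iG.
  - exact: (integrableD measurableT (if_ nu2) (icst nu2 _)).
  - by move=> z _; rewrite addrA; exact: hi.
move: L1; rewrite E => L1.
apply: (le_trans L1); apply: (le_trans (lerD L2 (lexx _))).
by rewrite -addrA lerD2l; clear -etae errt; nra.
Qed.

(** The open sets generate and are stable under intersection; their indicators are bounded limits of
    Lipschitz functions, to which the comparison applies in both directions. *)
Lemma circle_measure_unique (nu1 nu2 : {finite_measure set (circle R) -> \bar R}) :
  (forall w : C, normc w < 1 ->
    \int[nu1]_z poisson w z = \int[nu2]_z poisson w z) ->
  forall A, measurable A -> nu1 A = nu2 A.
Proof.
move=> nuE; apply: (measure_unique (@circle_open R) (fun=> setT)) => //.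
- move=> _ _ [U oU <-] [V oV <-]; exists (U `&` V); first exact: openI.
  by rewrite !setTI preimage_setI.
- by move=> _; exists setT; [exact: openT|rewrite setTI preimage_setT].
- by rewrite bigcup_const.
- move=> _ [U oU <-]; rewrite setTI.
  have mU : measurable (@circle_val R @^-1` U).
    by apply: sub_sigma_algebra; exists U => //; rewrite setTI.
  have [f [mf f01 fK fU]] := open_lipschitz_approx oU.
  have fM n z : `|f n z| <= 1.
    by have /andP[h1 h2] := f01 n z; rewrite ger0_norm.
  have cv (nu : {finite_measure set (circle R) -> \bar R}) :=
    bounded_convergence mf (measurable_indic mU) fM
      (aeW nu (fun z => fU z)).
  have E n : \int[nu1]_z f n z = \int[nu2]_z f n z.
    apply/eqP; rewrite eq_le; apply/andP; split.
      exact: (le_Rintegral_lipschitz nuE _ (mf n) (f01 n) (fK n)).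
    apply: (le_Rintegral_lipschitz _ _ (mf n) (f01 n) (fK n)) => // w w1.
    by rewrite nuE.
  have c2 := cv nu2; move: (cv nu1); under eq_fun do rewrite E.
  move=> c1; have := cvg_unique (@Rhausdorff R) c1 c2.
  rewrite !Rintegral_indic// => e12.
  rewrite -[LHS]fineK; last exact: fin_num_measure.
  rewrite -[RHS]fineK; last exact: fin_num_measure.
  by congr EFin; exact: e12.
- by move=> _; rewrite -ge0_fin_numE// fin_num_measure.
Qed.

End measures_on_the_circle.

(** * Harmonic measures and inner maps *)

Section harmonic_measure.
Variable R : realType.
Local Notation C := R[i].
Local Notation m := (@haar R).
Implicit Types (w c : C).

(* Points outside of the disk are sent to 0 to get a probability in all cases. *)
Definition to_disc c : C := if normc c < 1 then c else 0.

Lemma normc_to_disc c : normc (to_disc c) < 1.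
Proof. by rewrite /to_disc; case: ifP => // _; rewrite normc0. Qed.

Lemma to_discE c : normc c < 1 -> to_disc c = c.
Proof. by rewrite /to_disc => ->. Qed.

Definition harmonic_measure c : set (circle R) -> \bar R :=
  fun A => (\int[m]_(z in A) (poisson (to_disc c) z)%:E)%E.

Let P0 c z : (0 <= (poisson (to_disc c) z)%:E)%E.
Proof. by rewrite lee_fin poisson_ge0// normc_to_disc. Qed.

Let mP c : measurable_fun [set: circle R] (EFin \o poisson (to_disc c)).
Proof. by apply/measurable_EFinP; exact: measurable_poisson. Qed.

Let harmonic_measure0 c : harmonic_measure c set0 = 0%E.
Proof. by rewrite /harmonic_measure integral_set0. Qed.

Let harmonic_measure_ge0 c A : (0 <= harmonic_measure c A)%E.
Proof. by apply: integral_ge0. Qed.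

Let harmonic_measure_sigma_additive c : semi_sigma_additive (harmonic_measure c).
Proof.
move=> F mF tF mUF; rewrite /harmonic_measure; apply: cvg_toP.
  apply: ereal_nondecreasing_is_cvgn => i j ij.
  by apply: lee_sum_nneg_natr => // k _ _; exact: integral_ge0.
by rewrite ge0_integral_bigcup//=; exact: (measurable_funTS (mP c)).
Qed.

HB.instance Definition _ c := isMeasure.Build _ _ _ (harmonic_measure c)
  (harmonic_measure0 c) (harmonic_measure_ge0 c)
  (@harmonic_measure_sigma_additive c).

Let harmonic_measure_setT c : harmonic_measure c [set: circle R] = 1%E.
Proof.
have h := Rintegral_poisson (normc_to_disc c).
have := congr1 EFin h; rewrite /Rintegral fineK//; apply: integrable_fin_num => //.
exact: (integrable_poisson m (normc_to_disc c)).
Qed.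

HB.instance Definition _ c := @Measure_isProbability.Build _ _ R
  (harmonic_measure c) (harmonic_measure_setT c).

Lemma harmonic_measure_dominates c : harmonic_measure c `<< m.
Proof.
apply/null_content_dominatesP => A mA mA0.
rewrite /harmonic_measure (_ : 0%E = \int[m]_(z in A) cst 0%E z)%E ?integral0//.
by apply: null_set_integral => //; exact: (measurable_funTS (mP c)).
Qed.

Lemma harmonic_measure_density c :
  ae_eq m [set: circle R]
    (Radon_Nikodym (charge_of_finite_measure (harmonic_measure c)) m)
    (EFin \o poisson (to_disc c)).
Proof.
have dom := harmonic_measure_dominates c.
apply: integral_ae_eq => //.
- by apply: Radon_Nikodym_integrable.
- move=> E _ mE; rewrite -Radon_Nikodym_integral//.
Qed.

Lemma integral_harmonic_measure c (g : circle R -> \bar R) :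
  (harmonic_measure c).-integrable [set: circle R] g ->
  (\int[harmonic_measure c]_z g z =
   \int[m]_z (g z * (poisson (to_disc c) z)%:E))%E.
Proof.
move=> ig; have dom := harmonic_measure_dominates c.
rewrite -(Radon_Nikodym_change_of_variables dom measurableT ig).
have mg := measurable_int _ ig.
have RNi : m.-integrable setT
    (Radon_Nikodym (charge_of_finite_measure (harmonic_measure c)) m).
  by apply: Radon_Nikodym_integrable.
apply: ae_eq_integral => //.
- by apply: emeasurable_funM => //; exact: (measurable_int _ RNi).
- exact: (emeasurable_funM mg (mP c)).
- apply: ae_eqe_mul2l; exact: harmonic_measure_density.
Qed.

Lemma Rintegral_harmonic_measure c (g : circle R -> R) (M : R) :
  measurable_fun [set: circle R] g -> (forall z, `|g z| <= M) ->
  \int[harmonic_measure c]_z g z = \int[m]_z (g z * poisson (to_disc c) z).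
Proof.
move=> mg gM; rewrite /Rintegral integral_harmonic_measure//.
exact: bounded_integrable gM.
Qed.

Lemma Rintegral_poisson_harmonic w c : normc w < 1 -> normc c < 1 ->
  \int[harmonic_measure c]_z poisson w z =
  2 * complex.Re (1 - w^*%C * c)^-1 - 1.
Proof.
move=> w1 c1.
rewrite (@Rintegral_harmonic_measure c _ (4 / (1 - normc w ^+ 2))).
- by rewrite to_discE// Rintegral_poissonM.
- exact: measurable_poisson.
- by move=> z; exact: normr_poisson_le.
Qed.

End harmonic_measure.

(** * Self-maps of the disk that preserve the circle *)

Section inner_functions.
Variable R : realType.
Local Notation C := R[i].
Local Notation m := (@haar R).

(** By the type of [Sc], the map S is unimodular on the circle; the strict inequality inside
    excludes unimodular constants. *)
Record inner_map (S : C -> C) (Sc : circle R -> circle R) : Prop := InnerMap {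
  inner_disc_algebra : disc_algebra S ;
  inner_le1 : forall z, normc z <= 1 -> normc (S z) <= 1 ;
  inner_lt1 : forall z, normc z < 1 -> normc (S z) < 1 ;
  inner_circle : forall z, circle_val (Sc z) = S (circle_val z) }.

Lemma inner_map_comp S Sc T Tc :
  inner_map S Sc -> inner_map T Tc -> inner_map (S \o T) (Sc \o Tc).
Proof.
move=> [S1 S2 S3 S4] [T1 T2 T3 T4]; split.
- exact: disc_algebra_comp.
- by move=> z z1; exact/S2/T2.
- by move=> z z1; exact/S3/T3.
- by move=> z /=; rewrite S4 T4.
Qed.

Lemma measurable_inner_map S Sc : inner_map S Sc ->
  measurable_fun [set: circle R] Sc.
Proof.
move=> [hS _ _ ScE]; apply/measurable_circleP.
by under eq_fun do rewrite ScE; exact: cmeasurable_disc_algebra.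
Qed.

(** Both measures have the same Poisson integrals, [2 Re 1 / (1 - u) - 1] with u the product of
    [S 0] and the conjugate of w: one by the mean value property along S, the other by the product
    formula for two kernels. *)
Lemma haar_inner_map S Sc A : inner_map S Sc -> measurable A ->
  m (Sc @^-1` A) = harmonic_measure (S 0) A.
Proof.
move=> hS mA; have mSc := measurable_inner_map hS.
pose X : {mfun circle R >-> circle R} := HB.pack Sc
  (isMeasurableFun.Build _ _ _ _ Sc mSc).
have E : forall A, measurable A -> distribution m X A = harmonic_measure (S 0) A.
  apply: circle_measure_unique => w w1.
  have [S1 S2 S3 S4] := hS.
  rewrite Rintegral_poisson_harmonic//; last by rewrite S3// normc0.
  rewrite -(Rintegral_poisson_comp S1 S2 S4 w1).
  by apply: (Rintegral_transport mSc) => //; exact: measurable_poisson.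
by rewrite -E.
Qed.

Lemma normc_mobius_den (a z : C) : normc a < 1 -> normc z <= 1 ->
  0 < normc (1 - a^*%C * z).
Proof. by move=> a1 z1; rewrite normc_1B_gt0// normcM_lt1. Qed.

Lemma sqr_normc_mobius (a z : C) :
  normc (1 - a^*%C * z) ^+ 2 - normc (z - a) ^+ 2 =
  (1 - normc a ^+ 2) * (1 - normc z ^+ 2).
Proof. by rewrite !sqr_normcE; case: a z => p q [x y] /=; ring. Qed.

Lemma normc_mobius_le1 (a z : C) : normc a < 1 -> normc z <= 1 ->
  normc ((z - a) / (1 - a^*%C * z)) <= 1.
Proof.
move=> a1 z1; have d0 := normc_mobius_den a1 z1.
rewrite normcM normcV ler_pdivrMr// mul1r.
rewrite -(@ler_pXn2r _ 2) ?nnegrE ?normc_ge0// -subr_ge0 sqr_normc_mobius.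
by rewrite mulr_ge0// subr_ge0 expr_le1// ?normc_ge0// ltW.
Qed.

Lemma normc_mobius_lt1 (a z : C) : normc a < 1 -> normc z < 1 ->
  normc ((z - a) / (1 - a^*%C * z)) < 1.
Proof.
move=> a1 z1; have d0 := normc_mobius_den a1 (ltW z1).
rewrite normcM normcV ltr_pdivrMr// mul1r.
rewrite -(@ltr_pXn2r _ 2) ?nnegrE ?normc_ge0// -subr_gt0 sqr_normc_mobius.
by rewrite mulr_gt0// subr_gt0 expr_lt1// normc_ge0.
Qed.

Lemma disc_algebra_mobius (a : C) : normc a < 1 ->
  disc_algebra (fun z => (z - a) / (1 - a^*%C * z)).
Proof.
move=> a1; apply: disc_algebraM.
  by apply: disc_algebraD; [exact: disc_algebra_id|exact: disc_algebra_cst].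
apply: (@disc_algebra_geometric _ _ (normc a)) => //.
  by apply: disc_algebraM; [exact: disc_algebra_cst|exact: disc_algebra_id].
by move=> z z1; rewrite normcM normc_conj ler_piMr// normc_ge0.
Qed.

Lemma inner_map_mobius (a : C) : normc a < 1 ->
  exists Sc, inner_map (fun z => (z - a) / (1 - a^*%C * z)) Sc.
Proof.
move=> a1.
have e (z : circle R) :
    normc ((circle_val z - a) / (1 - a^*%C * circle_val z)) == 1.
  by apply/eqP/normc_blaschke_factor => //; exact: normc_circle.
exists (fun z => Circle (e z)); split => //.
- exact: disc_algebra_mobius.
- by move=> z z1; exact: normc_mobius_le1.
- by move=> z z1; exact: normc_mobius_lt1.
Qed.

(* Reduced to [haar_inner_map] by precomposing with the Moebius map that sends
   0 to [c]. *)
Lemma harmonic_measure_inner_map S Sc c A : inner_map S Sc -> normc c < 1 ->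
  measurable A ->
  harmonic_measure c (Sc @^-1` A) = harmonic_measure (S c) A.
Proof.
move=> hS c1 mA.
have c1' : normc (- c) < 1 by rewrite normc_opp.
have [Bc hB] := inner_map_mobius c1'.
have B0 : (0 - - c) / (1 - (- c)^*%C * 0) = c.
  by rewrite mulr0 subr0 divr1 sub0r opprK.
rewrite -{1}B0 -(haar_inner_map hB).
  by rewrite -[in RHS]B0 -(haar_inner_map (inner_map_comp hS hB)).
by rewrite -[X in measurable X]setTI; exact: (measurable_inner_map hS).
Qed.

Lemma Rintegral_harmonic_inner_map S Sc c (g : circle R -> R) :
  inner_map S Sc -> normc c < 1 -> measurable_fun [set: circle R] g ->
  \int[harmonic_measure c]_z g (Sc z) = \int[harmonic_measure (S c)]_z g z.
Proof.
move=> hS c1 mg; symmetry.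
apply: Rintegral_transport => //; first exact: measurable_inner_map hS.
by move=> A mA; exact/esym/(harmonic_measure_inner_map hS c1 mA).
Qed.

End inner_functions.

(** * Pseudo-hyperbolic contraction *)

Section blaschke_factors.
Variable R : realType.
Local Notation C := R[i].
Implicit Types (a z w : C).

Definition mobius a z : C := (z - a) / (1 - a^*%C * z).

Lemma sqr_normcC z : ((normc z ^+ 2)%:C)%C = z * z^*%C.
Proof. by rewrite -sqr_normc rmorphXn. Qed.

(** On the circle, z times the logarithmic derivative of a Moebius factor is the Poisson kernel of
    its zero. These are positive numbers, so they add up over a product without cancellation. *)
Lemma is_derive_mobius a z : normc a < 1 -> normc z = 1 ->
  is_derive (z : C) (1 : C) (mobius a : C -> C)
    (mobius a z * z^*%C * ((1 - normc a ^+ 2) / normc (z - a) ^+ 2)%:C%C).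
Proof.
move=> a1 z1.
have d0 : 1 - a^*%C * z != 0 by rewrite -normc_gt0 normc_mobius_den// z1.
have dn : is_derive (z : C) (1 : C) (fun z : C => z - a) (1 - 0).
  exact: is_deriveB.
have dd : is_derive (z : C) (1 : C) (fun z : C => 1 - a^*%C * z) (0 - a^*%C *: 1).
  by apply: is_deriveB; exact: is_deriveZ.
have dV : is_derive (z : C) (1 : C) (fun z : C => (1 - a^*%C * z)^-1)
    (- (1 - a^*%C * z) ^- 2 *: (0 - a^*%C *: 1)).
  have [d1 d2] := dd.
  apply: DeriveDef; first exact: derivableV.
  by rewrite deriveV// d2.
have := is_deriveM dn dV.
rewrite /GRing.scale/= => h.
apply: (is_derive_eq h).
have za : z - a != 0.
  rewrite -normc_gt0; apply: lt_le_trans (normc_sub_le _ _).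
  by rewrite z1 subr_gt0.
have zz : z * z^*%C = 1 by rewrite -sqr_normcC z1 expr1n.
have z0 : z^*%C != 0.
  by apply/eqP => z0; move: zz; rewrite z0 mulr0 => /eqP; rewrite eq_sym oner_eq0.
rewrite rmorphM fmorphV rmorphB rmorph1/= !sqr_normcC.
have -> : (z - a)^*%C = z^*%C * (1 - a^*%C * z).
  by rewrite rmorphB/= mulrBr mulr1 mulrCA [z^*%C * z]mulrC zz mulr1.
rewrite /mobius.
move: d0 za z0; set d := 1 - a^*%C * z => d0 za z0.
have dE : 1 - a * a^*%C = d + (z - a) * a^*%C by rewrite /d; ring.
rewrite dE; field.
by rewrite d0 z0 za.
Qed.

Lemma normc_mobius a z : normc a < 1 -> normc z = 1 -> normc (mobius a z) = 1.
Proof. exact: normc_blaschke_factor. Qed.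

Lemma is_derive_prod_mobius (n : nat) (a : nat -> C) z :
  (forall i, (i < n)%N -> normc (a i) < 1) -> normc z = 1 ->
  is_derive (z : C) (1 : C) (fun z : C => \prod_(i < n) mobius (a i) z)
   ((\prod_(i < n) mobius (a i) z) * z^*%C *
    (\sum_(i < n) (1 - normc (a i) ^+ 2) / normc (z - a i) ^+ 2)%:C%C).
Proof.
move=> + z1; elim: n => [|n IHn] an.
  rewrite (_ : (fun _ => _) = cst 1); last by apply/funext => u; rewrite big_ord0.
  by rewrite !big_ord0 mulr0; exact: is_derive_cst.
rewrite (_ : (fun _ => _) = (fun z => \prod_(i < n) mobius (a i) z) * mobius (a n));
  last by apply/funext => u; rewrite big_ord_recr.
have h1 := IHn (fun i lt_in => an i (ltnW lt_in)).
have h2 := is_derive_mobius (an n (leqnn _)) z1.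
apply: (is_derive_eq (is_deriveM h1 h2)).
by rewrite /GRing.scale/= !big_ord_recr/= rmorphD/=; ring.
Qed.

Lemma sqr_normc_mobiusE a z : normc a < 1 -> normc z <= 1 ->
  1 - normc (mobius a z) ^+ 2 =
  (1 - normc a ^+ 2) * (1 - normc z ^+ 2) / normc (1 - a^*%C * z) ^+ 2.
Proof.
move=> a1 z1; have d0 := normc_mobius_den a1 z1.
rewrite /mobius normcM normcV -sqr_normc_mobius expr_div_n mulrBl divff//.
by rewrite expf_neq0// gt_eqF.
Qed.

(** For t_i the squared moduli of the factors of a Blaschke product T, this bounds the defect of T z
    below by the sum of the defects of the factors, up to the factor |T z|^2, which is close to 1
    when T z is near the circle. *)
Lemma one_sub_prod_ge (n : nat) (t : nat -> R) :
  (forall i, (i < n)%N -> 0 <= t i <= 1) ->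
  (0 <= \prod_(i < n) t i <= 1) /\
  (\prod_(i < n) t i) * \sum_(i < n) (1 - t i) <= 1 - \prod_(i < n) t i.
Proof.
elim: n => [|n IHn] t01; first by rewrite !big_ord0; lra.
have [/andP[p0 p1] h] := IHn (fun i lt_in => t01 i (ltnW lt_in)).
have /andP[t0 t1] := t01 n (leqnn _).
have s0 : 0 <= \sum_(i < n) (1 - t i).
  apply: sumr_ge0 => i _; rewrite subr_ge0.
  by have /andP[_] := t01 i (ltnW (ltn_ord i)).
rewrite !big_ord_recr/=.
move: (\prod_(i < n) t i) (\sum_(i < n) (1 - t i)) (t n) p0 p1 h t0 t1 s0.
move=> p s u p0 p1 h u0 u1 s0.
split; first by rewrite mulr_ge0//= mulr_ile1.
have ps : 0 <= p * s by exact: mulr_ge0.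
have h2 : p * s * u <= p * s by rewrite ler_piMr.
have h3 : p * (1 - u) * u <= p * (1 - u).
  by rewrite ler_piMr// mulr_ge0// subr_ge0.
lra.
Qed.

(* The kernel (1 - F(z) conj F(w)) / (1 - z conj w) of a 2-point set, as the
   data of a positive semidefinite hermitian 2x2 matrix [[p, c], [conj c, q]]. *)
Definition psd2 (p q : R) (c : C) : Prop :=
  [/\ 0 <= p, 0 <= q & normc c ^+ 2 <= p * q].

(** The mixed part p q' + p' q - 2 |c c'| of the determinant is nonnegative by the inequality
    between arithmetic and geometric means. Thus the determinant provided by some factors of a
    product survives multiplication by the others. *)
Lemma psd2_det_add p q c p' q' c' : psd2 p q c -> psd2 p' q' c' ->
  psd2 (p + p') (q + q') (c + c') /\
  p * q - normc c ^+ 2 <= (p + p') * (q + q') - normc (c + c') ^+ 2.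
Proof.
move=> [p0 q0 h] [p0' q0' h'].
have cc : normc (c + c') ^+ 2 <= (normc c + normc c') ^+ 2.
  by rewrite lerXn2r ?nnegrE ?addr_ge0 ?normc_ge0// normcD_le.
have k : 2 * (normc c * normc c') <= p * q' + p' * q.
  rewrite -(@ler_pXn2r _ 2) ?nnegrE ?mulr_ge0 ?addr_ge0 ?mulr_ge0 ?normc_ge0//.
  rewrite exprMn exprMn.
  have : normc c ^+ 2 * normc c' ^+ 2 <= (p * q) * (p' * q').
    by apply: ler_pM => //; rewrite sqr_ge0.
  have := sqr_ge0 (p * q' - p' * q); nra.
have E : (normc c + normc c') ^+ 2 =
    normc c ^+ 2 + 2 * (normc c * normc c') + normc c' ^+ 2 by ring.
have D : p * q - normc c ^+ 2 <= (p + p') * (q + q') - normc (c + c') ^+ 2.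
  move: cc; rewrite E.
  move: (normc c ^+ 2) (normc c' ^+ 2) (normc (c + c') ^+ 2) k h h'.
  move: (normc c * normc c') => u x y v; nra.
split=> //; split; [exact: addr_ge0|exact: addr_ge0|].
by move: D h; move: (normc c ^+ 2) (normc (c + c') ^+ 2) => x y; lra.
Qed.

(** The entry at (z, w) of the Pick matrix of a function with values u at z and v at w; [pick_diag]
    is a diagonal entry, kept real. *)
Definition pick_kernel (u v z w : C) : C := (1 - u * v^*%C) / (1 - z * w^*%C).

Definition pick_diag (u z : C) : R := (1 - normc u ^+ 2) / (1 - normc z ^+ 2).

(** The Pick matrix of a product is that of the first factor, plus that of the second conjugated by
    the diagonal matrix of the values of the first: a sum of positive matrices. *)
Lemma pick_kernelM (u v u' v' z w : C) :
  pick_kernel (u * u') (v * v') z w =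
  pick_kernel u v z w + u * v^*%C * pick_kernel u' v' z w.
Proof. by rewrite /pick_kernel rmorphM/=; ring. Qed.

Lemma pick_diagM (u u' z : C) :
  pick_diag (u * u') z = pick_diag u z + normc u ^+ 2 * pick_diag u' z.
Proof. by rewrite /pick_diag normcM exprMn; ring. Qed.

Lemma psd2_scale p q c (u v : C) : psd2 p q c ->
  psd2 (normc u ^+ 2 * p) (normc v ^+ 2 * q) (u * v^*%C * c).
Proof.
move=> [p0 q0 h]; split; rewrite ?mulr_ge0 ?exprn_ge0 ?normc_ge0//.
rewrite !normcM normc_conj !exprMn [leRHS]mulrACA ler_wpM2l//.
by rewrite mulr_ge0 ?exprn_ge0 ?normc_ge0.
Qed.

(** The variables z and w separate, so the Pick matrix of one factor has rank one and zero
    determinant. This is the isometry property of Moebius maps, and the reason why contraction takes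
    two factors. *)
Lemma pick_kernel_mobius a z w : normc a < 1 -> normc z < 1 -> normc w < 1 ->
  pick_kernel (mobius a z) (mobius a w) z w =
  (1 - normc a ^+ 2)%:C%C / ((1 - a^*%C * z) * (1 - a * w^*%C)).
Proof.
move=> a1 z1 w1.
have n1 : 1 - a^*%C * z != 0 by rewrite -normc_gt0 normc_mobius_den// ltW.
have n2 : 1 - a * w^*%C != 0.
  have := normc_mobius_den a1 (ltW w1).
  rewrite -normc_conj rmorphB rmorphM rmorph1/= normc_gt0.
  by rewrite (_ : a^*^*%C = a)//; case: (a) => p q /=; rewrite opprK.
have n3 : 1 - z * w^*%C != 0.
  have := normc_mobius_den w1 (ltW z1).
  by rewrite normc_gt0 mulrC.
rewrite /pick_kernel /mobius rmorphM fmorphV !rmorphB rmorphM !rmorph1/=.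
rewrite (_ : a^*^*%C = a); last by case: (a) => p q /=; rewrite opprK.
rewrite sqr_normcC; field.
by rewrite n1 n2 n3.
Qed.

Lemma pick_diag_mobius a z : normc a < 1 -> normc z < 1 ->
  pick_diag (mobius a z) z = (1 - normc a ^+ 2) / normc (1 - a^*%C * z) ^+ 2.
Proof.
move=> a1 z1; rewrite /pick_diag sqr_normc_mobiusE// ?ltW//.
have d1 := lt0r_neq0 (sqr_normc_lt1 z1).
have d0 := lt0r_neq0 (normc_mobius_den a1 (ltW z1)).
by rewrite -!mulrA; congr (_ * _); rewrite mulrCA divff ?mulr1.
Qed.

Lemma normc_conj_den a w : normc (1 - a * w^*%C) = normc (1 - a^*%C * w).
Proof.
rewrite -normc_conj rmorphB rmorphM rmorph1/=.
by rewrite (_ : w^*^*%C = w)//; case: (w) => p q /=; rewrite opprK.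
Qed.

Lemma psd2_mobius a z w : normc a < 1 -> normc z < 1 -> normc w < 1 ->
  psd2 (pick_diag (mobius a z) z) (pick_diag (mobius a w) w)
    (pick_kernel (mobius a z) (mobius a w) z w).
Proof.
move=> a1 z1 w1; rewrite pick_kernel_mobius// !pick_diag_mobius//.
have A0 := sqr_normc_lt1 a1.
have dz := normc_mobius_den a1 (ltW z1); have dw := normc_mobius_den a1 (ltW w1).
split; [by rewrite divr_ge0 ?exprn_ge0 ?normc_ge0// ltW| |].
  by rewrite divr_ge0 ?exprn_ge0 ?normc_ge0// ltW.
rewrite normcM normcV !normcM normc_real ger0_norm ?(ltW A0)// normc_conj_den.
move: A0 dz dw; move: (1 - normc a ^+ 2) (normc (1 - a^*%C * z)) (normc (1 - a^*%C * w)).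
move=> A x y A0 x0 y0.
by rewrite le_eqVlt; apply/orP; left; apply/eqP; field; rewrite !gt_eqF.
Qed.

Lemma psd2_prod_mobius (n : nat) (a : nat -> C) z w :
  (forall i, (i < n)%N -> normc (a i) < 1) -> normc z < 1 -> normc w < 1 ->
  psd2 (pick_diag (\prod_(i < n) mobius (a i) z) z)
    (pick_diag (\prod_(i < n) mobius (a i) w) w)
    (pick_kernel (\prod_(i < n) mobius (a i) z) (\prod_(i < n) mobius (a i) w) z w).
Proof.
elim: n a => [|n IHn] a an z1 w1.
  rewrite !big_ord0 /pick_diag /pick_kernel rmorph1 mulr1 normc1 expr1n subrr.
  by rewrite !mul0r subrr mul0r; split; rewrite ?mulr0// normc0 expr0n.
rewrite !big_ord_recl pick_kernelM !(pick_diagM (mobius _ _)).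
have := IHn (a \o S) (fun i lt_in => an i.+1 lt_in) z1 w1.
move=> /(psd2_scale (mobius (a 0%N) z) (mobius (a 0%N) w)) h.
have [h1 _] := psd2_det_add (psd2_mobius (an 0%N isT) z1 w1) h.
exact: h1.
Qed.

(* Two Moebius factors already make the determinant of the kernel positive off
   the diagonal. *)
Lemma pick_det_mobius2 a b z w : normc a < 1 -> normc b < 1 ->
  normc z < 1 -> normc w < 1 ->
  (1 - normc a ^+ 2) * (1 - normc b ^+ 2) * normc (1 - b^*%C * a) ^+ 2 / 256
    * normc (z - w) ^+ 2 <=
  pick_diag (mobius a z * mobius b z) z * pick_diag (mobius a w * mobius b w) w
  - normc (pick_kernel (mobius a z * mobius b z) (mobius a w * mobius b w) z w) ^+ 2.
Proof.
move=> a1 b1 z1 w1.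
rewrite pick_kernelM !(pick_diagM (mobius _ _)) !pick_kernel_mobius// !pick_diag_mobius//.
have A0 := sqr_normc_lt1 a1; have B0 := sqr_normc_lt1 b1.
have daz := normc_mobius_den a1 (ltW z1); have daw := normc_mobius_den a1 (ltW w1).
have dbz := normc_mobius_den b1 (ltW z1); have dbw := normc_mobius_den b1 (ltW w1).
have le2 (c u : C) : normc c < 1 -> normc u < 1 -> normc (1 - c^*%C * u) <= 2.
  move=> c1 u1; apply: le_trans (normcD_le _ _) _.
  rewrite normc1 normc_opp -lerBrDl (_ : 2 - 1 = 1); last by ring.
  by rewrite ltW// normcM_lt1// ltW.
have Laz := le2 a z a1 z1; have Law := le2 a w a1 w1.
have Lbz := le2 b z b1 z1; have Lbw := le2 b w b1 w1.
set A := 1 - normc a ^+ 2 in A0 *; set B := 1 - normc b ^+ 2 in B0 *.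
have nz (c u : C) : normc c < 1 -> normc u < 1 -> 1 - c^*%C * u != 0.
  by move=> c1 u1; rewrite -normc_gt0 normc_mobius_den// ltW.
have naz := nz a z a1 z1; have naw := nz a w a1 w1.
have nbz := nz b z b1 z1; have nbw := nz b w b1 w1.
(* The Pick matrix of two factors is a combination with weights A and B of the rank one matrices of
   the vectors (x0, y0) and (x1, y1); by the identity of Lagrange its determinant is A B |x0 y1 - x1
   y0|^2. *)
pose x0 := (1 - a^*%C * z)^-1; pose y0 := (1 - a^*%C * w)^-1.
pose x1 := mobius a z * (1 - b^*%C * z)^-1.
pose y1 := mobius a w * (1 - b^*%C * w)^-1.
have E1 : x0 * y1 - x1 * y0 = (w - z) * (1 - b^*%C * a) /
    ((1 - a^*%C * z) * (1 - a^*%C * w) * ((1 - b^*%C * z) * (1 - b^*%C * w))).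
  rewrite /x0 /x1 /y0 /y1 /mobius; field.
  by rewrite naz naw nbz nbw.
have conjK (c : C) : c^*^*%C = c by case: c => p q /=; rewrite opprK.
have conjV (c u : C) : (1 - c * u^*%C)^-1 = ((1 - c^*%C * u)^-1)^*%C.
  by rewrite fmorphV rmorphB rmorphM rmorph1/= conjK.
have E2 : A%:C%C / ((1 - a^*%C * z) * (1 - a * w^*%C)) +
    mobius a z * (mobius a w)^*%C *
    (B%:C%C / ((1 - b^*%C * z) * (1 - b * w^*%C))) =
    A%:C%C * (x0 * y0^*%C) + B%:C%C * (x1 * y1^*%C).
  by rewrite !invfM !conjV /x0 /y0 /x1 /y1 (rmorphM _ (mobius a w))/=; ring.
have n2V (c : C) : normc c ^- 2 = normc c^-1 ^+ 2 by rewrite normcV exprVn.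
have lagrange (x y x' y' : C) :
    (A * normc x ^+ 2 + B * normc x' ^+ 2) * (A * normc y ^+ 2 + B * normc y' ^+ 2)
    - normc (A%:C%C * (x * y^*%C) + B%:C%C * (x' * y'^*%C)) ^+ 2 =
    A * B * normc (x * y' - x' * y) ^+ 2.
  rewrite !sqr_normcE; case: x y x' y' => [p1 q1] [p2 q2] [p3 q3] [p4 q4] /=; ring.
rewrite E2 !n2V.
have E3 : A * normc x0 ^+ 2 + normc (mobius a z) ^+ 2 * (B * normc (1 - b^*%C * z)^-1 ^+ 2)
   = A * normc x0 ^+ 2 + B * normc x1 ^+ 2 by rewrite /x1 (normcM (mobius a z)); ring.
have E4 : A * normc y0 ^+ 2 + normc (mobius a w) ^+ 2 * (B * normc (1 - b^*%C * w)^-1 ^+ 2)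
   = A * normc y0 ^+ 2 + B * normc y1 ^+ 2 by rewrite /y1 (normcM (mobius a w)); ring.
rewrite -/x0 -/y0 E3 E4 lagrange E1 !normcM normcV !normcM.
rewrite (normc_subC w z).
have sq x : 0 < x -> x <= 2 -> x ^+ 2 <= 4 :> R by move=> ? ?; nra.
have Saz := sq _ daz Laz; have Saw := sq _ daw Law.
have Sbz := sq _ dbz Lbz; have Sbw := sq _ dbw Lbw.
move: Saz Saw Sbz Sbw daz daw dbz dbw {E1 Laz Law Lbz Lbw}.
move: (normc (1 - a^*%C * z)) (normc (1 - a^*%C * w)) (normc (1 - b^*%C * z))
  (normc (1 - b^*%C * w)) (normc (z - w)) (normc (1 - b^*%C * a)).
move=> p q r s k l hp hq hr hs p0 q0 r0 s0.
have -> : A * B * (k * l / (p * q * (r * s))) ^+ 2 =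
    A * B * (k ^+ 2 * l ^+ 2) * (p ^+ 2 * q ^+ 2 * (r ^+ 2 * s ^+ 2))^-1.
  by field; rewrite !gt_eqF.
have -> : A * B * l ^+ 2 / 256 * k ^+ 2 = A * B * (k ^+ 2 * l ^+ 2) * 256^-1.
  by ring.
apply: ler_wpM2l.
  by apply: mulr_ge0; apply: mulr_ge0; rewrite ?sqr_ge0 ?(ltW A0) ?(ltW B0).
rewrite lef_pV2 ?posrE; [|by rewrite ltr0n|by rewrite !(mulr_gt0, exprn_gt0)].
(* Each of the four denominators has modulus at most 2 and enters the estimate squared. *)
have e256 : 256 = 4 * 4 * (4 * 4) :> R by ring.
rewrite e256.
by apply: ler_pM; rewrite ?(mulr_ge0 (sqr_ge0 _) (sqr_ge0 _))//;
  apply: ler_pM; rewrite ?sqr_ge0.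
Qed.

End blaschke_factors.

(** * The pseudo-hyperbolic metric and its contraction *)

Section pseudo_hyperbolic.
Variable R : realType.
Local Notation C := R[i].
Implicit Types (z w u v : C).

Definition defect z : R := 1 - normc z ^+ 2.

(* The square of the pseudo-hyperbolic distance. *)
Definition sqr_ph z w : R := normc (z - w) ^+ 2 / normc (1 - z * w^*%C) ^+ 2.

Lemma sqr_ph_ge0 z w : 0 <= sqr_ph z w.
Proof. by rewrite divr_ge0 ?sqr_ge0. Qed.

Lemma defect_le1 z : defect z <= 1.
Proof. by rewrite /defect gerBl sqr_ge0. Qed.

Lemma defect_gt0 z : (0 < defect z) = (normc z < 1).
Proof. by rewrite subr_gt0 expr_lt1// normc_ge0. Qed.

Lemma ph_den_gt0 z w : normc z < 1 -> normc w < 1 -> 0 < normc (1 - z * w^*%C).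
Proof. by move=> z1 w1; rewrite mulrC normc_mobius_den// ltW. Qed.

Lemma ph_den_le2 z w : normc z < 1 -> normc w < 1 -> normc (1 - z * w^*%C) <= 2.
Proof.
move=> z1 w1; apply: le_trans (normcD_le _ _) _.
rewrite normc1 normc_opp -lerBrDl (_ : 2 - 1 = 1); last by ring.
by rewrite mulrC ltW// normcM_lt1// ltW.
Qed.

Lemma one_sub_sqr_ph z w : normc z < 1 -> normc w < 1 ->
  1 - sqr_ph z w = defect z * defect w / normc (1 - z * w^*%C) ^+ 2.
Proof.
move=> z1 w1; have n0 := ph_den_gt0 z1 w1.
have <- : normc (1 - z * w^*%C) ^+ 2 - normc (z - w) ^+ 2 = defect z * defect w.
  by rewrite (mulrC z) sqr_normc_mobius mulrC.
by rewrite mulrBl divff// expf_neq0// gt_eqF.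
Qed.

Lemma sqr_ph_lt1 z w : normc z < 1 -> normc w < 1 -> sqr_ph z w < 1.
Proof.
move=> z1 w1; rewrite -subr_gt0 one_sub_sqr_ph//; apply: divr_gt0.
  by rewrite mulr_gt0 ?defect_gt0.
by rewrite exprn_gt0// ph_den_gt0.
Qed.

Lemma sqr_normc_sub_le_ph z w : normc z < 1 -> normc w < 1 ->
  normc (z - w) ^+ 2 <= 4 * sqr_ph z w.
Proof.
move=> z1 w1; have n0 := ph_den_gt0 z1 w1; have n2 := ph_den_le2 z1 w1.
have -> : normc (z - w) ^+ 2 = normc (1 - z * w^*%C) ^+ 2 * sqr_ph z w.
  by rewrite /sqr_ph mulrCA divff ?mulr1// expf_neq0// gt_eqF.
rewrite ler_wpM2r ?sqr_ph_ge0//; nra.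
Qed.

Lemma defect_le_den z w : normc z < 1 -> normc w < 1 ->
  defect z <= 2 * normc (1 - z * w^*%C).
Proof.
move=> z1 w1; apply: le_trans (_ : 2 * (1 - normc z) <= _).
  by rewrite /defect; have := normc_ge0 z; nra.
rewrite ler_pM2l//; apply: le_trans (normc_sub_le _ _).
rewrite normc1 lerD2l lerN2 normcM normc_conj.
by rewrite ler_piMr ?normc_ge0 ?ltW.
Qed.

(** Let Y and Y' be the squared distances before and after, N and N' the moduli of their
    denominators. The Pick determinant equals (N'^2 / N^2) (Y - Y') / (1 - Y), so a lower bound for
    it is a definite decrease of Y. The 16 comes from N'^2 <= 4 and k^4 <= 4 N^2 [defect z]
    [defect w]. *)
Lemma sqr_ph_contract u v z w (c k : R) :
  normc u < 1 -> normc v < 1 -> normc z < 1 -> normc w < 1 ->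
  0 <= c -> 0 <= k -> k <= defect z -> k <= defect w ->
  c * normc (z - w) ^+ 2 <=
    pick_diag u z * pick_diag v w - normc (pick_kernel u v z w) ^+ 2 ->
  sqr_ph u v <= (1 - c * k ^+ 4 / 16) * sqr_ph z w.
Proof.
move=> u1 v1 z1 w1 c0 k0 kz kw.
have N0 := ph_den_gt0 z1 w1; have N0' := ph_den_gt0 u1 v1.
have N2' := ph_den_le2 u1 v1; have kN := defect_le_den z1 w1.
have Dz : 0 < defect z by rewrite defect_gt0.
have Dw : 0 < defect w by rewrite defect_gt0.
have Y0 := sqr_ph_ge0 z w.
have E1 := one_sub_sqr_ph z1 w1; have E2 := one_sub_sqr_ph u1 v1.
rewrite /pick_diag /pick_kernel -!/(defect _) normcM normcV.
have -> : normc (z - w) ^+ 2 = normc (1 - z * w^*%C) ^+ 2 * sqr_ph z w.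
  by rewrite /sqr_ph mulrCA divff ?mulr1// expf_neq0// gt_eqF.
move: (normc (1 - z * w^*%C)) (normc (1 - u * v^*%C)) N0 N0' N2' kN E1 E2.
move=> N N' N0 N0' N2' kN E1 E2.
set P := defect u * defect v in E2 *.
move: (defect z) (defect w) kz kw Dz Dw E1 E2 kN => Dz Dw.
move: (sqr_ph z w) (sqr_ph u v) Y0 => Y Y' Y0 kz kw z0 w0 E1 E2 kN.
have -> : defect u / Dz * (defect v / Dw) = defect u * defect v / (Dz * Dw).
  by field; rewrite !gt_eqF.
rewrite -/P exprMn exprVn => h.
have NN0 : 0 < N ^+ 2 by rewrite exprn_gt0.
have NN0' : 0 < N' ^+ 2 by rewrite exprn_gt0.
have DD0 : 0 < Dz * Dw by rewrite mulr_gt0.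
have DDE : Dz * Dw = (1 - Y) * N ^+ 2 by rewrite E1 divfK// gt_eqF.
have PE : P = (1 - Y') * N' ^+ 2 by rewrite E2 divfK// gt_eqF.
have h2 : (1 - Y) * N' ^+ 2 + c * (N ^+ 2 * Y) * (Dz * Dw) <= P.
  have : (N' ^+ 2 / N ^+ 2 + c * (N ^+ 2 * Y)) * (Dz * Dw) <= P.
    by rewrite -ler_pdivlMr// addrC -lerBrDr.
  rewrite mulrDl; congr (_ + _ <= _).
  by rewrite DDE mulrCA mulrA; field; rewrite gt_eqF.
have k2 : k ^+ 2 <= Dz * Dw by rewrite expr2 ler_pM.
have k3 : k ^+ 2 <= 4 * N ^+ 2.
  rewrite (_ : 4 * _ = (2 * N) ^+ 2); last by ring.
  by rewrite lerXn2r ?nnegrE ?mulr_ge0 ?(ltW N0)// (le_trans kz).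
have k4 : k ^+ 4 <= 4 * (N ^+ 2 * (Dz * Dw)).
  rewrite (_ : k ^+ 4 = k ^+ 2 * k ^+ 2); last by ring.
  by rewrite mulrA ler_pM ?sqr_ge0.
have N4 : N' ^+ 2 <= 4 by nra.
have cY : 0 <= c * Y by rewrite mulr_ge0.
have h3 : c * Y * k ^+ 4 <= 4 * (c * (N ^+ 2 * Y) * (Dz * Dw)).
  by have := ler_wpM2l cY k4; rewrite (_ : 4 * (c * _ * _) =
    c * Y * (4 * (N ^+ 2 * (Dz * Dw))))//; ring.
have k40 : 0 <= k ^+ 4 by rewrite exprn_ge0.
have h4 : c * k ^+ 4 / 16 * Y * N' ^+ 2 <= c * (N ^+ 2 * Y) * (Dz * Dw).
  have : c * Y * k ^+ 4 * N' ^+ 2 <= c * Y * k ^+ 4 * 4 by rewrite ler_wpM2l// mulr_ge0.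
  by move: h3; rewrite (_ : c * k ^+ 4 / 16 * Y * N' ^+ 2 =
    c * Y * k ^+ 4 * N' ^+ 2 / 16); [lra|ring].
rewrite -(ler_pM2r NN0'); move: h2; rewrite PE; lra.
Qed.

End pseudo_hyperbolic.

(** * Blaschke products *)

Section blaschke_cocycle_theory.
Context d (Omega : measurableType d) (R : realType).
Variable B : blaschke_cocycle Omega R.
Local Notation C := R[i].
Local Notation m := (@haar R).
Implicit Types (w : Omega).

Lemma bmapE w (z : C) :
  bmap B w z = brot B w * \prod_(i < bdeg B w) mobius (bzero B w i) z.
Proof. by []. Qed.

Lemma inner_map_bmap w : inner_map (bmap B w) (bcircle B w).
Proof.
have z1 i : (i < bdeg B w)%N -> normc (bzero B w i) < 1 by exact: bzero_disk.
have prod_le1 z : normc z <= 1 ->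
    normc (\prod_(i < bdeg B w) mobius (bzero B w i) z) <= 1.
  move=> zl; elim/big_rec : _ => [|i x _ x1]; first by rewrite normc1.
  rewrite normcM mulr_ile1 ?normc_ge0//.
  by apply: normc_mobius_le1 => //; exact: z1.
split.
- apply: disc_algebraM; first exact: disc_algebra_cst.
  by apply: disc_algebra_prod => i _; apply: disc_algebra_mobius; exact: z1.
- by move=> z zl; rewrite bmapE normcM brot_circle mul1r prod_le1.
- move=> z zl; rewrite bmapE normcM brot_circle mul1r.
  have [n nE] : exists n, bdeg B w = n.+1.
    by exists (bdeg B w).-1; rewrite prednK// bdeg_gt0.
  have := z1; rewrite nE => z1'; rewrite big_ord_recl normcM.
  apply: (@le_lt_trans _ _ (normc (mobius (bzero B w 0%N) z))).
    apply: ler_piMr; first exact: normc_ge0.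
    elim/big_rec : _ => [|i x _ x1]; first by rewrite normc1.
    rewrite normcM mulr_ile1 ?normc_ge0//.
    by apply: normc_mobius_le1 (ltW zl); exact: z1' (ltn_ord (lift ord0 i)).
  by apply: normc_mobius_lt1 => //; exact: z1'.
- by [].
Qed.

Lemma measurable_bcircle w : measurable_fun [set: circle R] (bcircle B w).
Proof. exact: measurable_inner_map (inner_map_bmap w). Qed.

Lemma speedE w (z : circle R) :
  normc ((bmap B w)^`()%classic (circle_val z)) =
  \sum_(i < bdeg B w) poisson (bzero B w i) z.
Proof.
have zi i : (i < bdeg B w)%N -> normc (bzero B w i) < 1 by exact: bzero_disk.
have h := is_derive_prod_mobius zi (normc_circle z).
have h2 : is_derive (circle_val z : C) (1 : C) (bmap B w : C -> C) _ :=
  is_deriveZ (brot B w) h.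
rewrite derive1E; have [_ ->] := h2.
rewrite /GRing.scale/= !normcM brot_circle mul1r normc_conj normc_circle mulr1.
rewrite normc_real ger0_norm; last first.
  by apply: sumr_ge0 => i _; apply: (poisson_ge0 z); exact: zi.
rewrite [X in X * _](_ : _ = 1) ?mul1r//.
elim/big_rec : _ => [|i x _ x1]; first by rewrite normc1.
by rewrite normcM x1 mulr1 normc_mobius ?normc_circle ?zi.
Qed.

Lemma inf_speed_le w (z : circle R) :
  inf_speed B w <= \sum_(i < bdeg B w) poisson (bzero B w i) z.
Proof.
rewrite -speedE; apply: ge_inf; last by exists z.
by exists 0 => _ [y _ <-]; exact: normc_ge0.
Qed.

Lemma inf_speed_gt0 w : 0 < inf_speed B w.
Proof.
have zi : normc (bzero B w 0) < 1 by apply: bzero_disk; exact: bdeg_gt0.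
apply: lt_le_trans (_ : defect (bzero B w 0) / 4 <= _).
  by rewrite divr_gt0// defect_gt0.
apply: lb_le_inf; first by exists (normc ((bmap B w)^`()%classic (circle_exp 0))); exists (circle_exp 0).
move=> _ [z _ <-]; rewrite speedE.
have [n nE] : exists n, bdeg B w = n.+1.
  by exists (bdeg B w).-1; rewrite prednK// bdeg_gt0.
have := @bzero_disk _ _ _ B w; rewrite nE => zi'.
rewrite big_ord_recl; apply: le_trans (poisson_ge z zi) _; rewrite lerDl.
by apply: sumr_ge0 => i _; rewrite poisson_ge0// (zi' _ (ltn_ord (lift ord0 i))).
Qed.

(** The integrand of the third admissibility condition. By [Rintegral_comp_bcircle_le] it bounds the
    density of the image of Lebesgue measure. *)
Definition distortion w : R := (bdeg B w)%:R / inf_speed B w.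

(* The Poisson kernel at a zero of the map is sent to Lebesgue measure, and
   these kernels sum up to the derivative. *)
Lemma Rintegral_comp_bcircle_le w (g : circle R -> R) (M : R) :
  measurable_fun [set: circle R] g -> (forall z, 0 <= g z) ->
  (forall z, `|g z| <= M) ->
  \int[m]_z g (bcircle B w z) <= distortion w * \int[m]_z g z.
Proof.
move=> mg g0 gM.
have r0 := inf_speed_gt0 w.
have mgB : measurable_fun setT (g \o bcircle B w).
  by apply: measurableT_comp => //; exact: measurable_bcircle.
have zi i : (i < bdeg B w)%N -> normc (bzero B w i) < 1 by exact: bzero_disk.
have ig : m.-integrable setT (EFin \o (g \o bcircle B w)).
  by apply: (bounded_integrable m (M := M)) => // z; exact: gM.
have S0 i : (i < bdeg B w)%N ->
    \int[m]_z (g (bcircle B w z) * poisson (bzero B w i) z) = \int[m]_z g z.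
  move=> iw; have a1 := zi i iw.
  have := Rintegral_harmonic_inner_map (inner_map_bmap w) a1 mg.
  rewrite (@Rintegral_harmonic_measure _ _ _ M mgB (fun z => gM _)).
  rewrite to_discE// => ->.
  have -> : bmap B w (bzero B w i) = 0.
    rewrite bmapE (bigD1 (Ordinal iw))//= {1}/mobius subrr mul0r.
    by rewrite mul0r mulr0.
  rewrite (@Rintegral_harmonic_measure _ _ _ M mg gM).
  rewrite to_discE ?normc0//; apply: eq_Rintegral => z _.
  by rewrite /poisson normc0 expr0n subr0 subr0 normc_circle expr1n divr1 mulr1.
have ii i : (i < bdeg B w)%N -> m.-integrable setT
    (EFin \o (fun z => g (bcircle B w z) * poisson (bzero B w i) z)).
  move=> iw.
  apply: (bounded_integrable m (M := M * (4 / (1 - normc (bzero B w i) ^+ 2)))).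
    by apply: measurable_funM => //; exact: measurable_poisson.
  by move=> z; rewrite normrM ler_pM// normr_poisson_le// zi.
have sumE n : (n <= bdeg B w)%N ->
    m.-integrable setT (EFin \o (fun z => g (bcircle B w z) *
      \sum_(i < n) poisson (bzero B w i) z)) /\
    \int[m]_z (g (bcircle B w z) * \sum_(i < n) poisson (bzero B w i) z) =
    n%:R * \int[m]_z g z.
  elim: n => [|n IHn] nw.
    under eq_Rintegral do rewrite big_ord0 mulr0.
    rewrite Rintegral_haar_cst mul0r; split => //.
    apply: (eq_integrable measurableT (cst 0%E)) => //.
      by move=> z _ /=; rewrite big_ord0 mulr0.
    exact: integrable0.
  have [i1 i2] := IHn (ltnW nw).
  split.
    rewrite (_ : (fun z => g (bcircle B w z) * _) = fun z =>
      g (bcircle B w z) * \sum_(i < n) poisson (bzero B w i) z +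
      g (bcircle B w z) * poisson (bzero B w n) z); last first.
      by apply/funext => z; rewrite big_ord_recr/= mulrDr.
    exact: (integrableD measurableT i1 (ii n nw)).
  under eq_Rintegral do rewrite big_ord_recr/= mulrDr.
  rewrite RintegralD//; last exact: ii.
  by rewrite i2 S0// -natr1 mulrDl mul1r.
have [i1 i2] := sumE _ (leqnn _).
have : inf_speed B w * \int[m]_z g (bcircle B w z) <= (bdeg B w)%:R * \int[m]_z g z.
  rewrite -i2 -RintegralZl//; apply: le_Rintegral => //.
    exact: (integrableZl measurableT (inf_speed B w) ig).
  by move=> z _; rewrite mulrC ler_wpM2l// inf_speed_le.
by rewrite /distortion mulrAC ler_pdivlMr// mulrC.
Qed.

Lemma distortion_ge1 w : 1 <= distortion w.
Proof.
have h1 (z : circle R) : 0 <= (cst 1 z : R) by rewrite /= ler01.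
have h2 (z : circle R) : `|(cst 1 z : R)| <= 1 by rewrite /= normr1.
have h3 : measurable_fun [set: circle R] (cst (1 : R)) by [].
have := Rintegral_comp_bcircle_le w h3 h1 h2.
by rewrite !Rintegral_haar_cst mulr1.
Qed.

(** Integrate the Poisson kernel of u, the image of z, against the harmonic measure at u itself. The
    result is [2 / defect u - 1], hence at least [1 / defect u]. Pulled back to z, where the
    harmonic density is at most [4 / defect z], it is at most [4 / defect z * distortion w]. *)
Lemma defect_bmap_ge w (z : C) : normc z < 1 ->
  defect z <= 4 * distortion w * defect (bmap B w z).
Proof.
move=> z1; have [_ _ T1 _] := inner_map_bmap w; have u1 := T1 z z1.
set u := bmap B w z in u1 *.
have D0 : 0 < defect z by rewrite defect_gt0.
have U0 : 0 < defect u by rewrite defect_gt0.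
have mP := @measurable_poisson R u.
have PM := fun y => normr_poisson_le y u1.
have lo : (defect u)^-1 <= \int[harmonic_measure u]_y poisson u y.
  rewrite Rintegral_poisson_harmonic//.
  have -> : u^*%C * u = ((normc u ^+ 2)%:C)%C by rewrite sqr_normcC mulrC.
  rewrite -[1 - _]/(real_complex R 1 - _) -(rmorphB (real_complex R)) -fmorphV/=.
  have : 1 <= (defect u)^-1 by rewrite invf_ge1// defect_le1.
  by rewrite /defect; lra.
have hi : \int[harmonic_measure u]_y poisson u y <=
    4 / defect z * distortion w.
  rewrite -(Rintegral_harmonic_inner_map (inner_map_bmap w) z1 mP).
  have mPB : measurable_fun setT (poisson u \o bcircle B w).
    by apply: measurableT_comp => //; exact: measurable_bcircle.
  rewrite (@Rintegral_harmonic_measure _ _ _ _ mPB (fun y => PM _)) to_discE//.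
  have iP : m.-integrable setT (EFin \o (poisson u \o bcircle B w)).
    exact: (bounded_integrable m mPB (fun y => PM _)).
  apply: (@le_trans _ _ (4 / defect z * \int[m]_y poisson u (bcircle B w y))).
    rewrite -RintegralZl//; apply: le_Rintegral => //.
    - apply: (bounded_integrable m (M := 4 / (1 - normc u ^+ 2) * (4 / (1 - normc z ^+ 2)))).
        by apply: measurable_funM => //; exact: measurable_poisson.
      by move=> y; rewrite normrM ler_pM// ?PM// normr_poisson_le.
    - exact: (integrableZl measurableT (4 / defect z) iP).
    - move=> y _; rewrite mulrC; apply: ler_wpM2r; first exact: poisson_ge0.
      exact: poisson_le.
  rewrite ler_wpM2l//; first by rewrite divr_ge0// ltW.
  apply: le_trans (Rintegral_comp_bcircle_le w mP (fun y => poisson_ge0 y u1) PM) _.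
  by rewrite Rintegral_poisson// mulr1.
have := le_trans lo hi; rewrite mulrAC ler_pdivlMr// mulrC ler_pdivrMr//.
Qed.

(** Near the circle the i-th factor has defect [q i * defect z], where [q i] is close to the Poisson
    kernel of the i-th zero at the radial projection zeta of z, and these kernels sum to the
    derivative at zeta. The loss t pays for this comparison and for the factor |T z|^2 of
    [one_sub_prod_ge]; when |T z|^2 is too small for that, the first term of the minimum is already
    reached. *)
Lemma boundary_expansion w (z : C) (t b : R) : 0 < t -> t < 1 -> 0 < b -> b <= 1 ->
  (forall i, (i < bdeg B w)%N -> b <= 1 - normc (bzero B w i)) ->
  normc z < 1 -> defect z <= b * (1 - t) / 4 ->
  Order.min ((1 - t) / 2) (t * inf_speed B w * defect z) <= defect (bmap B w z).
Proof.
move=> t0 t1 b0 b1 hb z1 Dz.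
have D0 : 0 < defect z by rewrite defect_gt0.
have z0 : 0 < normc z.
  rewrite normc_gt0; apply/eqP => zE; move: Dz.
  rewrite zE /defect normc0 expr0n/= subr0; nra.
rewrite ge_min; have [//|Du] := leP ((1 - t) / 2) (defect (bmap B w z)).
rewrite /=.
have zi i : (i < bdeg B w)%N -> normc (bzero B w i) < 1 by exact: bzero_disk.
have e1 : normc (z / (normc z)%:C%C) == 1.
  by rewrite normcM normcV normc_real ger0_norm ?normc_ge0// divff// gt_eqF.
pose zeta := Circle e1.
pose q i := (1 - normc (bzero B w i) ^+ 2) / normc (1 - (bzero B w i)^*%C * z) ^+ 2.
have tE i : (i < bdeg B w)%N ->
    1 - normc (mobius (bzero B w i) z) ^+ 2 = q i * defect z.
  by move=> iw; rewrite sqr_normc_mobiusE ?zi ?(ltW z1)// /q mulrAC.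
have qge i : (i < bdeg B w)%N ->
    (1 - (1 - t) / 2) * q i >= t * poisson (bzero B w i) zeta.
  move=> iw; have a1 := zi i iw; have ai := hb i iw.
  have zn : normc (circle_val zeta - z) = 1 - normc z.
    have -> : circle_val zeta - z = circle_val zeta * ((1 - normc z)%:C)%C.
      rewrite /zeta/= rmorphB mulrBr mulr1 divfK//.
      by rewrite -normc_gt0 normc_real gtr0_norm.
    by rewrite normcM normc_circle mul1r normc_real ger0_norm// subr_ge0 ltW.
  set a := bzero B w i in a1 ai *.
  have A0 : 0 < 1 - normc a ^+ 2 by rewrite subr_gt0 expr_lt1 ?normc_ge0.
  rewrite /poisson /q -/a.
  have dz0 := normc_mobius_den a1 (ltW z1).
  have zeta0 := normc_sub_circle_gt0 zeta a1.
  have den : normc (1 - a^*%C * z) <= normc (circle_val zeta - a) + defect z.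
    rewrite (_ : 1 - _ = (1 - a^*%C * circle_val zeta) + a^*%C * (circle_val zeta - z));
      last by ring.
    apply: le_trans (normcD_le _ _) _; apply: lerD.
      have := sqr_normc_mobius a (circle_val zeta).
      rewrite normc_circle expr1n subrr mulr0 => /eqP; rewrite subr_eq0.
      by rewrite eqrXn2// ?normc_ge0// => /eqP ->.
    rewrite normcM normc_conj zn /defect.
    have := normc_ge0 z; have := normc_ge0 a; nra.
  have zb : b <= normc (circle_val zeta - a).
    apply: (le_trans ai); apply: le_trans (normc_sub_le _ _).
    by rewrite normc_circle.
  have den2 : normc (1 - a^*%C * z) <=
      normc (circle_val zeta - a) * (1 + (1 - t) / 4).
    apply: (le_trans den); rewrite mulrDr mulr1 lerD2l.
    apply: (le_trans Dz); rewrite -mulrA ler_wpM2r//; lra.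
  rewrite mulrCA [leRHS]mulrCA ler_pM2l// ler_pdivrMr ?exprn_gt0//.
  rewrite mulrAC ler_pdivlMr ?exprn_gt0//.
  have : normc (1 - a^*%C * z) ^+ 2 <=
      normc (circle_val zeta - a) ^+ 2 * (1 + (1 - t) / 4) ^+ 2.
    rewrite -exprMn lerXn2r ?nnegrE ?normc_ge0// mulr_ge0 ?normc_ge0//; lra.
  move: (normc (1 - a^*%C * z) ^+ 2) => x.
  have : 0 < normc (circle_val zeta - a) ^+ 2 by rewrite exprn_gt0.
  move: (normc (circle_val zeta - a) ^+ 2) => y y0 xy.
  (* With s = 1 - t both sides differ by s^2 (7 + s) / 16. The factor 1 + s/4 is what the bound
     [b * (1 - t) / 4] on the defect yields for the ratio of the distances. *)
  have tt : t * (1 + (1 - t) / 4) ^+ 2 <= 1 - (1 - t) / 2.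
    rewrite -subr_ge0 [leRHS](_ : _ = (1 - t) ^+ 2 * (7 + (1 - t)) / 16); last by field.
    by rewrite divr_ge0// mulr_ge0 ?sqr_ge0//; lra.
  apply: (@le_trans _ _ (t * (y * (1 + (1 - t) / 4) ^+ 2))).
    by rewrite ler_wpM2l// ltW.
  by rewrite mulrCA mulrC ler_pM2r.
have := @one_sub_prod_ge _ (bdeg B w) (fun i => normc (mobius (bzero B w i) z) ^+ 2).
have TE : normc (bmap B w z) ^+ 2 =
    \prod_(i < bdeg B w) normc (mobius (bzero B w i) z) ^+ 2.
  rewrite bmapE normcM brot_circle mul1r.
  elim/big_rec2 : _ => [|i y x _ IH]; first by rewrite normc1 expr1n.
  by rewrite normcM exprMn IH.
rewrite -TE => /(_ _)[].
  move=> i iw; rewrite sqr_ge0/= expr_le1 ?normc_ge0//.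
  by apply: normc_mobius_le1 (ltW z1); exact: zi.
move=> _; rewrite -/(defect _); apply: le_trans.
rewrite (eq_bigr (fun i : 'I__ => q i * defect z)); last by move=> i _; exact: tE.
rewrite -mulr_suml mulrA ler_wpM2r ?(ltW D0)//.
apply: (@le_trans _ _ ((1 - (1 - t) / 2) * \sum_(i < bdeg B w) q i)); last first.
  apply: ler_wpM2r; last by move: Du; rewrite /defect; lra.
  apply: sumr_ge0 => i _; rewrite /q divr_ge0 ?sqr_ge0//.
  by rewrite subr_ge0 expr_le1 ?normc_ge0// ltW// zi.
rewrite mulr_sumr; apply: le_trans (_ : t * \sum_(i < bdeg B w) poisson (bzero B w i) zeta <= _).
  by rewrite ler_wpM2l ?(ltW t0)// inf_speed_le.
by rewrite mulr_sumr; apply: ler_sum => i _; exact: qge.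
Qed.

(* The amount of contraction of the pseudo-hyperbolic distance by two factors. *)
Definition folding w : R := if (1 < bdeg B w)%N then
  (1 - normc (bzero B w 0) ^+ 2) * (1 - normc (bzero B w 1) ^+ 2)
    * normc (1 - (bzero B w 1)^*%C * bzero B w 0) ^+ 2 / 256 else 0.

Lemma folding_gt0 w : (1 < bdeg B w)%N -> 0 < folding w.
Proof.
move=> n1; rewrite /folding n1.
have a1 : normc (bzero B w 0) < 1 by apply: bzero_disk; exact: bdeg_gt0.
have b1 : normc (bzero B w 1) < 1 by exact: bzero_disk.
apply: divr_gt0; last by rewrite ltr0n.
rewrite mulr_gt0 ?exprn_gt0 ?normc_mobius_den ?(ltW a1)//.
by rewrite mulr_gt0// sqr_normc_lt1.
Qed.

Lemma folding_ge0 w : 0 <= folding w.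
Proof.
have [/folding_gt0/ltW//|] := boolP (1 < bdeg B w)%N.
by rewrite /folding => /negbTE ->.
Qed.

Lemma folding_le w : folding w <= 4 / 256.
Proof.
rewrite /folding; case: ifPn => n1; last by apply: divr_ge0; exact: ler0n.
have a1 : normc (bzero B w 0) < 1 by apply: bzero_disk; exact: bdeg_gt0.
have b1 : normc (bzero B w 1) < 1 by exact: bzero_disk.
apply: ler_wpM2r; first by rewrite invr_ge0; exact: ler0n.
have A0 := sqr_normc_lt1 a1; have B0 := sqr_normc_lt1 b1.
have A1 := defect_le1 (bzero B w 0); have B1 := defect_le1 (bzero B w 1).
rewrite /defect in A1 B1.
have : normc (1 - (bzero B w 1)^*%C * bzero B w 0) ^+ 2 <= 4.
  have := ph_den_le2 a1 b1; have := ph_den_gt0 a1 b1; rewrite mulrC.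
  by move: (normc _) => x; nra.
have : (1 - normc (bzero B w 0) ^+ 2) * (1 - normc (bzero B w 1) ^+ 2) <= 1.
  by rewrite mulr_ile1// ltW.
have : 0 <= (1 - normc (bzero B w 0) ^+ 2) * (1 - normc (bzero B w 1) ^+ 2).
  by rewrite mulr_ge0// ltW.
move: (_ * _) => x x0 x1; have := sqr_ge0 (normc (1 - (bzero B w 1)^*%C * bzero B w 0)).
move: (_ ^+ 2) => y; nra.
Qed.

(** The rotation does not change the Pick matrix; the first two factors provide the determinant, and
    the remaining ones add a positive matrix, which does not decrease it. In degree 1 [folding] is 0
    and positivity alone is used. *)
Lemma sqr_ph_bmap w (z z' : C) (k : R) : normc z < 1 -> normc z' < 1 ->
  0 <= k -> k <= defect z -> k <= defect z' ->
  sqr_ph (bmap B w z) (bmap B w z') <=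
  (1 - folding w * k ^+ 4 / 16) * sqr_ph z z'.
Proof.
move=> z1 z1' k0 kz kz'; have [_ _ T1 _] := inner_map_bmap w.
apply: sqr_ph_contract => //; [exact: T1|exact: T1|exact: folding_ge0|].
have zi i : (i < bdeg B w)%N -> normc (bzero B w i) < 1 by exact: bzero_disk.
have rr : brot B w * (brot B w)^*%C = 1 by rewrite -sqr_normcC brot_circle expr1n.
rewrite !bmapE.
have dE u y : pick_diag (brot B w * u) y = pick_diag u y.
  by rewrite /pick_diag normcM brot_circle mul1r.
have kE u v : pick_kernel (brot B w * u) (brot B w * v) z z' = pick_kernel u v z z'.
  by rewrite /pick_kernel rmorphM/= mulrACA rr mul1r.
rewrite !dE kE.
have [n1|n1] := boolP (1 < bdeg B w)%N; last first.
  rewrite {1}/folding (negbTE n1) mul0r subr_ge0.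
  by have [] := psd2_prod_mobius zi z1 z1'.
rewrite /folding n1.
have [n nE] : exists n, bdeg B w = n.+2.
  by exists (bdeg B w).-2; case: (bdeg B w) n1 => [//|[]].
have := zi; rewrite nE => zi'.
pose a := bzero B w 0; pose b := bzero B w 1.
pose G u := \prod_(i < n) mobius (bzero B w i.+2) u.
have PE u : \prod_(i < n.+2) mobius (bzero B w i) u = mobius a u * mobius b u * G u.
  by rewrite !big_ord_recl (mulrA (mobius _ u)).
rewrite !PE.
apply: le_trans (pick_det_mobius2 (zi' 0%N isT) (zi' 1%N isT) z1 z1') _.
have hG : psd2 (pick_diag (G z) z) (pick_diag (G z') z') (pick_kernel (G z) (G z') z z').
  exact: (@psd2_prod_mobius _ n (fun i => bzero B w i.+2) z z' (fun i lt_in => zi' i.+2 lt_in)).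
have zi2 : forall i, (i < 2)%N -> normc (bzero B w i) < 1.
  by move=> i i2; apply: zi'; rewrite (leq_trans i2).
have hF : psd2 (pick_diag (mobius a z * mobius b z) z)
    (pick_diag (mobius a z' * mobius b z') z')
    (pick_kernel (mobius a z * mobius b z) (mobius a z' * mobius b z') z z').
  have := psd2_prod_mobius zi2 z1 z1'.
  by rewrite !big_ord_recl !big_ord0 !mulr1.
rewrite [in leRHS]pick_kernelM !(pick_diagM (mobius a _ * mobius b _)).
have [_] := psd2_det_add hF (psd2_scale (mobius a z * mobius b z)
  (mobius a z' * mobius b z') hG).
exact.
Qed.

Lemma sqr_ph_bmap_le w (z z' : C) : normc z < 1 -> normc z' < 1 ->
  sqr_ph (bmap B w z) (bmap B w z') <= sqr_ph z z'.
Proof.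
move=> z1 z1'; have := @sqr_ph_bmap w z z' 0 z1 z1' (lexx _).
rewrite expr0n mulr0 mul0r subr0 mul1r; apply.
  by rewrite ltW// defect_gt0.
by rewrite ltW// defect_gt0.
Qed.

End blaschke_cocycle_theory.

(** * Measurability in the random parameter *)

Section blaschke_measurability.
Context d (Omega : measurableType d) (R : realType).
Variable B : blaschke_cocycle Omega R.
Local Notation C := R[i].

Lemma measurable_bdeg_eq j : measurable [set w | bdeg B w = j].
Proof.
rewrite -[X in measurable X]setTI.
by apply: (@bdeg_measurable _ _ _ B measurableT [set j]).
Qed.

(** The zeros are measurable on each set of constant degree, where their number is fixed; the
    extension by 0 makes the i-th one measurable on the whole space. *)
Definition zero_or0 i w : C := if (i < bdeg B w)%N then bzero B w i else 0.

Lemma cmeasurable_zero_or0 i : cmeasurable [set: Omega] (zero_or0 i).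
Proof.
apply/measurable_borelC.
have -> : [set: Omega] = \bigcup_j [set w | bdeg B w = j].
  by apply/esym/seteqP; split=> // w _; exists (bdeg B w).
apply/measurable_fun_bigcup; first by move=> j; exact: measurable_bdeg_eq.
move=> j; have [ij|ij] := ltnP i j; last first.
  apply: (eq_measurable_fun (cst (0 : borelC R))) => //.
  by move=> w; rewrite inE/= /zero_or0 => ->; rewrite ltnNge ij.
apply: (eq_measurable_fun (fun w => tnth
    ([tuple bzero B w i | i < j] : j.-tuple (borelC R)) (Ordinal ij))).
  by move=> w; rewrite inE/= /zero_or0 => ->; rewrite ij tnth_mktuple.
apply: (measurableT_comp (measurable_tnth (Ordinal ij))).
exact: bzero_measurable.
Qed.

Lemma cmeasurable_brot : cmeasurable [set: Omega] (brot B).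
Proof. exact/measurable_borelC/brot_measurable. Qed.

Lemma cmeasurable_bigcup d' (T : measurableType d') (E : nat -> set T) (f : T -> C) :
  (forall n, measurable (E n)) -> (forall n, cmeasurable (E n) f) ->
  cmeasurable (\bigcup_n E n) f.
Proof.
move=> mE mf; split; apply/measurable_fun_bigcup => // n; first by have [] := mf n.
by have [] := mf n.
Qed.

Lemma eq_cmeasurable d' (T : measurableType d') (D : set T) (f g : T -> C) :
  {in D, f =1 g} -> cmeasurable D f -> cmeasurable D g.
Proof.
move=> fg [f1 f2]; split.
  by apply: eq_measurable_fun f1 => t tD; rewrite fg.
by apply: eq_measurable_fun f2 => t tD; rewrite fg.
Qed.

Lemma cmeasurableT d' (T : measurableType d') (D : set T) (f : T -> C) :
  cmeasurable [set: T] f -> cmeasurable D f.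
Proof. by move=> [f1 f2]; split; exact: measurable_funTS. Qed.

Lemma cmeasurable_bmap d' (T : measurableType d') (f : T -> Omega) (Z : T -> C) :
  measurable_fun [set: T] f -> cmeasurable [set: T] Z ->
  cmeasurable [set: T] (fun t => bmap B (f t) (Z t)).
Proof.
move=> mf mZ.
have mE j : measurable (f @^-1` [set w | bdeg B w = j]).
  by rewrite -[X in measurable X]setTI; apply: mf => //; exact: measurable_bdeg_eq.
have -> : [set: T] = \bigcup_j (f @^-1` [set w | bdeg B w = j]).
  by apply/esym/seteqP; split=> // t _; exists (bdeg B (f t)).
apply: cmeasurable_bigcup => // j.
apply: (@eq_cmeasurable _ _ _ (fun t => brot B (f t) *
    \prod_(i <- index_enum 'I_j) mobius (zero_or0 i (f t)) (Z t))).
  move=> t; rewrite inE/= => tj; rewrite bmapE tj; congr (_ * _).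
  by apply: eq_bigr => i _; rewrite /zero_or0 tj ltn_ord.
apply: cmeasurableT; apply: cmeasurableM.
  exact: cmeasurable_comp cmeasurable_brot mf.
apply: cmeasurable_prod => i.
have mz := cmeasurable_comp (cmeasurable_zero_or0 i) mf.
apply: cmeasurableM; first exact: cmeasurableB.
apply: cmeasurableV => //; apply: cmeasurableB; first exact: cmeasurable_cst.
by apply: cmeasurableM => //; exact: cmeasurable_conj.
Qed.

Lemma measurable_skew d' (T : measurableType d') (f : T -> Omega)
    (g : T -> circle R) :
  measurable_fun [set: T] f -> measurable_fun [set: T] g ->
  measurable_fun [set: T] (fun t => bcircle B (f t) (g t)).
Proof.
move=> mf /measurable_circleP mg; apply/measurable_circleP.
exact: cmeasurable_bmap.
Qed.

Lemma measurable_bdeg_lt n : measurable_fun [set: Omega] (fun w => n < bdeg B w)%N.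
Proof. by apply: measurable_fun_ltn => //; exact: bdeg_measurable. Qed.

Lemma measurable_folding : measurable_fun [set: Omega] (folding B).
Proof.
have E : folding B = fun w => if (1 < bdeg B w)%N then
   (1 - normc (zero_or0 0 w) ^+ 2) * (1 - normc (zero_or0 1 w) ^+ 2)
    * normc (1 - (zero_or0 1 w)^*%C * zero_or0 0 w) ^+ 2 / 256 else 0.
  apply/funext => w; rewrite /folding /zero_or0 bdeg_gt0.
  by case: ifP.
rewrite E; apply: measurable_fun_ifT; [exact: measurable_bdeg_lt| |exact: measurable_cst].
have m0 := cmeasurable_zero_or0 0; have m1 := cmeasurable_zero_or0 1.
apply: measurable_funM; last exact: measurable_cst.
apply: measurable_funM.
  by apply: measurable_funM; apply: measurable_funB => //; exact: measurable_sqr_normc.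
apply: measurable_sqr_normc; apply: cmeasurableB; first exact: cmeasurable_cst.
by apply: cmeasurableM => //; exact: cmeasurable_conj.
Qed.

Definition zeros_inside (N : nat) : set Omega :=
  [set w | forall i, (i < bdeg B w)%N -> N.+1%:R^-1 <= 1 - normc (bzero B w i)].

Lemma measurable_zeros_inside N : measurable (zeros_inside N).
Proof.
have -> : zeros_inside N = \bigcap_i
    [set w | N.+1%:R^-1 <= 1 - Num.sqrt (normc (zero_or0 i w) ^+ 2)].
  apply/seteqP; split=> w h i.
    move=> _ /=; rewrite sqrtr_sqr ger0_norm ?normc_ge0// /zero_or0.
    case: ifPn => [/h//|_].
    by rewrite normc0 subr0 invf_le1 ?ler1n ?ltr0n.
  move=> iw; have := h i I; rewrite /= sqrtr_sqr ger0_norm ?normc_ge0//.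
  by rewrite /zero_or0 iw.
apply: bigcap_measurable => // i _; rewrite -[X in measurable X]setTI.
apply: (measurable_fun_ler (f := cst N.+1%:R^-1)
  (g := fun w => 1 - Num.sqrt (normc (zero_or0 i w) ^+ 2))) => //.
apply: measurable_funB => //; apply: measurableT_comp.
  by apply: continuous_measurable_fun; exact: sqrt_continuous.
exact: measurable_sqr_normc (cmeasurable_zero_or0 i).
Qed.

Lemma zeros_inside_cover w : exists N, forall n, (N <= n)%N -> zeros_inside n w.
Proof.
have [b b0 hb] : exists2 b : R, 0 < b &
    forall i, (i < bdeg B w)%N -> b <= 1 - normc (bzero B w i).
  have := @bzero_disk _ _ _ B w; elim: (bdeg B w) => [|n IHn] h.
    by exists 1.
  have [b b0 hb] := IHn (fun i lt_in => h i (ltnW lt_in)).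
  exists (Order.min b (1 - normc (bzero B w n))).
    by rewrite lt_min b0 subr_gt0 h.
  move=> i; rewrite ltnS leq_eqVlt => /orP[/eqP ->|lt_in].
    by rewrite ge_min lexx orbT.
  by rewrite ge_min hb.
have [N Nb] := exists_nat_gt b^-1; exists N => n Nn i iw.
apply: le_trans (hb i iw).
rewrite -[leRHS]invrK lef_pV2 ?posrE ?invr_gt0//.
by apply: (le_trans (ltW Nb)); rewrite ler_nat (leq_trans Nn).
Qed.

End blaschke_measurability.

(** * Backward compositions *)

Lemma geometric_cvg (R : realType) (u : nat -> R) (A r : R) :
  0 <= r -> r < 1 -> (forall n, `|u n.+1 - u n| <= A * r ^+ n) ->
  exists l : R, forall n, `|u n - l| <= A / (1 - r) * r ^+ n.
Proof.
move=> r0 r1 uA.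
have A0 : 0 <= A by have := uA 0%N; rewrite expr0 mulr1; exact: le_trans.
have s0 : 0 < 1 - r by rewrite subr_gt0.
have D0 : 0 <= A / (1 - r) by rewrite divr_ge0// ltW.
have uD n k : `|u (n + k)%N - u n| <= A / (1 - r) * (r ^+ n - r ^+ (n + k)).
  elim: k => [|k IHk]; first by rewrite addn0 !subrr normr0 mulr0.
  rewrite addnS -(subrKA (u (n + k)%N)) (le_trans (ler_normD _ _))//.
  apply: le_trans (lerD (uA _) IHk) _.
  rewrite exprS; move: (r ^+ n) (r ^+ (n + k)) => x y.
  rewrite (_ : A * y = A / (1 - r) * ((1 - r) * y)); last by rewrite mulrA divfK// gt_eqF.
  by rewrite -mulrDr ler_wpM2l//; lra.
have uB n k : `|u (n + k)%N - u n| <= A / (1 - r) * r ^+ n.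
  by apply: le_trans (uD n k) _; rewrite ler_wpM2l// gerBl exprn_ge0.
have cu : cvgn u.
  apply/cauchy_cvgP; apply: cauchy_exP => e e0.
  have [n rn] := @geometric_lt R r (e / (A / (1 - r) + 1)) r0 r1
    (divr_gt0 e0 (ltr_wpDl D0 ltr01)).
  have h : A / (1 - r) * r ^+ n < e.
    apply: (@le_lt_trans _ _ ((A / (1 - r) + 1) * r ^+ n)).
      by rewrite ler_wpM2r ?exprn_ge0// lerDl.
    by rewrite mulrC -ltr_pdivlMr ?ltr_wpDl.
  exists (u n); exists n => // k /= nk.
  by rewrite /ball/= distrC (le_lt_trans _ h)// -(subnKC nk).
exists (limn u) => n.
apply/ler_addgt0Pr => e e0.
have /cvgrPdist_lt/(_ e e0)[N _ hN] := cu.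
have := hN (n + N)%N (leq_addl _ _) => h.
rewrite distrC -(subrKA (u (n + N)%N)) (le_trans (ler_normD _ _))// addrC.
by apply: lerD (uB n N) (ltW h).
Qed.

Section backward_composition.
Variable R : realType.
Local Notation C := R[i].
Variable T : nat -> C -> C.

(* T_j \o ... \o T_(j+k-1) *)
Fixpoint backcomp k j z : C :=
  if k is k'.+1 then T j (backcomp k' j.+1 z) else z.

Lemma backcompSr k j z : backcomp k.+1 j z = backcomp k j (T (j + k) z).
Proof.
elim: k j => [|k IHk] j; first by rewrite addn0.
by rewrite [LHS]/= -[T j.+1 _]/(backcomp k.+1 j.+1 z) IHk addSnnS.
Qed.

Hypothesis T1 : forall j z, normc z < 1 -> normc (T j z) < 1.

Lemma backcomp_lt1 k j z : normc z < 1 -> normc (backcomp k j z) < 1.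
Proof. by move=> z1; elim: k j => [//|k IHk] j /=; exact: T1. Qed.

Variables (kappa g c : nat -> R).
Hypothesis kappa0 : forall j, 0 < kappa j.
Hypothesis kappa1 : forall j, kappa j <= 1.
Hypothesis g0 : forall j, 0 < g j.
(* The region [defect >= kappa j] is invariant, and g bounds from below the
   expansion of the defect outside of it. *)
Hypothesis Tdefect : forall j z s, normc z < 1 -> 0 <= s ->
  Order.min (kappa j.+1) s <= defect z ->
  Order.min (kappa j) (g j * s) <= defect (T j z).
Hypothesis c1 : forall j, c j <= 1.
Hypothesis Tcontract : forall j z z', normc z < 1 -> normc z' < 1 ->
  kappa j.+1 <= defect z -> kappa j.+1 <= defect z' ->
  sqr_ph (T j z) (T j z') <= (1 - c j) * sqr_ph z z'.

Lemma backcomp_defect k j z s : normc z < 1 -> 0 <= s ->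
  Order.min (kappa (j + k)%N) s <= defect z ->
  Order.min (kappa j) (s * \prod_(i < k) g (j + i)%N) <= defect (backcomp k j z).
Proof.
move=> z1 s0; elim: k j => [|k IHk] j; first by rewrite addn0 big_ord0 mulr1.
rewrite -addSnnS => /IHk h; rewrite big_ord_recl/= addn0 mulrCA.
have -> : \prod_(i < k) g (j + lift ord0 i)%N = \prod_(i < k) g (j.+1 + i)%N.
  by apply: eq_bigr => i _; rewrite /= /bump/= add1n addSnnS.
apply: Tdefect => //; first exact: backcomp_lt1.
by rewrite mulr_ge0// prodr_ge0// => i _; exact: ltW.
Qed.

(** Indices increase into the past: of the p + q maps, the q of largest index act first. Only the p
    maps applied last are asked to act in the region of contraction; for the others the bound 1 on
    the squared distance suffices. *)
Lemma backcomp_contract p q j z z' : normc z < 1 -> normc z' < 1 ->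
  (forall i k, (i < p)%N -> (i + k).+1 = (p + q)%N ->
     kappa (j + i).+1 <= defect (backcomp k (j + i).+1 z) /\
     kappa (j + i).+1 <= defect (backcomp k (j + i).+1 z')) ->
  sqr_ph (backcomp (p + q) j z) (backcomp (p + q) j z') <=
  \prod_(i < p) (1 - c (j + i)%N).
Proof.
move=> z1 z1'; elim: p j => [|p IHp] j h.
  by rewrite big_ord0 ltW// sqr_ph_lt1//; exact: backcomp_lt1.
rewrite addSn big_ord_recl/= addn0.
have [h1 h2] := h 0%N (p + q)%N isT erefl.
rewrite addn0 in h1 h2.
apply: le_trans (Tcontract (backcomp_lt1 _ _ z1) (backcomp_lt1 _ _ z1') h1 h2) _.
rewrite ler_wpM2l ?subr_ge0//.
have -> : \prod_(i < p) (1 - c (j + lift ord0 i)%N) =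
    \prod_(i < p) (1 - c (j.+1 + i)%N).
  by apply: eq_bigr => i _; rewrite /= /bump/= add1n addSnnS.
apply: IHp => i k ip E; rewrite addSnnS.
by apply: h; rewrite ?ltnS// addSn E addSn.
Qed.

Variables (gam al C1 be C2 : R).
Hypothesis gam0 : 0 < gam.
Hypothesis al0 : 0 < al.
Hypothesis be0 : 0 < be.
Hypothesis g_le : forall j, g j <= expR gam.
Hypothesis g_prod : forall n, expR (al * n%:R - C1) <= \prod_(i < n) g i.
Hypothesis c_sum : forall n, be * n%:R - C2 <= \sum_(i < n) c i.

Let prod_one_sub_le n : \prod_(i < n) (1 - c i) <= expR (C2 - be * n%:R).
Proof.
apply: (@le_trans _ _ (expR (- \sum_(i < n) c i))); last first.
  by rewrite ler_expR; have := c_sum n; lra.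
elim: n => [|n IHn]; first by rewrite !big_ord0 oppr0 expR0.
rewrite !big_ord_recr/= opprD expRD ler_pM//.
- by rewrite prodr_ge0// => i _; rewrite subr_ge0.
- by rewrite subr_ge0.
- exact: expR_ge1Dx.
Qed.

Let prod_g_split n i k : (i + k)%N = n ->
  \prod_(l < n) g l = \prod_(l < i) g l * \prod_(l < k) g (i + l)%N.
Proof. by move=> <-; rewrite big_split_ord. Qed.

Let prod_g_le n : \prod_(i < n) g i <= expR (gam * n%:R).
Proof.
elim: n => [|n IHn]; first by rewrite big_ord0 mulr0 expR0.
rewrite big_ord_recr/= -natr1 mulrDr mulr1 expRD ler_pM//.
  by rewrite prodr_ge0// => i _; exact: ltW.
exact: ltW.
Qed.

Lemma backcomp_uniform_contraction :
  exists a r A : R, exists n1 : nat,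
  [/\ 0 < a, a < 1, 0 < r, r < 1 & 0 <= A] /\
  (forall n z, normc z < 1 -> Order.min (kappa n) (a ^+ n) <= defect z ->
    (n1 <= n)%N -> kappa 0 <= defect (backcomp n 0 z)) /\
  (forall n z z', normc z < 1 -> normc z' < 1 ->
    Order.min (kappa n) (a ^+ n) <= defect z ->
    Order.min (kappa n) (a ^+ n) <= defect z' ->
    sqr_ph (backcomp n 0 z) (backcomp n 0 z') <= A * r ^+ n).
Proof.
(* The n/q maps applied last expand the defect by at most exp (al n / 4), and C1 <= al n / 4 for n
   >= n1. A point of defect a^n = exp (- al n / 2) has therefore reached the invariant region before
   them: the total growth exp (al n - C1) exceeds all three losses together. *)
have [q' q'E] := exists_nat_gt (4 * gam / al).
pose q := q'.+1.
have q0 : 0 < q%:R :> R by rewrite ltr0n.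
have qE : gam / q%:R <= al / 4.
  have : 4 * gam / al <= q%:R by rewrite (le_trans (ltW q'E))// ler_nat.
  by rewrite !ler_pdivrMr// => h; lra.
have [n1 n1E] := exists_nat_gt (4 * C1 / al).
pose a := expR (- (al / 2)); pose r := expR (- (be / q%:R)).
(* In the first summand be pays for rounding n/q to an integer; the second makes [A * r ^+ n] at
   least 1 for n below n1. *)
pose A := expR (C2 + be) + expR (be * n1%:R / q%:R).
have a0 : 0 < a by exact: expR_gt0.
have a1 : a < 1 by rewrite -expR0 ltr_expR oppr_lt0 divr_gt0.
have r0 : 0 < r by exact: expR_gt0.
have r1 : r < 1 by rewrite -expR0 ltr_expR oppr_lt0 divr_gt0.
have aX n : a ^+ n = expR (- (al / 2) * n%:R).
  by rewrite /a -expRM_natl mulrC.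
have rX n : r ^+ n = expR (- (be / q%:R) * n%:R).
  by rewrite /r -expRM_natl mulrC.
(* The defect a^n is expanded to 1 before the last n/q steps. *)
have key n z i k : normc z < 1 -> Order.min (kappa n) (a ^+ n) <= defect z ->
    (n1 <= n)%N -> (i + k)%N = n -> (i * q <= n)%N ->
    kappa i <= defect (backcomp k i z).
  move=> z1 hz n1n ik iq.
  have := @backcomp_defect k i z (a ^+ n) z1 (ltW (exprn_gt0 _ a0)).
  rewrite ik => /(_ hz); rewrite ge_min => /orP[//|].
  apply: le_trans; apply: (le_trans (kappa1 i)).
  have G := g_prod n; rewrite (prod_g_split ik) in G.
  have Gi := prod_g_le i.
  have P0 : 0 <= \prod_(l < k) g (i + l)%N by rewrite prodr_ge0// => l _; exact: ltW.
  have : expR (al * n%:R - C1) <= expR (gam * i%:R) * \prod_(l < k) g (i + l)%N.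
    by apply: (le_trans G); rewrite ler_wpM2r.
  rewrite [leRHS]mulrC -ler_pdivrMr ?expR_gt0// -expRN -expRD => h.
  rewrite aX; apply: le_trans (ler_wpM2l (expR_ge0 _) h); rewrite -expRD.
  rewrite -{1}expR0 ler_expR.
  have nC : C1 <= al / 4 * n%:R.
    have : 4 * C1 / al <= n%:R by rewrite (le_trans (ltW n1E))// ler_nat.
    by rewrite ler_pdivrMr//; lra.
  have iG : gam * i%:R <= al / 4 * n%:R.
    apply: (@le_trans _ _ (gam / q%:R * n%:R)); last by rewrite ler_wpM2r.
    rewrite -mulrA ler_pM2l// ler_pdivlMl// mulrC -natrM ler_nat//.
  lra.
exists a, r, A, n1; split; first by split => //; rewrite addr_ge0 ?expR_ge0.
split.
  by move=> n z z1 hz n1n; apply: (key n z 0%N n).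
move=> n z z' z1 z1' hz hz'.
have [n1n|nn1] := leqP n1 n; last first.
  apply: (@le_trans _ _ 1).
    by rewrite ltW// sqr_ph_lt1//; exact: backcomp_lt1.
  rewrite mulrDl; apply: ler_wpDl; first by rewrite mulr_ge0 ?expR_ge0 ?exprn_ge0 ?ltW.
  rewrite rX -expRD -[leLHS]expR0 ler_expR.
  rewrite (_ : _ + _ = be / q%:R * (n1%:R - n%:R)); last by ring.
  by rewrite mulr_ge0 ?subr_ge0 ?ler_nat ?(ltnW nn1)// divr_ge0// ltW.
have pn : (n %/ q <= n)%N by exact: leq_div.
have := @backcomp_contract (n %/ q) (n - n %/ q) 0 z z' z1 z1'.
rewrite subnKC// => h; apply: (le_trans (h _)).
  move=> i k ip ik; rewrite add0n.
  have iq : (i.+1 * q <= n)%N by rewrite (leq_trans _ (leq_divM n q))// leq_mul.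
  by split; apply: (key n) => //; rewrite addSn.
have -> : \prod_(i < n %/ q) (1 - c (0 + i)%N) = \prod_(i < n %/ q) (1 - c i) by [].
apply: (le_trans (prod_one_sub_le _)).
rewrite mulrDl; apply: ler_wpDr; first by rewrite mulr_ge0 ?expR_ge0 ?exprn_ge0 ?ltW.
rewrite rX -expRD ler_expR.
have : n%:R / q%:R <= (n %/ q)%:R + 1 :> R.
  by rewrite ler_pdivrMr// natr1 -natrM ler_nat ltnW// ltn_ceil.
move=> /(ler_wpM2l (ltW be0)); rewrite mulrDr mulr1 mulrA mulNr mulrAC; lra.
Qed.

(** The iterates u_n and u_(n+1) of 0 are the images of 0 and [T n 0] under the same composition, so
    the uniform contraction makes the sequence Cauchy. The rate is the square root of the previous
    one, since [sqr_ph] is a squared distance. *)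
Theorem backcomp_limit :
  exists (x : C) (a r A : R) (n1 : nat),
  [/\ normc x < 1, kappa 0 <= defect x, 0 < a, a < 1 & 0 < r] /\
  [/\ r < 1, 0 <= A,
    (forall n z, normc z < 1 -> a ^+ n <= defect z -> (n1 <= n)%N ->
      kappa 0 <= defect (backcomp n 0 z)) &
    (forall n z, normc z < 1 -> a ^+ n <= defect z ->
      normc (backcomp n 0 z - x) <= A * r ^+ n)].
Proof.
have [a [r [A [n1 [[a0 a1 r0 r1 A0] [hD hY]]]]]] := backcomp_uniform_contraction.
pose s := Num.sqrt r.
have s0 : 0 < s by rewrite sqrtr_gt0.
have s1 : s < 1 by rewrite -sqrtr1 ltr_sqrt.
have Z0 : normc (0 : C) < 1 by rewrite normc0.
have D0 : defect (0 : C) = 1 by rewrite /defect normc0 expr0n subr0.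
have h0 n : Order.min (kappa n) (a ^+ n) <= defect 0.
  by rewrite D0 ge_min kappa1.
have hT n : Order.min (kappa n) (a ^+ n) <= defect (T n 0).
  rewrite ge_min; apply/orP; left.
  (* This s makes both terms of the minimum in the conclusion equal to [kappa n]. *)
  have := @Tdefect n 0 (kappa n / g n) Z0 (ltW (divr_gt0 (kappa0 _) (g0 _))).
  rewrite D0 ge_min kappa1 => /(_ isT).
  by rewrite mulrC divfK ?gt_eqF// minxx.
have step n z z' : normc z < 1 -> normc z' < 1 ->
    Order.min (kappa n) (a ^+ n) <= defect z ->
    Order.min (kappa n) (a ^+ n) <= defect z' ->
    normc (backcomp n 0 z - backcomp n 0 z') <= 2 * Num.sqrt A * s ^+ n.
  move=> z1 z1' hz hz'.
  have h := sqr_normc_sub_le_ph (backcomp_lt1 n 0 z1) (backcomp_lt1 n 0 z1').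
  rewrite -(@ler_pXn2r _ 2) ?nnegrE ?normc_ge0//; last first.
    by rewrite !mulr_ge0 ?sqrtr_ge0 ?exprn_ge0 ?(ltW s0).
  apply: (le_trans h); rewrite !exprMn sqr_sqrtr// -exprM mulnC exprM.
  rewrite sqr_sqrtr ?(ltW r0)// -mulrA (_ : 2 ^+ 2 = 4); last by ring.
  by rewrite ler_pM2l// hY.
pose u n := backcomp n 0 0.
have us n : normc (u n.+1 - u n) <= 2 * Num.sqrt A * s ^+ n.
  by rewrite /u backcompSr add0n; apply: step => //; exact: T1.
have [lr hr] : exists l : R, forall n,
    `|complex.Re (u n) - l| <= 2 * Num.sqrt A / (1 - s) * s ^+ n.
  apply: geometric_cvg => //; first exact: ltW.
  by move=> n; rewrite -ReB; apply: le_trans (normr_Re_le _) _.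
have [li hi] : exists l : R, forall n,
    `|complex.Im (u n) - l| <= 2 * Num.sqrt A / (1 - s) * s ^+ n.
  apply: geometric_cvg => //; first exact: ltW.
  move=> n; rewrite -(raddfB (@complex.Im R : Rcomplex R -> R)).
  by apply: le_trans (normr_Im_le _) _.
pose x : C := (lr +i* li)%C.
have ux n : normc (u n - x) <= 2 * (2 * Num.sqrt A / (1 - s)) * s ^+ n.
  apply: (le_trans (normc_le_ReIm _)).
  move: (hr n) (hi n); rewrite /x; case: (u n) => p q /= h1 h2.
  by rewrite -mulrA mulr2n mulrDl !mul1r lerD.
have xk : kappa 0 <= defect x.
  rewrite /defect lerBrDr -lerBrDl.
  have k0 : 0 <= 1 - kappa 0 by rewrite subr_ge0.
  suff xs : normc x <= Num.sqrt (1 - kappa 0).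
    by rewrite -(sqr_sqrtr k0) lerXn2r ?nnegrE ?sqrtr_ge0 ?normc_ge0.
  apply/ler_addgt0Pr => e e0.
  set M := 2 * (2 * Num.sqrt A / (1 - s)) in ux.
  have M0 : 0 <= M by rewrite !mulr_ge0 ?sqrtr_ge0 ?invr_ge0 ?subr_ge0 ?ltW.
  have [n sn] := @geometric_lt R s (e / (M + 1)) (ltW s0) s1
    (divr_gt0 e0 (ltr_wpDl M0 ltr01)).
  have Mn : M * s ^+ (n1 + n) <= e.
    apply: (@le_trans _ _ ((M + 1) * s ^+ n)).
      apply: ler_pM => //; rewrite ?exprn_ge0 ?(ltW s0)// ?lerDl//.
      by rewrite exprD ler_piMl ?exprn_ge0 ?exprn_ile1 ?(ltW s0) ?(ltW s1).
    by rewrite mulrC -ler_pdivlMr ?ltr_wpDl// ltW.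
  have ku := hD (n1 + n)%N 0 Z0 (h0 _) (leq_addr _ _).
  rewrite -[x](subrK (u (n1 + n)%N)); apply: (le_trans (normcD_le _ _)).
  rewrite addrC; apply: lerD; last by rewrite normc_subC (le_trans (ux _)).
  rewrite -(@ler_pXn2r _ 2) ?nnegrE ?normc_ge0 ?sqrtr_ge0// sqr_sqrtr//.
  by move: ku; rewrite /defect -/(u _); lra.
exists x, a, s, (2 * Num.sqrt A + 2 * (2 * Num.sqrt A / (1 - s))), n1.
split; first by split => //; rewrite -defect_gt0 (lt_le_trans _ xk).
split => //.
- by rewrite addr_ge0 ?mulr_ge0 ?sqrtr_ge0 ?invr_ge0 ?subr_ge0 ?ltW.
- by move=> n z z1 hz; apply: hD => //; rewrite ge_min hz orbT.
- move=> n z z1 hz; rewrite -(subrKA (u n)) mulrDl.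
  apply: (le_trans (normcD_le _ _)); apply: lerD (ux n).
  by apply: step => //; rewrite ge_min hz orbT.
Qed.

End backward_composition.

(** * Truncation of functions of positive, possibly infinite, integral *)

Section truncation.
Context d (T : measurableType d) (R : realType) (P : probability T R).

Lemma integrable_min_nat (f Q : T -> R) (M : nat) :
  measurable_fun [set: T] f -> P.-integrable [set: T] (EFin \o Q) ->
  (forall w, - Q w <= f w) ->
  P.-integrable [set: T] (EFin \o (fun w => Order.min (f w) M%:R)).
Proof.
move=> mf iQ Qf.
apply: (@le_integrable _ _ _ P setT measurableT _
  (fun w => `|Q w|%:E + (cst M%:R w)%:E)%E).
- by apply/measurable_EFinP; apply: measurable_minr.
- move=> w _ /=; rewrite lee_fin [leRHS]ger0_norm ?addr_ge0//.
  have := Qf w; have := ler_norm (Q w); have := normr_ge0 (Q w).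
  have M0 : 0 <= M%:R :> R by [].
  by rewrite ler_norml /Order.min; case: ifP => [?|/negbT]; rewrite -?leNgt; move: M0; lra.
- apply: integrableD => //; first exact: integrable_norm.
  exact: finite_measure_integrable_cst.
Qed.

(* The integral of f may be infinite: f is only assumed to be bounded below by
   an integrable function. *)
Lemma positive_truncation (f Q : T -> R) :
  measurable_fun [set: T] f -> P.-integrable [set: T] (EFin \o Q) ->
  (forall w, 0 <= Q w) -> (forall w, - Q w <= f w) ->
  (0 < \int[P]_w (f w)%:E)%E ->
  exists M : nat, 0 < \int[P]_w Order.min (f w) M%:R.
Proof.
move=> mf iQ Q0 Qf f0.
have mQ : measurable_fun setT Q by apply/measurable_EFinP; exact: measurable_int iQ.
apply: contrapT => nM.
have le0 M : \int[P]_w Order.min (f w) M%:R <= 0.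
  by rewrite leNgt; apply/negP => h; apply: nM; exists M.
have iM M := integrable_min_nat M mf iQ Qf.
(* Adding Q makes the truncations nonnegative, so monotone convergence applies: if all of them had
   nonpositive integral, so would f. *)
pose h M w := (Order.min (f w) M%:R + Q w)%:E.
have h0 M w : (0 <= h M w)%E.
  rewrite lee_fin -lerBlDr sub0r le_min Qf/=.
  by rewrite (le_trans _ (ler0n _ _))// oppr_le0.
have mh M : measurable_fun setT (h M).
  by apply/measurable_EFinP; apply: measurable_funD => //; exact: measurable_minr.
have hnd w : nondecreasing_seq (h ^~ w).
  move=> m n mn; rewrite lee_fin lerD2r le_min ge_min lexx/=.
  by rewrite ge_min ler_nat mn orbT.
have hcv w : h n w @[n --> \oo] --> (f w + Q w)%:E.
  apply: cvg_near_cst.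
  have [k fk] := exists_nat_gt (f w); exists k => // n /= kn.
  rewrite /h min_l// (le_trans (ltW fk))// ler_nat//.
have hle M : (\int[P]_w h M w <= \int[P]_w (Q w)%:E)%E.
  rewrite (_ : h M = ((EFin \o (fun w => Order.min (f w) M%:R)) \+ (EFin \o Q))%E)//.
  rewrite integralD//= -[leRHS]add0e leeD2r//.
  have := le0 M; rewrite -lee_fin /Rintegral fineK//.
  exact: (integrable_fin_num measurableT (iM M)).
have intfQ : (\int[P]_w (f w + Q w)%:E <= \int[P]_w (Q w)%:E)%E.
  have cv : (\int[P]_w h n w)%E @[n --> \oo] --> (\int[P]_w (f w + Q w)%:E)%E.
    have -> : (\int[P]_w (f w + Q w)%:E = \int[P]_w (limn (h ^~ w)))%E.
      apply: eq_integral => w _; apply/esym/cvg_lim => //; exact: hcv.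
    exact: (cvg_monotone_convergence measurableT mh (fun n w _ => h0 n w)
      (fun w _ => hnd w)).
  rewrite -(cvg_lim (@ereal_hausdorff _) cv); apply: lime_le.
    by apply/cvg_ex; eexists; exact: cv.
  by apply: nearW => n; exact: hle.
have mEf : measurable_fun setT (EFin \o f) by exact/measurable_EFinP.
have fn_le : (\int[P]_w (EFin \o f)^\- w <= \int[P]_w (Q w)%:E)%E.
  apply: ge0_le_integral => //.
  - exact: measurable_funeneg.
  - exact/measurable_EFinP.
  - move=> w _; rewrite funenegE/= ge_max !lee_fin Q0 andbT.
    by rewrite lerNl.
have IQ := integrable_fin_num measurableT iQ.
have fn_fin : (\int[P]_w (EFin \o f)^\- w)%E \is a fin_num.
  rewrite ge0_fin_numE; last by apply: integral_ge0.
  by apply: le_lt_trans fn_le _; rewrite -ge0_fin_numE//; apply: integral_ge0 => w _; rewrite lee_fin.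
(* Integrating (f + Q) + f^- = f^+ + Q, all of whose terms are nonnegative, avoids a difference of
   infinite integrals. *)
have E : (\int[P]_w (f w + Q w)%:E + \int[P]_w (EFin \o f)^\- w =
    \int[P]_w (EFin \o f)^\+ w + \int[P]_w (Q w)%:E)%E.
  rewrite -!ge0_integralD//.
  - apply: eq_integral => w _; rewrite funeposE funenegE/= -!EFin_max.
    rewrite -!EFinD; congr EFin.
    by rewrite /Order.max; do 2 case: ifP; lra.
  - exact: measurable_funepos.
  - by move=> w _; rewrite lee_fin.
  - exact/measurable_EFinP.
  - by move=> w _; rewrite lee_fin -lerBlDr sub0r.
  - by apply/measurable_EFinP; exact: measurable_funD.
  - exact: measurable_funeneg.
move: f0; rewrite [in X in X -> _]integralE; move: E intfQ fn_fin.
rewrite -[(fun w => (f w)%:E)]/(EFin \o f).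
move: IQ.
move: (\int[P]_w (f w + Q w)%:E)%E (\int[P]_w (Q w)%:E)%E.
move: (\int[P]_w (EFin \o f)^\+ w)%E (\int[P]_w (EFin \o f)^\- w)%E.
move=> p n a q; case: n q p a => [n| |] [q| |] [p| |] [a| |]//= _; rewrite -?EFinD.
  by move=> [E]; rewrite !lee_fin -?EFinB !lte_fin => h1 _ h2; clear -E h1 h2; lra.
Qed.

End truncation.

(** The series of terms Q (s^n w) r^n has finite integral, hence a finite sum almost everywhere,
    which bounds each term. Integrability thus makes Q subexponential along orbits. *)
Lemma bounded_by_summable d (T : measurableType d) (R : realType)
    (P : probability T R) (s : T -> T) (Q : T -> R) (r : R) :
  measurable_fun [set: T] s ->
  (forall A, measurable A -> P (s @^-1` A) = P A) ->
  P.-integrable [set: T] (EFin \o Q) -> (forall w, 0 <= Q w) ->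
  0 <= r -> r < 1 ->
  {ae P, forall w, exists C : R, forall n, Q (iter n s w) * r ^+ n <= C}.
Proof.
move=> ms sP iQ Q0 r0 r1.
have mQ : measurable_fun setT Q by apply/measurable_EFinP; exact: measurable_int iQ.
have ms_n n : measurable_fun setT (iter n s).
  by elim: n => [|n IHn]; [exact: measurable_id|exact: measurableT_comp].
have sPn n A : measurable A -> P A = P (iter n s @^-1` A).
  move=> mA; elim: n => [//|n IHn].
  rewrite IHn -sP; last by rewrite -[X in measurable X]setTI; exact: ms_n.
  by congr (P _); apply/funext => w; rewrite /preimage/= -iterSr.
pose f n w := (Q (iter n s w) * r ^+ n)%:E.
have mf n : measurable_fun setT (f n).
  apply/measurable_EFinP; apply: measurable_funM; last exact: measurable_cst.
  exact: measurableT_comp.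
have f0 n w : [set: T] w -> (0 <= f n w)%E.
  by move=> _; rewrite lee_fin mulr_ge0// exprn_ge0.
have If n : (\int[P]_w f n w = (r ^+ n * \int[P]_w Q w)%:E)%E.
  under eq_integral do rewrite /f mulrC EFinM.
  rewrite ge0_integralZl//; last 3 first.
  - by apply/measurable_EFinP; exact: measurableT_comp.
  - by move=> w _; rewrite lee_fin.
  - by rewrite lee_fin exprn_ge0.
  rewrite -(integral_transport (ms_n n) (sPn n) (f := EFin \o Q))//=.
    by rewrite EFinM /Rintegral fineK//; exact: integrable_fin_num.
  exact/measurable_EFinP.
have S := integral_nneseries P measurableT mf f0.
have fin : (\sum_(n <oo) \int[P]_w f n w < +oo)%E.
  have sumle n : (\sum_(0 <= i < n) \int[P]_w f i w <= ((1 - r)^-1 * \int[P]_w Q w)%:E)%E.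
    under eq_bigr do rewrite If.
    rewrite sumEFin lee_fin -mulr_suml ler_wpM2r//.
      by apply: Rintegral_ge0 => w _.
    rewrite -[leRHS]mul1r ler_pdivlMr ?subr_gt0//.
    rewrite big_mkord mulrC -opprB mulNr -subrX1 opprB gerBl.
    exact: exprn_ge0.
  apply: (@le_lt_trans _ _ ((1 - r)^-1 * \int[P]_w Q w)%:E); last exact: ltry.
  apply: lime_le; last by apply: nearW => n; exact: sumle.
  by apply: is_cvg_nneseries => n _ _; apply: integral_ge0 => w; exact: f0.
have iS : P.-integrable setT (fun w => \sum_(n <oo) f n w)%E.
  apply/integrableP; split.
    apply: ge0_emeasurable_sum => //; first by move=> n w _ _; exact: f0.
  under eq_integral.
    move=> w _; rewrite gee0_abs; last by apply: nneseries_ge0 => n _ _; exact: f0.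
    over.
  by rewrite S.
have := integrable_ae measurableT iS; apply: filterS => w /(_ I) fw.
exists (fine (\sum_(n <oo) f n w)%E) => n.
rewrite -lee_fin fineK// -/(f n w).
apply: (@le_trans _ _ (\sum_(0 <= i < n.+1) f i w)%E).
  by rewrite big_nat_recr//= leeDr// sume_ge0// => i _; exact: f0.
by apply: nneseries_lim_ge => i _ _; exact: f0.
Qed.

(** * The random attracting point *)

Section random_limit.
Context d (Omega : measurableType d) (R : realType) (P : probability Omega R).
Variables (sigma sigmaV : Omega -> Omega) (B : blaschke_cocycle Omega R).
Hypothesis hsigma : invertible_mpt P sigma sigmaV.
Hypothesis herg : ergodic P sigma.
Hypothesis hadm : admissible B P.
Local Notation C := R[i].

Lemma measurable_sigma : measurable_fun [set: Omega] sigma.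
Proof. by have [] := hsigma. Qed.

Lemma measurable_sigmaV : measurable_fun [set: Omega] sigmaV.
Proof. by have [] := hsigma. Qed.

Lemma sigma_mpt A : measurable A -> P (sigma @^-1` A) = P A.
Proof. by have [] := hsigma => _ _ _ _; apply. Qed.

Lemma preimage_sigmaK A : sigma @^-1` (sigmaV @^-1` A) = A.
Proof.
by have [K _ _ _ _] := hsigma; apply/seteqP; split=> w /=; rewrite K.
Qed.

Lemma sigmaV_mpt A : measurable A -> P (sigmaV @^-1` A) = P A.
Proof.
move=> mA; rewrite -[in RHS](preimage_sigmaK A) sigma_mpt//.
by rewrite -[X in measurable X]setTI; exact: measurable_sigmaV.
Qed.

Lemma sigmaV_ergodic : ergodic P sigmaV.
Proof. by move=> A mA sA; apply: herg => //; rewrite -{1}sA preimage_sigmaK. Qed.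

Lemma cocycle_backward (Y : Type) (F : Omega -> Y -> Y) n w y :
  cocycle sigma F n.+1 (iter n.+1 sigmaV w) y =
  F (sigmaV w) (cocycle sigma F n (iter n sigmaV (sigmaV w)) y).
Proof.
rewrite [iter n.+1 _ _]iterSr /=; congr (F _ _).
have [_ K _ _ _] := hsigma.
by elim: n (sigmaV w) => [//|n IHn] w'; rewrite [iter n.+1 sigma _]iterSr /= K IHn.
Qed.

(** Index i of the deterministic sequence of maps stands for the fiber i + 1 steps in the past, so
    that a composition from index 0 ends at w. *)
Lemma backcomp_cocycle n j w z :
  backcomp (fun i => bmap B (iter i.+1 sigmaV w)) n j z =
  cocycle sigma (bmap B) n (iter n sigmaV (iter j sigmaV w)) z.
Proof.
elim: n j => [//|n IHn] j.
by rewrite cocycle_backward /= IHn.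
Qed.

Let mr : measurable_fun [set: Omega] (inf_speed B).
Proof.
have [/measurable_fun_pairP[]] := hadm; by [].
Qed.

Let mdeg : measurable_fun [set: Omega] (fun w => (bdeg B w)%:R : R).
Proof.
apply: (measurableT_comp (f := fun n : nat => n%:R : R)) => //.
exact: bdeg_measurable.
Qed.

Let mQ : measurable_fun [set: Omega] (distortion B).
Proof. by apply: measurable_funM => //; exact: measurable_funV. Qed.

Let Q0 w : 0 < distortion B w.
Proof. by apply: lt_le_trans (distortion_ge1 B w). Qed.

Let iQ : P.-integrable [set: Omega] (EFin \o distortion B).
Proof.
apply/integrableP; split; first exact/measurable_EFinP.
have [_ _ h _] := hadm; apply: le_lt_trans h.
by rewrite le_eqVlt; apply/orP; left; apply/eqP; apply: eq_integral => w _;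
  rewrite gee0_abs ?lee_fin ?(ltW (Q0 w)).
Qed.

(** As ln (1/r) < 1/r, the integrable [distortion] dominates the negative part of the logarithm. The
    positive part may have infinite integral, which is why it is truncated below. *)
Let ln_speed_ge w : - distortion B w <= ln (inf_speed B w).
Proof.
have r0 := inf_speed_gt0 B w.
have := @ln_sublinear R (inf_speed B w)^-1; rewrite invr_gt0 lnV ?posrE//.
move=> /(_ r0); rewrite lerNl => h; apply: (le_trans (ltW h)).
by rewrite /distortion ler_peMl ?invr_ge0 ?(ltW r0)// ler1n bdeg_gt0.
Qed.

Let mln : measurable_fun [set: Omega] (fun w => ln (inf_speed B w)).
Proof. by apply: measurableT_comp => //; exact: measurable_ln. Qed.

Let trunc : exists M : nat,
  0 < \int[P]_w Order.min (ln (inf_speed B w)) M%:R.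
Proof.
have [_ h _ _] := hadm.
exact: (positive_truncation mln iQ (fun w => ltW (Q0 w)) ln_speed_ge h).
Qed.

(* The lower bound for the logarithmic expansion of the defect close to the
   circle. *)
Definition log_expansion (M : nat) (eta : R) (N : nat) w : R :=
  if w \in zeros_inside B N then Order.min (ln (inf_speed B w)) M%:R - eta
  else - ln (4 * distortion B w).

Let measurable_log_expansion M eta N :
  measurable_fun [set: Omega] (log_expansion M eta N).
Proof.
apply: measurable_fun_ifT.
- apply: (measurable_fun_bool true) => /=.
  rewrite setTI (_ : _ @^-1` _ = zeros_inside B N).
    exact: measurable_zeros_inside.
  by apply/seteqP; split=> w /= => [/set_mem|/mem_set].
- by apply: measurable_funB => //; exact: measurable_minr.
- apply: measurable_funN; apply: measurableT_comp; first exact: measurable_ln.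
  exact: measurable_funM.
Qed.

Let log_expansion_bound M eta N w : 0 <= eta ->
  `|log_expansion M eta N w| <= M%:R + eta + 4 * distortion B w.
Proof.
move=> e0; have Q1 := Q0 w; have M0 : 0 <= M%:R :> R by [].
rewrite /log_expansion; case: ifP => _.
  have := ln_speed_ge w; rewrite ler_norml.
  by rewrite /Order.min; case: ifP => [?|/negbT]; rewrite -?leNgt; lra.
have h4 : 1 <= 4 * distortion B w by have := distortion_ge1 B w; lra.
rewrite normrN ger0_norm ?ln_ge0//.
have := @ln_sublinear R (4 * distortion B w); rewrite mulr_gt0// => /(_ isT).
lra.
Qed.

Let integrable_log_expansion M eta N : 0 <= eta ->
  P.-integrable [set: Omega] (EFin \o log_expansion M eta N).
Proof.
move=> e0; apply: (@le_integrable _ _ _ P setT measurableT _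
  ((EFin \o cst (M%:R + eta)%R) \+ (fun w => 4%:E * (EFin \o distortion B) w))%E).
- exact/measurable_EFinP.
- move=> w _ /=; rewrite lee_fin; apply: (le_trans (log_expansion_bound _ _ _ e0)).
  exact: ler_norm.
- apply: integrableD => //; first exact: finite_measure_integrable_cst.
  exact: integrableZl.
Qed.

(** As N grows every fiber ends up in [zeros_inside B N]; by dominated convergence the integrals
    tend to that of the truncated logarithm minus eta, which is half of a positive number. *)
Lemma positive_expansion : exists (M : nat) (eta : R) (N : nat),
  [/\ 0 < eta, (0 < M)%N & 0 < \int[P]_w log_expansion M eta N w].
Proof.
(* The successor makes M positive: it later bounds the logarithmic growth of the defect per step. *)
have [M' hM'] := trunc; pose M := M'.+1.
pose I M := \int[P]_w Order.min (ln (inf_speed B w)) M%:R.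
have iM k := integrable_min_nat k mln iQ ln_speed_ge.
have IM : 0 < I M.
  apply: lt_le_trans hM' _; apply: le_Rintegral => //.
  by move=> w _; rewrite le_min ge_min lexx/= ge_min ler_nat leqnSn orbT.
pose eta := I M / 2.
have e0 : 0 < eta by rewrite divr_gt0.
have cv : \int[P]_w log_expansion M eta N w @[N --> \oo] -->
    \int[P]_w (Order.min (ln (inf_speed B w)) M%:R - eta).
  have [ig _ cv] : [/\ P.-integrable setT
      (EFin \o (fun w => Order.min (ln (inf_speed B w)) M%:R - eta)),
    ([sequence \int[P]_w `|(EFin \o log_expansion M eta n) w -
      (EFin \o (fun w => Order.min (ln (inf_speed B w)) M%:R - eta)%R) w|]_n
      @ \oo --> 0)%E &
    ([sequence \int[P]_w (EFin \o log_expansion M eta n) w]_n @ \oo -->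
      \int[P]_w (EFin \o (fun w => Order.min (ln (inf_speed B w)) M%:R - eta)%R) w)%E].
    apply: (@dominated_convergence _ _ _ P setT measurableT
      (fun n => EFin \o log_expansion M eta n) _
      ((EFin \o cst (M%:R + eta)%R) \+ (fun w => 4%:E * (EFin \o distortion B) w))%E).
    - by move=> n; exact/measurable_EFinP.
    - by apply/measurable_EFinP; apply: measurable_funB => //; exact: measurable_minr.
    - apply: aeW => w _; apply: cvg_near_cst.
      have [N hN] := zeros_inside_cover B w.
      by exists N => // n /= Nn; rewrite /log_expansion mem_set//; exact: hN.
    - apply: integrableD => //; first exact: finite_measure_integrable_cst.
      exact: integrableZl.
    - by apply: aeW => w n _ /=; rewrite lee_fin; exact: log_expansion_bound (ltW e0).
  by apply: fine_cvg; rewrite fineK//; exact: integrable_fin_num.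
rewrite RintegralB// in cv; last exact: finite_measure_integrable_cst.
rewrite Rintegral_cst// [X in fine X](_ : _ = 1%E) in cv; last exact: probability_setT.
rewrite mulr1 -/(I M) in cv.
have pos : 0 < I M - eta by rewrite /eta; lra.
have /cvgrPdist_lt/(_ _ pos)[N _ /(_ N (leqnn _)) h] := cv.
exists M, eta, N; split => //.
by move: h; rewrite ltr_norml; set J := \int[P]_w _ => /andP[_]; lra.
Qed.

(** In degree 1, [distortion_ge1] says that [inf_speed] is at most 1, so the logarithm is
    nonpositive there, against its positive integral. *)
Lemma not_ae_moebius : P [set w | (1 < bdeg B w)%N] != 0%E.
Proof.
apply/eqP => P0.
have mD : measurable [set w | (1 < bdeg B w)%N].
  rewrite -[X in measurable X]setTI.
  by apply: (@measurable_bdeg_lt _ _ _ B 1 measurableT [set true]).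
have [_ h _ _] := hadm.
have : (\int[P]_w (ln (inf_speed B w))%:E <= \int[P]_w cst 0 w)%E.
  rewrite integralE.
  have -> : (\int[P]_w (fun x => (ln (inf_speed B x))%:E)^\+ w = \int[P]_w cst 0 w)%E.
    apply: ge0_ae_eq_integral => //.
    - by apply: measurable_funepos; exact/measurable_EFinP.
    - exists [set w | (1 < bdeg B w)%N]; split => // w /= nw.
      rewrite ltnNge; apply/negP => deg1; apply: nw => _.
      rewrite funeposE/= max_r// lee_fin ln_le0//.
      have := distortion_ge1 B w; rewrite /distortion ler_pdivlMr ?inf_speed_gt0//.
      by rewrite mul1r => /le_trans; apply; rewrite lern1.
  rewrite [X in (X - _)%E]integral0 integral0 sub0e oppe_le0.
  by apply: integral_ge0.
by rewrite integral0 leNgt h.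
Qed.

(** * The random invariant region and the contraction inside it *)

Section random_limit_parameters.
Variables (M : nat) (eta : R) (N : nat).
Hypotheses (eta0 : 0 < eta) (M0 : (0 < M)%N).
Hypothesis E0 : 0 < \int[P]_w log_expansion M eta N w.

Let t : R := expR (- eta).
(** The threshold of [boundary_expansion] for zeros at distance 1/(N+1) from the circle. From a
    defect above it, [defect_bmap_ge] guarantees the image at least [floor w]; below it, the defect
    is multiplied by [g w] or the image exceeds [floor w]. *)
Let delta : R := N.+1%:R^-1 * (1 - t) / 4.
Let floor w : R := Order.min ((1 - t) / 2) (delta / (4 * distortion B w)).
Let g w : R := expR (log_expansion M eta N w).

Let t0 : 0 < t. Proof. exact: expR_gt0. Qed.
Let t1 : t < 1. Proof. by rewrite -expR0 ltr_expR oppr_lt0. Qed.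
Let N0 : 0 < N.+1%:R^-1 :> R. Proof. by rewrite invr_gt0 ltr0n. Qed.
Let delta0 : 0 < delta.
Proof.
have s0 : 0 < 1 - t by rewrite subr_gt0; exact: t1.
have := mulr_gt0 N0 s0 => h; exact: divr_gt0 h _.
Qed.
Let floor0 w : 0 < floor w.
Proof.
have s0 : 0 < 1 - t by rewrite subr_gt0; exact: t1.
have q4 : 0 < 4 * distortion B w by rewrite mulr_gt0// Q0.
by rewrite /floor lt_min (divr_gt0 s0 _)// (divr_gt0 delta0 q4).
Qed.
Let g0 w : 0 < g w. Proof. exact: expR_gt0. Qed.

Let defect_step w z : normc z < 1 ->
  Order.min (floor w) (g w * defect z) <= defect (bmap B w z).
Proof.
move=> z1; have D0 : 0 < defect z by rewrite defect_gt0.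
have := defect_bmap_ge B w z1 => hQ.
have Q4 : 0 < 4 * distortion B w by rewrite mulr_gt0.
have hQ2 : defect z / (4 * distortion B w) <= defect (bmap B w z).
  by rewrite ler_pdivrMr// mulrC.
have [Dd|dD] := leP (defect z) delta; last first.
  rewrite ge_min; apply/orP; left; apply: le_trans hQ2.
  rewrite ge_min; apply/orP; right.
  by rewrite ler_pM2r ?invr_gt0// ltW.
rewrite /g /log_expansion; case: ifPn => [|_]; last first.
  rewrite ge_min; apply/orP; right.
  by rewrite expRN lnK ?posrE// mulrC.
rewrite inE => hN.
have N1 : N.+1%:R^-1 <= 1 :> R by rewrite invf_le1 ?ler1n ?ltr0n.
apply: le_trans (boundary_expansion t0 t1 N0 N1 hN z1 Dd).
rewrite le_min !ge_min lexx/=; apply/orP; right.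
rewrite ler_pM2r// expRD -/t mulrC ler_pM2l//.
rewrite -[leRHS](lnK (x := inf_speed B w)) ?posrE ?inf_speed_gt0// ler_expR.
by rewrite ge_min lexx.
Qed.

Let prod_iterSl (G : Omega -> R) k w :
  \prod_(j < k.+1) G (iter j.+1 sigmaV w) =
  G (sigmaV w) * \prod_(j < k) G (iter j.+1 sigmaV (sigmaV w)).
Proof.
rewrite big_ord_recl; congr (_ * _); apply: eq_bigr => i _.
by congr G; exact: iterSr.
Qed.

(** The defect guaranteed at w to an orbit that was reset to the floor k + 1 steps ago and has been
    multiplied by g since then. The infimum [kappa] over k is the largest function with
    [kappa_le_floor] and [kappa_step], the two inequalities that make the region
    [kappa w <= defect z] invariant. *)
Let barrier (w : Omega) (k : nat) : R :=
  floor (iter k.+1 sigmaV w) * \prod_(j < k) g (iter j.+1 sigmaV w).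

Definition kappa w : R := infs (barrier w) 0.

Let barrier_gt0 w k : 0 < barrier w k.
Proof. by rewrite mulr_gt0// prodr_gt0. Qed.

Let kappa_le w k : kappa w <= barrier w k.
Proof.
apply: ge_inf; last by exists k.
by exists 0 => _ [j _ <-]; exact: ltW.
Qed.

Let kappa_ge w c : (forall k, c <= barrier w k) -> c <= kappa w.
Proof.
move=> h; apply: lb_le_inf; first by exists (barrier w 0); exists 0%N.
by move=> _ [j _ <-].
Qed.

Let kappa_ge0 w : 0 <= kappa w.
Proof. by apply: kappa_ge => k; exact: ltW. Qed.

Let kappa_le_floor w : kappa w <= floor (sigmaV w).
Proof.
by apply: le_trans (kappa_le w 0) _; rewrite /barrier big_ord0 mulr1.
Qed.

Let kappa_le1 w : kappa w <= 1.
Proof.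
apply: (le_trans (kappa_le_floor w)); rewrite ge_min; apply/orP; left.
by have := t0; lra.
Qed.

Let kappa_step w : kappa w <= g (sigmaV w) * kappa (sigmaV w).
Proof.
rewrite mulrC -ler_pdivrMr//; apply: kappa_ge => k.
rewrite ler_pdivrMr//; apply: le_trans (kappa_le w k.+1) _.
by rewrite /barrier prod_iterSl (iterSr k.+1) [leLHS]mulrCA [leRHS]mulrC.
Qed.

Let measurable_iter k : measurable_fun [set: Omega] (iter k sigmaV).
Proof.
elim: k => [|k IHk]; first exact: measurable_id.
by apply: measurableT_comp => //; exact: measurable_sigmaV.
Qed.

Lemma measurable_kappa : measurable_fun [set: Omega] kappa.
Proof.
have mf : measurable_fun setT floor.
  apply: measurable_minr; first exact: measurable_cst.
  apply: measurable_funM; first exact: measurable_cst.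
  by apply: measurable_funV => //; exact: measurable_funM.
have mg : measurable_fun setT g.
  by apply: measurableT_comp => //; exact: measurable_expR.
apply: (measurable_fun_infs (h := fun k w => barrier w k)).
  by move=> w _; exists 0 => _ [j _ <-]; exact: ltW.
move=> k; apply: measurable_funM.
  exact: (measurableT_comp mf (measurable_iter k.+1)).
apply: measurable_prod => j _.
exact: (measurableT_comp mg (measurable_iter j.+1)).
Qed.

Let expansion_growth : exists2 al : R, 0 < al &
  {ae P, forall w, exists C1 : R, forall n,
    expR (al * n%:R - C1) <= \prod_(i < n) g (iter i.+1 sigmaV w)}.
Proof.
have iE := @integrable_log_expansion M eta N (ltW eta0).
have mE := @measurable_log_expansion M eta N.
have PV A : measurable A -> P A = P (sigmaV @^-1` A).
  by move=> mA; rewrite sigmaV_mpt.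
have iEV : P.-integrable setT (EFin \o (log_expansion M eta N \o sigmaV)).
  apply: (integrable_transport measurable_sigmaV PV (f := EFin \o log_expansion M eta N)) => //.
  exact/measurable_EFinP.
have EV0 : 0 < \int[P]_w (log_expansion M eta N \o sigmaV) w.
  by rewrite -(Rintegral_transport measurable_sigmaV PV mE).
have [al al0 h] := ergodic_sums_linear_growth measurable_sigmaV sigmaV_mpt
  sigmaV_ergodic iEV EV0.
exists al => //; apply: filterS h => w [C1 h]; exists C1 => n.
rewrite (_ : \prod_(i < n) _ = expR (\sum_(i < n) log_expansion M eta N (iter i.+1 sigmaV w))).
  by rewrite ler_expR.
by elim: {h} n => [|n IHn]; rewrite ?big_ord0 ?expR0// !big_ord_recr/= expRD IHn.
Qed.

(** The product in the k-th barrier is at least exp (al k - C1), while the floor k + 1 steps back is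
    at least a constant times exp (- al (k + 1)), because the distortion grows at most at the rate
    al. The two exponentials cancel and leave a bound uniform in k. *)
Let kappa_gt0 : {ae P, forall w, 0 < kappa w}.
Proof.
have [al al0 hal] := expansion_growth.
have r1 : expR (- al) < 1 by rewrite -expR0 ltr_expR oppr_lt0.
have hQ := bounded_by_summable measurable_sigmaV sigmaV_mpt iQ
  (fun w => ltW (Q0 w)) (expR_ge0 (- al)) r1.
apply: filterS2 hal hQ => w [C1 hC1] [C2 hC2].
pose c := Order.min ((1 - t) / 2) (delta / 4).
have s0 : 0 < 1 - t by rewrite subr_gt0; exact: t1.
have c0 : 0 < c by rewrite lt_min (divr_gt0 s0 _)// (divr_gt0 delta0 _).
have C20 : 0 < C2.
  by have := hC2 0%N; rewrite expr0 mulr1; apply: lt_le_trans (Q0 _).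
apply: (@lt_le_trans _ _ (c * expR (- C1) * (expR (- al)) / C2)).
  by rewrite divr_gt0// !mulr_gt0 ?expR_gt0.
apply: kappa_ge => k; rewrite /barrier.
set w' := iter k.+1 sigmaV w.
have fl : c / distortion B w' <= floor w'.
  rewrite le_min; apply/andP; split.
    apply: (@le_trans _ _ c); last by rewrite ge_min lexx.
    by rewrite ler_pdivrMr// ler_peMr ?(ltW c0)// distortion_ge1.
  rewrite (_ : delta / (4 * distortion B w') = delta / 4 / distortion B w').
    by rewrite ler_pM2r ?invr_gt0// ge_min lexx orbT.
  by rewrite [in LHS]invfM mulrA.
apply: (@le_trans _ _ (c / distortion B w' * expR (al * k%:R - C1))); last first.
  by apply: ler_pM => //; rewrite ?expR_ge0// divr_ge0// ltW.
have := hC2 k.+1; rewrite -/w'; have := Q0 w'.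
set q := distortion B w' => q0 h.
have E : expR (- al) ^+ k * expR (al * k%:R) = 1.
  by rewrite -expRM_natl -expRD mulrN [al * _]mulrC addNr expR0.
rewrite expRD ler_pdivrMr// -!mulrA ler_pM2l//.
have -> : q^-1 * (expR (al * k%:R) * (expR (- C1) * C2)) =
    expR (- C1) * (q^-1 * (expR (al * k%:R) * C2)) by ring.
rewrite ler_pM2l ?expR_gt0// mulrC ler_pdivlMr//.
have := ler_wpM2r (expR_ge0 (al * k%:R)) h.
rewrite exprS [C2 * _]mulrC; apply: le_trans; rewrite le_eqVlt; apply/orP; left; apply/eqP.
transitivity (expR (- al) * q * (expR (- al) ^+ k * expR (al * k%:R))).
  by rewrite E mulr1.
by set u := expR (- al); set v := expR (al * _); ring.
Qed.

Let contraction w := folding B w * kappa w ^+ 4 / 16.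

Let contraction_ge0 w : 0 <= contraction w.
Proof. by rewrite divr_ge0// mulr_ge0 ?folding_ge0// exprn_ge0. Qed.

Let contraction_le1 w : contraction w <= 1.
Proof.
rewrite /contraction; have f1 := folding_le B w; have f0 := folding_ge0 B w.
have k1 : kappa w ^+ 4 <= 1 by rewrite exprn_ile1.
have k0 : 0 <= kappa w ^+ 4 by rewrite exprn_ge0.
have := ler_pM f0 k0 f1 k1; lra.
Qed.

Let measurable_contraction : measurable_fun [set: Omega] contraction.
Proof.
apply: measurable_funM; last exact: measurable_cst.
apply: measurable_funM; first exact: measurable_folding.
by apply: measurable_funX; exact: measurable_kappa.
Qed.

Let integrable_contraction : P.-integrable [set: Omega] (EFin \o contraction).
Proof.
apply: (bounded_integrable P measurable_contraction (M := 1)) => w.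
by rewrite ger0_norm.
Qed.

(** Otherwise [contraction] would vanish almost everywhere, but it is positive wherever the degree
    is at least 2 and [kappa] is positive. *)
Let integral_contraction_gt0 : 0 < \int[P]_w contraction w.
Proof.
have ge0 : 0 <= \int[P]_w contraction w.
  by apply: Rintegral_ge0 => w _; exact: contraction_ge0.
rewrite lt_neqAle ge0 andbT.
apply/eqP => /esym I0; have /eqP := not_ae_moebius; apply.
have /(ae_eq_integral_abs P measurableT)[h _] :
    measurable_fun setT (EFin \o contraction) by exact/measurable_EFinP.
have /h{}h : (\int[P]_w `|(EFin \o contraction) w| = 0)%E.
  rewrite (_ : (fun _ => _) = EFin \o contraction); last first.
    by apply/funext => w /=; rewrite ger0_norm.
  by rewrite -[LHS]fineK ?integrable_fin_num// [fine _]I0.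
apply: (measure_negligible (mu := P)).
  rewrite -[X in measurable X]setTI.
  by apply: (@measurable_bdeg_lt _ _ _ B 1 measurableT [set true]).
have hk : {ae P, forall w, contraction w = 0 /\ 0 < kappa w}.
  by apply: filterS2 h kappa_gt0 => w /(_ I)[h] k0.
apply: negligibleS hk.
move=> w /= d1 [cw k0].
have : 0 < contraction w.
  by rewrite /contraction divr_gt0// mulr_gt0 ?folding_gt0// exprn_gt0.
by rewrite cw ltxx.
Qed.

Let contraction_growth : exists2 be : R, 0 < be &
  {ae P, forall w, exists C2 : R, forall n,
    be * n%:R - C2 <= \sum_(i < n) contraction (iter i.+1 sigmaV w)}.
Proof.
have PV A : measurable A -> P A = P (sigmaV @^-1` A).
  by move=> mA; rewrite sigmaV_mpt.
have iV : P.-integrable setT (EFin \o (contraction \o sigmaV)).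
  apply: (integrable_transport measurable_sigmaV PV (f := EFin \o contraction)) => //.
  exact/measurable_EFinP.
have V0 : 0 < \int[P]_w (contraction \o sigmaV) w.
  by rewrite -(Rintegral_transport measurable_sigmaV PV measurable_contraction).
exact: (ergodic_sums_linear_growth measurable_sigmaV sigmaV_mpt
  sigmaV_ergodic iV V0).
Qed.

Lemma random_backward_limit_aux : {ae P, forall w,
  exists (x : C) (a r A k0 : R) (n1 : nat),
  [/\ normc x < 1, 0 < k0, 0 < a, a < 1 & 0 < r] /\
  [/\ r < 1, 0 <= A,
    (forall n z, normc z < 1 -> a ^+ n <= defect z -> (n1 <= n)%N ->
      k0 <= defect (cocycle sigma (bmap B) n (iter n sigmaV w) z)) &
    (forall n z, normc z < 1 -> a ^+ n <= defect z ->
      normc (cocycle sigma (bmap B) n (iter n sigmaV w) z - x) <= A * r ^+ n)]}.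
Proof.
have [al al0 hal] := expansion_growth.
have [be be0 hbe] := contraction_growth.
have hk := ae_comp_mpt_iter measurable_sigmaV sigmaV_mpt kappa_gt0.
near=> w.
have [C1 hC1] : exists C1 : R, forall n,
    expR (al * n%:R - C1) <= \prod_(i < n) g (iter i.+1 sigmaV w).
  by near: w.
have [C2 hC2] : exists C2 : R, forall n,
    be * n%:R - C2 <= \sum_(i < n) contraction (iter i.+1 sigmaV w).
  by near: w.
have hk' : forall n, 0 < kappa (iter n sigmaV w) by near: w.
have gam0 : 0 < M%:R :> R by rewrite ltr0n.
have T1 (j : nat) z : normc z < 1 -> normc (bmap B (iter j.+1 sigmaV w) z) < 1.
  by have [_ _ T1 _] := inner_map_bmap B (iter j.+1 sigmaV w); exact: T1.
have Td (j : nat) z s : normc z < 1 -> 0 <= s ->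
    Order.min (kappa (iter j.+1 sigmaV w)) s <= defect z ->
    Order.min (kappa (iter j sigmaV w)) (g (iter j.+1 sigmaV w) * s) <=
      defect (bmap B (iter j.+1 sigmaV w) z).
  move=> z1 s0 hs; apply: le_trans (defect_step _ z1).
  set w' := iter j sigmaV w; rewrite le_min; apply/andP; split.
    by rewrite ge_min; apply/orP; left; exact: kappa_le_floor.
  move: hs; rewrite ge_min => /orP[] hs; rewrite ge_min; apply/orP; [left|right].
    by apply: (le_trans (kappa_step w')); rewrite ler_pM2l.
  by rewrite ler_pM2l.
have gle (j : nat) : g (iter j.+1 sigmaV w) <= expR M%:R.
  rewrite ler_expR /log_expansion; case: ifP => _.
    by rewrite lerBlDr ge_min; apply/orP; right; rewrite lerDl ltW.
  apply: (@le_trans _ _ 0) => //; rewrite oppr_le0 ln_ge0//.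
  by have := distortion_ge1 B (iter j.+1 sigmaV w); lra.
have Tc (j : nat) z z' : normc z < 1 -> normc z' < 1 ->
    kappa (iter j.+1 sigmaV w) <= defect z ->
    kappa (iter j.+1 sigmaV w) <= defect z' ->
    sqr_ph (bmap B (iter j.+1 sigmaV w) z) (bmap B (iter j.+1 sigmaV w) z') <=
    (1 - contraction (iter j.+1 sigmaV w)) * sqr_ph z z'.
  by move=> z1 z1' h h'; exact: sqr_ph_bmap.
have [x [a [r [A [n1 [[x1 hx a0 a1 r0] [r1 A0 hD hx2]]]]]]] :=
  backcomp_limit T1 hk' (fun j => kappa_le1 _) (fun j => g0 _) Td
    (fun j => contraction_le1 _) Tc
    gam0 al0 be0 gle hC1 hC2.
exists x, a, r, A, (kappa w), n1; split; first by split => //; exact: (hk' 0%N).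
split => // n z z1.
  move=> h1 h2; have := hD n z z1 h1 h2.
  by rewrite backcomp_cocycle.
by move=> h1; have := hx2 n z z1 h1; rewrite backcomp_cocycle.
Unshelve. all: by end_near.
Qed.

End random_limit_parameters.

Lemma random_backward_limit : {ae P, forall w,
  exists (x : C) (a r A k0 : R) (n1 : nat),
  [/\ normc x < 1, 0 < k0, 0 < a, a < 1 & 0 < r] /\
  [/\ r < 1, 0 <= A,
    (forall n z, normc z < 1 -> a ^+ n <= defect z -> (n1 <= n)%N ->
      k0 <= defect (cocycle sigma (bmap B) n (iter n sigmaV w) z)) &
    (forall n z, normc z < 1 -> a ^+ n <= defect z ->
      normc (cocycle sigma (bmap B) n (iter n sigmaV w) z - x) <= A * r ^+ n)]}.
Proof.
have [M [eta [N [e0 M0 E0]]]] := positive_expansion.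
exact: random_backward_limit_aux e0 M0 E0.
Qed.

End random_limit.

(** * A measurable and equivariant choice of the attracting point *)

Section random_fixed_point.
Context d (Omega : measurableType d) (R : realType) (P : probability Omega R).
Variables (sigma sigmaV : Omega -> Omega) (B : blaschke_cocycle Omega R).
Hypothesis hsigma : invertible_mpt P sigma sigmaV.
Local Notation C := R[i].

(** The map does not increase the pseudo-hyperbolic distance, which is comparable to the Euclidean
    one near x. *)
Lemma bmap_lipschitz w (x z : C) : normc x < 1 -> normc z < 1 ->
  normc (bmap B w x - bmap B w z) <= 4 / defect x * normc (x - z).
Proof.
move=> x1 z1; have [_ _ T1 _] := inner_map_bmap B w.
have D0 : 0 < defect x by rewrite defect_gt0.
have rhs0 : 0 <= 4 / defect x * normc (x - z).
  by rewrite mulr_ge0 ?divr_ge0 ?normc_ge0 ?(ltW D0).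
rewrite -(@ler_pXn2r _ 2) ?nnegrE ?normc_ge0//.
apply: (le_trans (sqr_normc_sub_le_ph (T1 _ x1) (T1 _ z1))).
apply: (@le_trans _ _ (4 * sqr_ph x z)); first by rewrite ler_pM2l// sqr_ph_bmap_le.
have N0 := ph_den_gt0 x1 z1; have := defect_le_den x1 z1.
rewrite /sqr_ph mulrA ler_pdivrMr ?exprn_gt0//.
move: (normc (1 - x * _)) N0 (defect x) D0 (normc (x - z)) => N N0 D D0 n h.
have -> : (4 / D * n) ^+ 2 * N ^+ 2 = 4 * n ^+ 2 * ((2 * N) ^+ 2 / D ^+ 2).
  by field; rewrite gt_eqF.
apply: ler_peMr; first by rewrite mulr_ge0 ?sqr_ge0.
rewrite ler_pdivlMr ?exprn_gt0// mul1r.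
by rewrite ler_pXn2r ?nnegrE ?mulr_ge0 ?(ltW N0) ?(ltW D0).
Qed.

(** The conclusion of [random_backward_limit] at a given point, with its rates: the Poisson averages
    start from points of defect a^n, which change with n, so pointwise convergence alone does not
    control them. *)
Definition backward_attractor w (x : C) :=
  exists (a r A k0 : R) (n1 : nat),
  [/\ normc x < 1, 0 < k0, 0 < a, a < 1 & 0 < r] /\
  [/\ r < 1, 0 <= A,
    (forall n z, normc z < 1 -> a ^+ n <= defect z -> (n1 <= n)%N ->
      k0 <= defect (cocycle sigma (bmap B) n (iter n sigmaV w) z)) &
    (forall n z, normc z < 1 -> a ^+ n <= defect z ->
      normc (cocycle sigma (bmap B) n (iter n sigmaV w) z - x) <= A * r ^+ n)].

Lemma backward_attractor_cvg w x z : backward_attractor w x -> normc z < 1 ->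
  forall e : R, 0 < e ->
  \forall n \near \oo, normc (x - cocycle sigma (bmap B) n (iter n sigmaV w) z) < e.
Proof.
move=> [a [r [A [k0 [n1 [[x1 k00 a0 a1 r0] [r1 A0 _ h]]]]]]] z1 e e0.
have D0 : 0 < defect z by rewrite defect_gt0.
have [N1 hN1] := geometric_lt (ltW a0) a1 D0.
have A1 : 0 < A + 1 by rewrite ltr_wpDl.
have [N2 hN2] := geometric_lt (ltW r0) r1 (divr_gt0 e0 A1).
exists (maxn N1 N2) => // n /=; rewrite geq_max => /andP[nN1 nN2].
rewrite normc_subC; apply: (le_lt_trans (h n z z1 _)).
  by apply: le_trans (ltW hN1); rewrite ler_wiXn2l ?ltW.
have : r ^+ n < e / (A + 1).
  by apply: le_lt_trans hN2; rewrite ler_wiXn2l ?ltW.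
rewrite ltr_pdivlMr// mulrC; apply: le_lt_trans.
by rewrite ler_wpM2r ?exprn_ge0 ?ltW// ltrDl.
Qed.

Lemma cvg_cocycleP w x z :
  cocycle sigma (bmap B) n (iter n sigmaV w) z @[n --> \oo] --> x <->
  forall e : R, 0 < e -> \forall n \near \oo,
    normc (x - cocycle sigma (bmap B) n (iter n sigmaV w) z) < e.
Proof. exact: cvg_normcP. Qed.

Let u n w : C := cocycle sigma (bmap B) n (iter n sigmaV w) 0.

Let normc_u n w : normc (u n w) < 1.
Proof.
rewrite /u; elim: n w => [|n IHn] w; first by rewrite normc0.
rewrite (cocycle_backward hsigma).
by have [_ _ T1 _] := inner_map_bmap B (sigmaV w); apply: T1.
Qed.

Let cmeasurable_u n : cmeasurable [set: Omega] (u n).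
Proof.
elim: n => [|n IHn]; first exact: cmeasurable_cst.
have msV := measurable_sigmaV hsigma.
rewrite (_ : u n.+1 = fun w => bmap B (sigmaV w) (u n (sigmaV w))).
  by apply: cmeasurable_bmap => //; exact: (cmeasurable_comp IHn msV).
by apply/funext => w; rewrite /u (cocycle_backward hsigma).
Qed.

(** Componentwise upper limits are measurable even where the sequence diverges; [to_disc] then
    repairs the null set on which v may leave the disk. *)
Let v w : C :=
  (limn_sup (fun n => complex.Re (u n w)) +i* limn_sup (fun n => complex.Im (u n w)))%C.

Let bounded_seq (f : C -> R) (w : Omega) : (forall z, `|f z| <= normc z) ->
  has_ubound (range (fun n => f (u n w))) /\ has_lbound (range (fun n => f (u n w))).
Proof.
move=> fz; split; [exists 1|exists (-1)] => _ [n _ <-];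
  by have := le_trans (fz (u n w)) (ltW (normc_u n w)); rewrite ler_norml => /andP[].
Qed.

Let cmeasurable_v : cmeasurable [set: Omega] v.
Proof.
split; apply: measurable_fun_limn_sup => [w _|w _|n].
- by have [] := bounded_seq w (@normr_Re_le R).
- by have [] := bounded_seq w (@normr_Re_le R).
- by have [] := cmeasurable_u n.
- by have [] := bounded_seq w (@normr_Im_le R).
- by have [] := bounded_seq w (@normr_Im_le R).
- by have [] := cmeasurable_u n.
Qed.

Let cmeasurable_to_disc (f : Omega -> C) : cmeasurable [set: Omega] f ->
  cmeasurable [set: Omega] (fun w => to_disc (f w)).
Proof.
move=> mf; have m2 := measurable_sqr_normc mf.
have mlt : measurable_fun [set: Omega] (fun w => normc (f w) < 1).
  rewrite (_ : (fun _ => _) = (fun w => normc (f w) ^+ 2 < 1)).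
    by apply: measurable_fun_ltr => //; exact: measurable_cst.
  by apply/funext => w; rewrite expr_lt1// normc_ge0.
have [m1' m2'] := mf.
have E (g : C -> R) : g 0 = 0 -> (fun w => g (to_disc (f w))) =
    (fun w => if normc (f w) < 1 then g (f w) else 0).
  by move=> g0; apply/funext => w; rewrite /to_disc; case: ifP.
by split; rewrite E//; apply: measurable_fun_ifT => //; exact: measurable_cst.
Qed.

Lemma random_fixed_point_aux :
  {ae P, forall w, exists x, backward_attractor w x} ->
  exists x : Omega -> C, [/\ forall w, normc (x w) < 1,
    cmeasurable [set: Omega] x &
    {ae P, forall w, backward_attractor w (x w)}].
Proof.
move=> ha; exists (fun w => to_disc (v w)); split.
- by move=> w; exact: normc_to_disc.
- exact: cmeasurable_to_disc.
- apply: filterS ha => w [x hx]; rewrite (_ : to_disc (v w) = x)//.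
  have x1 : normc x < 1 by have [a [r [A [k0 [n1 [[]]]]]]] := hx.
  suff -> : v w = x by rewrite to_discE.
  have z0 : normc (0 : C) < 1 by rewrite normc0.
  have h := backward_attractor_cvg hx z0.
  have E (f : C -> R) : (forall z, `|f z| <= normc z) ->
      (forall z z', f (z - z') = f z - f z') ->
      limn_sup (fun n => f (u n w)) = f x.
    move=> fz fB.
    have : f (u n w) @[n --> \oo] --> f x.
      apply/cvgrPdist_lt => e e0; apply: filterS (h e e0) => n.
      by apply: le_lt_trans; rewrite -fB.
    by move=> /cvg_limn_inf_sup[].
  rewrite /v (E (@complex.Re R)) ?(E (@complex.Im R)).
  - by case: (x).
  - exact: normr_Im_le.
  - by case=> ? ? [].
  - exact: normr_Re_le.
  - by case=> ? ? [].
Qed.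

Lemma backward_attractor_equivariant w x y :
  backward_attractor w x -> backward_attractor (sigma w) y -> bmap B w x = y.
Proof.
move=> hx hy.
have x1 : normc x < 1 by have [a [r [A [k0 [n1 [[]]]]]]] := hx.
have z0 : normc (0 : C) < 1 by rewrite normc0.
have Dx : 0 < defect x by rewrite defect_gt0.
have cy : u n.+1 (sigma w) @[n --> \oo] --> y.
  apply/cvg_normcP => e e0; have [N _ hN] := backward_attractor_cvg hy z0 e0.
  by exists N => // n /= Nn; apply: (hN n.+1); exact: leqW.
have cx : u n.+1 (sigma w) @[n --> \oo] --> bmap B w x.
  apply/cvg_normcP => e e0.
  have c0 : 0 < 4 / defect x by rewrite divr_gt0.
  apply: filterS (backward_attractor_cvg hx z0 (divr_gt0 e0 c0)) => n h.
  have [K _ _ _ _] := hsigma.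
  rewrite /u (cocycle_backward hsigma) K.
  apply: le_lt_trans (bmap_lipschitz w x1 (normc_u n w)) _.
  by rewrite mulrC -ltr_pdivlMr.
exact: (cvg_unique _ cx cy).
Qed.

Lemma random_fixed_point : ergodic P sigma -> admissible B P ->
  exists x : Omega -> C, [/\ forall w, normc (x w) < 1,
    cmeasurable [set: Omega] x,
    {ae P, forall w, backward_attractor w (x w)} &
    {ae P, forall w, bmap B w (x w) = x (sigma w)}].
Proof.
move=> herg hadm.
have [x [x1 mx hx]] := random_fixed_point_aux (random_backward_limit hsigma herg hadm).
exists x; split => //.
have := ae_comp_mpt (measurable_sigma hsigma) (sigma_mpt hsigma) hx.
by apply: filterS2 hx => w; exact: backward_attractor_equivariant.
Qed.

End random_fixed_point.

(** * Transport of absolutely continuous measures *)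

Section mass_transport.
Variable R : realType.
Local Notation C := R[i].
Local Notation m := (@haar R).
Implicit Types (x c : C) (z : circle R).

(** Over a common denominator the numerator is at most 12 |c - x|. Both points are at distance at
    least k/2 from the circle, so the denominator is at least k^4 / 16; and 192 = 12 * 16. *)
Lemma poisson_lipschitz k x c z : 0 < k -> normc x < 1 -> normc c < 1 ->
  k <= defect x -> k <= defect c ->
  `|poisson c z - poisson x z| <= 192 / k ^+ 4 * normc (c - x).
Proof.
move=> k0 x1 c1 kx kc.
have n u : normc u < 1 -> k <= defect u ->
    k / 2 <= normc (circle_val z - u) /\ normc (circle_val z - u) <= 2.
  move=> u1; rewrite /defect => ku; have u0 := normc_ge0 u.
  have := normc_sub_le (circle_val z) u; have := normcD_le (circle_val z) (- u).
  rewrite normc_opp normc_circle; split; last by lra.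
  by apply: le_trans (_ : 1 - normc u <= _); [nra|lra].
have [nx nx2] := n x x1 kx; have [nc nc2] := n c c1 kc.
have hn : `|normc (circle_val z - c) - normc (circle_val z - x)| <= normc (c - x).
  have E : (circle_val z - x) - (circle_val z - c) = c - x by ring.
  have := normc_sub_le (circle_val z - x) (circle_val z - c); rewrite E.
  have := normc_sub_le (circle_val z - c) (circle_val z - x).
  rewrite -(normc_opp (circle_val z - c - _)) opprB E ler_norml.
  by lra.
have hd : `|normc c - normc x| <= normc (c - x).
  have := normc_sub_le c x; have := normc_sub_le x c; rewrite (normc_subC x).
  by rewrite ler_norml; lra.
have c0 := normc_ge0 c; have x0 := normc_ge0 x.
rewrite /poisson; move: (normc (circle_val z - c)) (normc (circle_val z - x))
  (normc (c - x)) nx nx2 nc nc2 hn hd => p q e nx nx2 nc nc2 hn hd.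
move: kx kc; rewrite /defect; move: (normc c) (normc x) c0 x0 c1 x1 hd =>
  s t s0 t0 s1 t1 hd kx kc.
have p0 : 0 < p by apply: lt_le_trans nc; rewrite divr_gt0.
have q0 : 0 < q by apply: lt_le_trans nx; rewrite divr_gt0.
have -> : (1 - s ^+ 2) / p ^+ 2 - (1 - t ^+ 2) / q ^+ 2 =
    ((t - s) * (t + s) * q ^+ 2 + (1 - t ^+ 2) * ((q - p) * (q + p))) / (p * q) ^+ 2.
  by field; rewrite !gt_eqF.
have pq0 : 0 < (p * q) ^+ 2 by rewrite exprn_gt0// mulr_gt0.
rewrite normrM normfV (ger0_norm (ltW pq0)) ler_pdivrMr//.
have e0 : 0 <= e by apply: le_trans hn.
apply: (@le_trans _ _ (12 * e)).
  have Q0 : 0 <= q ^+ 2 by exact: sqr_ge0.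
  have Q4 : q ^+ 2 <= 4 by nra.
  move: (q ^+ 2) Q0 Q4 => Q Q0 h3.
  apply: (le_trans (ler_normD _ _)); rewrite !normrM.
  rewrite (distrC t) (distrC q) (ger0_norm (_ : 0 <= t + s)) ?addr_ge0//.
  rewrite (ger0_norm (_ : 0 <= q + p)) ?addr_ge0 ?(ltW p0) ?(ltW q0)//.
  rewrite (ger0_norm Q0).
  rewrite (ger0_norm (_ : 0 <= 1 - t ^+ 2)); last by apply: le_trans kx; exact: ltW.
  have h1 : `|s - t| * (t + s) <= e * 2 by apply: ler_pM => //; lra.
  have h2 : `|p - q| * (q + p) <= e * 4 by apply: ler_pM => //; lra.
  have h4 : 1 - t ^+ 2 <= 1 by rewrite gerBl sqr_ge0.
  have h5 : `|s - t| * (t + s) * Q <= e * 2 * 4.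
    by apply: ler_pM => //; rewrite ?sqr_ge0 ?mulr_ge0 ?addr_ge0.
  have h6 : (1 - t ^+ 2) * (`|p - q| * (q + p)) <= 1 * (e * 4).
    apply: ler_pM => //; first by apply: le_trans kx; exact: ltW.
    by rewrite mulr_ge0// ltW// addr_gt0.
  lra.
have : (k ^+ 2 / 4) ^+ 2 <= (p * q) ^+ 2.
  rewrite ler_pXn2r ?nnegrE ?divr_ge0 ?sqr_ge0 ?mulr_ge0 ?(ltW p0) ?(ltW q0)//.
  have := ler_pM (divr_ge0 (ltW k0) (ler0n R 2)) (divr_ge0 (ltW k0) (ler0n R 2)) nc nx.
  by apply: le_trans; rewrite expr2; lra.
move=> h; apply: (@le_trans _ _ (192 / k ^+ 4 * e * (k ^+ 2 / 4) ^+ 2)).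
  by rewrite le_eqVlt; apply/orP; left; apply/eqP; field; rewrite gt_eqF.
apply: ler_wpM2l; last exact: h.
apply: mulr_ge0; last exact: e0.
apply: divr_ge0; first exact: ler0n.
by apply: exprn_ge0; exact: ltW.
Qed.

Lemma Rintegral_inner_poisson S Sc c (g : circle R -> R) (N : R) :
  inner_map S Sc -> normc c < 1 -> measurable_fun [set: circle R] g ->
  (forall z, `|g z| <= N) ->
  \int[m]_z (g (Sc z) * poisson c z) = \int[m]_z (g z * poisson (S c) z).
Proof.
move=> hS c1 mg gN; have [_ _ /(_ c c1) Sc1 _] := hS.
have mS := measurable_inner_map hS.
have := Rintegral_harmonic_inner_map hS c1 mg.
have mgS : measurable_fun setT (g \o Sc) by exact: measurableT_comp.
rewrite (Rintegral_harmonic_measure (g := g \o Sc) (M := N) c mgS (fun z => gN _)).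
by rewrite (@Rintegral_harmonic_measure _ _ _ N mg gN) !to_discE.
Qed.

(* The majorant of f is averaged by the Poisson kernel of radius r, which S
   transports to Poisson kernels of points close to x. *)
Lemma inner_map_mass_le S Sc x (f fp g : circle R -> R) (M eta r k e : R) :
  inner_map S Sc -> measurable_fun [set: circle R] f ->
  measurable_fun [set: circle R] fp -> measurable_fun [set: circle R] g ->
  (forall z, `|f z| <= M) -> (forall z, `|fp z| <= M) ->
  (forall z, 0 <= g z <= 1) -> 0 < eta -> local_majorant eta f fp ->
  0 <= r -> r < 1 -> normc x < 1 -> 0 < k -> k <= defect x ->
  k <= defect (S 0) -> (forall y, k <= defect (S (radial r y))) ->
  (forall y, normc (S (radial r y) - x) <= e) ->
  \int[m]_z (f z * g (Sc z)) <=
  (\int[m]_z fp z) * \int[m]_z (g z * poisson x z) +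
  (M * (192 / k ^+ 4 * e) + 8 * M * (1 - r ^+ 2) / eta ^+ 2 * (4 / k)) *
  \int[m]_z g z.
Proof.
move=> hS mf mfp mg fM fpM g01 eta0 fmaj r0 r1 x1 k0 kx kS0 kS Se.
have S1 := inner_lt1 hS; have mS := measurable_inner_map hS.
have mgS : measurable_fun setT (g \o Sc) by exact: measurableT_comp.
have gN z : `|g z| <= 1 by have /andP[? ?] := g01 z; rewrite ger0_norm.
have g0 z : 0 <= g z by have /andP[] := g01 z.
have M0 : 0 <= M by apply: le_trans (fM point).
have ig : m.-integrable setT (EFin \o g) by exact: bounded_integrable mg gN.
have G0 : 0 <= \int[m]_z g z by apply: Rintegral_ge0.
have e0 : 0 <= e by apply: le_trans (Se point); exact: normc_ge0.
have D0 : 0 < 1 - r ^+ 2 by rewrite subr_gt0 expr_lt1.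
set err := 8 * M * (1 - r ^+ 2) / eta ^+ 2.
have err0 : 0 <= err.
  apply: divr_ge0; last exact: sqr_ge0.
  by apply: mulr_ge0; [exact: mulr_ge0|exact: ltW].
have nr y : normc (radial r y) < 1 by rewrite normc_radial.
pose A z := \int[m]_y (fp y * poisson (radial r y) z).
have AM z : `|A z| <= M * (4 / (1 - r ^+ 2)).
  apply: normr_Rintegral_le => [|y].
    apply: measurable_funM; first exact: mfp.
    apply: measurable_poisson2; first exact: cmeasurable_radial.
    exact: measurable_cst.
  rewrite normrM; apply: ler_pM; [exact: normr_ge0|exact: normr_ge0|exact: fpM|].
  by have := normr_poisson_le z (nr y); rewrite normc_radial.
have [mA exch] := Rintegral_poisson_exchange m mfp mgS fpM (fun z => gN _) r0 r1.
have mfg : measurable_fun setT (fun z => f z * g (Sc z)).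
  exact: (measurable_funM mf mgS).
have mgA : measurable_fun setT (fun z => g (Sc z) * A z).
  exact: (measurable_funM mgS mA).
have iS : m.-integrable setT (EFin \o (fun z => g (Sc z))).
  exact: (bounded_integrable m mgS (fun z => gN _)).
have igA : m.-integrable setT (EFin \o (fun z => g (Sc z) * A z)).
  apply: (bounded_integrable m mgA (M := 1 * (M * (4 / (1 - r ^+ 2))))) => z.
  rewrite normrM; apply: ler_pM;
    [exact: normr_ge0|exact: normr_ge0|exact: gN|exact: AM].
have ierr : m.-integrable setT (EFin \o (fun z => err * g (Sc z))).
  exact: (integrableZl measurableT err iS).
apply: (@le_trans _ _ (\int[m]_z (g (Sc z) * A z + err * g (Sc z)))).
  apply: (le_Rintegral measurableT).
  - apply: (bounded_integrable m mfg (M := M * 1)) => z.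
    rewrite normrM; apply: ler_pM;
      [exact: normr_ge0|exact: normr_ge0|exact: fM|exact: gN].
  - exact: (integrableD measurableT igA ierr).
  - move=> z _; rewrite [f z * _]mulrC (mulrC err) -mulrDr.
    apply: ler_wpM2l; first exact: g0.
    exact: (@le_poisson_integral _ f fp M eta r z mfp fM fpM eta0 fmaj r0 r1).
rewrite (RintegralD measurableT igA ierr) (RintegralZl err measurableT iS).
have ip c : normc c < 1 -> m.-integrable setT (EFin \o (fun z => g z * poisson c z)).
  move=> c1; apply: (bounded_integrable m (M := 1 * (4 / (1 - normc c ^+ 2)))) => [|z].
    by apply: measurable_funM; [exact: mg|exact: measurable_poisson].
  rewrite normrM; apply: ler_pM;
    [exact: normr_ge0|exact: normr_ge0|exact: gN|exact: normr_poisson_le].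
have IS c : normc c < 1 -> k <= defect (S c) ->
    \int[m]_z (g z * poisson (S c) z) <= 4 / k * \int[m]_z g z.
  move=> c1 kc; rewrite -(RintegralZl (4 / k) measurableT ig).
  apply: (le_Rintegral measurableT (ip _ (S1 _ c1))).
    exact: (integrableZl measurableT (4 / k) ig).
  move=> z _; rewrite mulrC; apply: ler_wpM2r; first exact: g0.
  apply: le_trans (poisson_le _ (S1 _ c1)) _.
  apply: ler_wpM2l; first exact: ler0n.
  by rewrite lef_pV2 ?posrE; [exact: kc|exact: (lt_le_trans k0 kc)|exact: k0].
have n0 : normc (0 : C) < 1 by rewrite normc0.
(* Lebesgue measure is harmonic measure at 0, so its image has the density of the kernel at [S 0],
   which is at most 4 / k. *)
have -> : \int[m]_z g (Sc z) = \int[m]_z (g z * poisson (S 0) z).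
  rewrite -(Rintegral_inner_poisson hS n0 mg gN).
  apply: eq_Rintegral => z _.
  by rewrite /poisson normc0 subr0 normc_circle expr0n/= subr0 expr1n divr1 mulr1.
pose Ix := \int[m]_z (g z * poisson x z).
pose I y := \int[m]_z (g (Sc z) * poisson (radial r y) z).
rewrite (_ : \int[m]_z (g (Sc z) * A z) = \int[m]_y (fp y * I y)); last exact: exch.
have IE y : I y = \int[m]_z (g z * poisson (S (radial r y)) z).
  exact: (Rintegral_inner_poisson hS (nr y) mg gN).
have Ile y : `|I y - Ix| <= 192 / k ^+ 4 * e * \int[m]_z g z.
  have Sy1 := S1 _ (nr y).
  have idif : m.-integrable setT
      (EFin \o (fun z => g z * poisson (S (radial r y)) z - g z * poisson x z)).
    exact: (integrableB measurableT (ip _ Sy1) (ip _ x1)).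
  rewrite IE /Ix -(RintegralB measurableT (ip _ Sy1) (ip _ x1)).
  rewrite -(RintegralZl _ measurableT ig).
  apply: (le_trans (le_normr_Rintegral measurableT idif)).
  apply: (le_Rintegral measurableT).
  - exact: (integrable_norm idif).
  - exact: (integrableZl measurableT (192 / k ^+ 4 * e) ig).
  - move=> z _; rewrite -mulrBr normrM (ger0_norm (g0 z)) mulrC.
    apply: ler_wpM2r; first exact: g0.
    apply: le_trans (poisson_lipschitz z k0 x1 Sy1 kx (kS y)) _.
    apply: ler_wpM2l; last exact: Se.
    apply: divr_ge0; first exact: ler0n.
    by apply: exprn_ge0; exact: ltW.
have ifp := bounded_integrable m mfp fpM.
have mI : measurable_fun setT I.
  apply: (@measurable_Rintegral2 _ _ _ _ _ m m
    (fun p => g (Sc p.1) * poisson (radial r p.2) p.1) (1 * (4 / (1 - r ^+ 2)))).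
    apply: measurable_funM; last exact: measurable_poisson_radial.
    exact: (measurableT_comp mgS measurable_fst).
  case=> z y; rewrite normrM; apply: ler_pM;
    [exact: normr_ge0|exact: normr_ge0|exact: gN|].
  by have := normr_poisson_le z (nr y); rewrite normc_radial.
have IM y : `|I y| <= 4 / k * \int[m]_z g z.
  have I0 : 0 <= I y.
    rewrite IE; apply: Rintegral_ge0 => z _; apply: mulr_ge0; first exact: g0.
    by apply: poisson_ge0; exact: S1.
  by rewrite (ger0_norm I0) IE; exact: IS.
rewrite mulrDl addrA; apply: lerD; last first.
  by rewrite -[leRHS]mulrA; apply: ler_wpM2l; [exact: err0|exact: IS].
rewrite -/Ix [_ * Ix]mulrC -(RintegralZl Ix measurableT ifp).
set cc := M * _ * _.
have cE : cc = \int[m]_y cst cc y by rewrite Rintegral_haar_cst.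
have iL : m.-integrable setT (EFin \o (fun y => Ix * fp y)).
  exact: (integrableZl measurableT Ix ifp).
have iC : m.-integrable setT (EFin \o cst cc) by exact: finite_measure_integrable_cst.
rewrite cE -(RintegralD measurableT iL iC).
apply: (le_Rintegral measurableT).
- apply: (bounded_integrable m (M := M * (4 / k * \int[m]_z g z))) => [|y].
    exact: (measurable_funM mfp mI).
  rewrite normrM; apply: ler_pM;
    [exact: normr_ge0|exact: normr_ge0|exact: fpM|exact: IM].
- exact: (integrableD measurableT iL iC).
- move=> y _; rewrite -lerBlDl (mulrC Ix) -mulrBr.
  apply: (le_trans (ler_norm _)); rewrite normrM /cc /= -mulrA.
  apply: ler_pM; [exact: normr_ge0|exact: normr_ge0|exact: fpM|exact: Ile].
Qed.

End mass_transport.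

(** * Exponential estimates along the backward cocycle *)

Section random_mass_transport.
Context d (Omega : measurableType d) (R : realType) (P : probability Omega R).
Variables (sigma sigmaV : Omega -> Omega) (B : blaschke_cocycle Omega R).
Local Notation C := R[i].
Local Notation m := (@haar R).

Lemma inner_map_cocycle n w :
  inner_map (cocycle sigma (bmap B) n w) (cocycle sigma (bcircle B) n w).
Proof.
elim: n => [|n IHn]; last exact: inner_map_comp (inner_map_bmap B _) IHn.
by split => //; exact: disc_algebra_id.
Qed.

(** The upper envelope of f at scale eta exceeds f by at most L eta in mean, without being uniformly
    close to it. Jumps are thus allowed, and the same estimate covers functions of bounded
    variation, for the rate, and Lipschitz functions, for the mixing. *)
Definition majorizable (M L : R) (f : circle R -> R) :=
  [/\ measurable_fun [set: circle R] f, forall z, `|f z| <= M, 0 <= L &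
   forall eta, 0 < eta -> eta <= 1 -> exists fp : circle R -> R,
   [/\ measurable_fun [set: circle R] fp, forall z, `|fp z| <= M,
       local_majorant eta f fp & \int[m]_z fp z <= \int[m]_z f z + L * eta]].

Lemma random_mass_le w x f M L : backward_attractor sigma sigmaV B w x ->
  majorizable M L f ->
  exists (K t : R) (n0 : nat), [/\ 0 <= K, 0 < t, t < 1 &
  forall n (g : circle R -> R), (n0 <= n)%N ->
    measurable_fun [set: circle R] g -> (forall z, 0 <= g z <= 1) ->
    \int[m]_z (f z * g (cocycle sigma (bcircle B) n (iter n sigmaV w) z)) <=
    (\int[m]_z f z) * \int[m]_z (g z * poisson x z) + K * t ^+ n * \int[m]_z g z].
Proof.
move=> [a [r [A [k0 [n1 [[x1 k00 a0 a1 r0] [r1 A0 hD hx]]]]]]] [mf fM L0 hf].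
have Dx : 0 < defect x by rewrite defect_gt0.
pose k := Order.min k0 (defect x).
have kp : 0 < k by rewrite lt_min k00.
have kx : k <= defect x by rewrite ge_min lexx orbT.
have kk0 : k <= k0 by rewrite ge_min lexx.
(* The width of the majorant is s^n and the radius q below has 1 - q^2 = a^n = s^(4 n), so the tail
   (1 - q^2) / eta^2 is s^(2 n). *)
pose s := Num.sqrt (Num.sqrt a).
have s0 : 0 < s by rewrite !sqrtr_gt0.
have s4 : s ^+ 4 = a by rewrite (exprM s 2 2) !sqr_sqrtr// ?sqrtr_ge0// ltW.
have s1 : s < 1.
  by rewrite -(@expr_lt1 _ 4) ?s4// ltW.
have M0 : 0 <= M by apply: le_trans (fM point).
pose t := Num.max r s.
have t0 : 0 < t by rewrite lt_max r0.
have t1 : t < 1 by rewrite gt_max r1 s1.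
have rt n : r ^+ n <= t ^+ n.
  by apply: lerXn2r; rewrite ?nnegrE ?(ltW r0) ?(ltW t0)// le_max lexx.
have st n : s ^+ n <= t ^+ n.
  by apply: lerXn2r; rewrite ?nnegrE ?(ltW s0) ?(ltW t0)// le_max lexx orbT.
pose K := M * (192 / k ^+ 4 * A) + 8 * M * (4 / k) + L * (4 / k).
have k4 : 0 <= 4 / k by rewrite divr_ge0// ltW.
have k192 : 0 <= 192 / k ^+ 4 by apply: divr_ge0; [exact: ler0n|apply: exprn_ge0; exact: ltW].
have k1A : 0 <= M * (192 / k ^+ 4 * A) by apply: mulr_ge0 M0 (mulr_ge0 k192 A0).
have k8 : 0 <= 8 * M * (4 / k).
  by apply: mulr_ge0 k4; apply: mulr_ge0 M0; exact: ler0n.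
have kL : 0 <= L * (4 / k) by exact: mulr_ge0.
exists K, t, n1; split => //.
  exact: addr_ge0 (addr_ge0 k1A k8) kL.
move=> n g nn1 mg g01.
have an0 : 0 < a ^+ n by rewrite exprn_gt0.
have an1 : a ^+ n <= 1 by rewrite exprn_ile1// ltW.
pose q := Num.sqrt (1 - a ^+ n).
have q0 : 0 <= q by exact: sqrtr_ge0.
have q2 : 1 - q ^+ 2 = a ^+ n by rewrite sqr_sqrtr ?subr_ge0//; ring.
have q1 : q < 1.
  by rewrite -(@expr_lt1 _ 2)// -subr_gt0 q2.
have eta0 : 0 < s ^+ n by rewrite exprn_gt0.
have eta1 : s ^+ n <= 1 by rewrite exprn_ile1// ltW.
have [fp [mfp fpM fmaj fpI]] := hf _ eta0 eta1.
have nr y : normc (radial q y) < 1 by rewrite normc_radial.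
have Dr y : a ^+ n <= defect (radial q y) by rewrite /defect normc_radial// q2.
have D0 : a ^+ n <= defect 0 by rewrite /defect normc0 expr0n subr0.
have n0 : normc (0 : C) < 1 by rewrite normc0.
have := @inner_map_mass_le _ _ _ x f fp g M (s ^+ n) q k (A * r ^+ n)
  (inner_map_cocycle n (iter n sigmaV w)) mf mfp mg fM fpM g01 eta0 fmaj q0 q1
  x1 kp kx (le_trans kk0 (hD n 0 n0 D0 nn1))
  (fun y => le_trans kk0 (hD n _ (nr y) (Dr y) nn1)) (fun y => hx n _ (nr y) (Dr y)).
move=> /le_trans; apply.
have g0 z : 0 <= g z by have /andP[] := g01 z.
have gN z : `|g z| <= 1 by have /andP[? ?] := g01 z; rewrite ger0_norm.
have ig : m.-integrable setT (EFin \o g) by exact: bounded_integrable mg gN.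
have G0 : 0 <= \int[m]_z g z by apply: Rintegral_ge0.
have I0 : 0 <= \int[m]_z (g z * poisson x z).
  by apply: Rintegral_ge0 => z _; rewrite mulr_ge0// poisson_ge0.
have IG : \int[m]_z (g z * poisson x z) <= 4 / k * \int[m]_z g z.
  rewrite -(RintegralZl (4 / k) measurableT ig).
  apply: (le_Rintegral measurableT).
  - apply: (bounded_integrable m (M := 1 * (4 / (1 - normc x ^+ 2)))) => [|z].
      by apply: measurable_funM; [exact: mg|exact: measurable_poisson].
    rewrite normrM; apply: ler_pM;
      [exact: normr_ge0|exact: normr_ge0|exact: gN|exact: normr_poisson_le].
  - exact: (integrableZl measurableT (4 / k) ig).
  move=> z _; rewrite mulrC; apply: ler_wpM2r; first exact: g0.
  apply: le_trans (poisson_le _ x1) _.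
  apply: ler_wpM2l; first exact: ler0n.
  by rewrite lef_pV2 ?posrE; [exact: kx|exact: Dx|exact: kp].
move: (\int[m]_z (g z * _)) (\int[m]_z g z) (\int[m]_z fp z) (\int[m]_z f z)
  fpI I0 IG G0 => I G Fp F fpI I0 IG G0.
rewrite q2 -s4 -exprM mulnC exprM (_ : 8 * M * _ / _ = 8 * M * (s ^+ n) ^+ 2); last first.
  by field; rewrite gt_eqF.
have h1 : Fp * I <= F * I + L * s ^+ n * I.
  by rewrite -mulrDl; apply: ler_wpM2r.
apply: (le_trans (lerD h1 (lexx _))); rewrite -addrA lerD2l.
have h2 : L * s ^+ n * I <= L * (4 / k) * t ^+ n * G.
  apply: (@le_trans _ _ (L * s ^+ n * (4 / k * G))).
    by apply: ler_wpM2l => //; rewrite mulr_ge0// ltW.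
  rewrite (_ : _ * (4 / k * G) = L * (4 / k) * G * s ^+ n); last by ring.
  rewrite (_ : _ * t ^+ n * G = L * (4 / k) * G * t ^+ n); last by ring.
  by apply: ler_wpM2l; [exact: mulr_ge0 kL G0|exact: st].
apply: (le_trans (lerD h2 (lexx _))); rewrite -mulrDl.
apply: ler_wpM2r; first exact: G0.
rewrite /K [leRHS]mulrDl [leLHS]addrC; apply: lerD; last exact: lexx.
rewrite [leRHS]mulrDl; apply: lerD.
  rewrite (_ : M * (192 / k ^+ 4 * (A * r ^+ n)) = M * (192 / k ^+ 4 * A) * r ^+ n).
    by apply: ler_wpM2l; [exact: k1A|exact: rt].
  by rewrite !mulrA.
rewrite (_ : 8 * M * _ * (4 / k) = 8 * M * (4 / k) * (s ^+ n) ^+ 2); last by ring.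
apply: ler_wpM2l; first exact: k8.
by apply: le_trans (st n); rewrite expr2 ler_piMl// ltW.
Qed.

End random_mass_transport.

(** * Functions of bounded variation *)

Section argument.
Variable R : realType.
Implicit Types (s t x : R) (z y : circle R).

(** With h = x / 2 and the mean value theorem, sin x = 2 sin h cos h >= 2 h cos^2 h = h (1 + cos x)
    >= h. *)
Lemma sin_ge_half x : 0 <= x -> x <= pi / 2 -> x / 2 <= sin x.
Proof.
rewrite le_eqVlt => /predU1P[<-|x0] xpi; first by rewrite sin0 mul0r.
have p0 := pi_gt0 R.
pose h := x / 2; have h0 : 0 < h by rewrite divr_gt0.
have [c + E] := @MVT R sin cos 0 h h0 (fun x _ => is_derive_sin x)
  (continuous_subspaceT (@continuous_sin R)).
rewrite in_itv/= => /andP[c0 ch].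
move: E; rewrite sin0 !subr0 => E.
have hp : h <= pi by rewrite /h; lra.
have cc : cos h <= cos c.
  have cin : c \in `[0, pi] by rewrite in_itv/= (ltW c0) (le_trans (ltW ch)).
  have hin : h \in `[0, pi] by rewrite in_itv/= (ltW h0) hp.
  by rewrite leNgt ltr_cos// -leNgt ltW.
have chx : 0 <= cos x by apply: cos_ge0_pihalf; lra.
have xE : x = h *+ 2 by rewrite /h -mulr_natr divfK.
have Ec : cos x = cos h ^+ 2 *+ 2 - 1 by rewrite xE cos_mulr2n.
have Es : sin x = (cos h * sin h) *+ 2 by rewrite xE sin_mulr2n.
have ch0 : 0 <= cos h by apply: cos_ge0_pihalf; rewrite /h; lra.
rewrite Es E -mulr_natr.
have : h * cos h ^+ 2 <= cos h * (cos c * h).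
  rewrite [leRHS]mulrA mulrC; apply: ler_wpM2r; first exact: ltW.
  by rewrite expr2; apply: ler_wpM2l.
rewrite -/h; have : 0 <= h * (cos h ^+ 2 *+ 2 - 1).
  by rewrite -Ec mulr_ge0// ltW.
rewrite -mulr_natr; nra.
Qed.

Lemma sqr_normc_chord s t :
  normc (circle_val (circle_exp s) - circle_val (circle_exp t)) ^+ 2 =
  4 * sin (pi * (s - t)) ^+ 2.
Proof.
rewrite sqr_normcE /=.
set a := 2 * pi * s; set b := 2 * pi * t.
have E : cos (a - b) = 1 - 2 * sin (pi * (s - t)) ^+ 2.
  have -> : a - b = (pi * (s - t)) *+ 2 by rewrite /a /b mulr2n; ring.
  by rewrite cos_mulr2n cos2sin2 mulr2n; ring.
have := cos2Dsin2 a; have := cos2Dsin2 b; move: E; rewrite cosB => E ha hb.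
rewrite [LHS](_ : _ = (cos a ^+ 2 + sin a ^+ 2) + (cos b ^+ 2 + sin b ^+ 2) -
   2 * (cos a * cos b + sin a * sin b)); last by ring.
by rewrite ha hb E; ring.
Qed.

(** The minimum is the distance from s - t to the nearest integer, the length in turns of the arc
    between the points: nearby points have close parameters, except across the cut. *)
Lemma chord_ge s t : `|s - t| <= 1 ->
  Order.min `|s - t| (1 - `|s - t|) <=
  normc (circle_val (circle_exp s) - circle_val (circle_exp t)).
Proof.
move=> st; have p2 := pi_ge2 R; set u := `|s - t| in st *.
have u0 : 0 <= u by exact: normr_ge0.
have E : normc (circle_val (circle_exp s) - circle_val (circle_exp t)) ^+ 2 =
    (2 * sin (pi * u)) ^+ 2.
  rewrite sqr_normc_chord /u exprMn -natrX; congr (_ * _).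
  by have [_|_] := ger0P (s - t); rewrite // mulrN sinN sqrrN.
have h : Order.min u (1 - u) <= 2 * sin (pi * u).
  have [u2|u2] := leP u (1 / 2).
    rewrite ge_min; apply/orP; left.
    have : pi * u / 2 <= sin (pi * u) by apply: sin_ge_half; nra.
    nra.
  rewrite ge_min; apply/orP; right.
  have -> : sin (pi * u) = sin (pi * (1 - u)).
    by rewrite mulrBr mulr1 -[X in _ = sin X]opprB sinN sinB cospi sinpi; ring.
  have : pi * (1 - u) / 2 <= sin (pi * (1 - u)) by apply: sin_ge_half; nra.
  nra.
apply: (le_trans h); rewrite -ler_sqr ?nnegrE ?normc_ge0 ?E//.
by apply: le_trans h; rewrite le_min u0 subr_ge0.
Qed.

(** Composed with the projection onto [-1, 1], the function acos becomes monotone on the whole line,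
    hence measurable. *)
Let clamp x : R := Order.max (-1) (Order.min 1 x).

Let clampE x : -1 <= x <= 1 -> clamp x = x.
Proof. by move=> /andP[h1 h2]; rewrite /clamp min_r// max_r. Qed.

Let clamp_itv x : -1 <= clamp x <= 1.
Proof. by rewrite le_max lexx/= ge_max ge_min lexx/= andbT; lra. Qed.

Let measurable_acos_clamp : measurable_fun [set: R] (fun x => acos (clamp x)).
Proof.
rewrite (_ : (fun _ => _) = -%R \o (fun x => - acos (clamp x))); last first.
  by apply/funext => x /=; rewrite opprK.
apply: measurableT_comp; first exact: oppr_measurable.
apply: nondecreasing_measurable => // x y xy; rewrite lerN2 leNgt.
apply/negP => h.
have ha u : acos (clamp u) \in `[0, pi].
  by rewrite in_itv/= acos_ge0 ?acos_lepi ?clamp_itv.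
move: h; rewrite -ltr_cos ?ha// !acosK ?in_itv/= ?clamp_itv//.
rewrite ltNge => /negP; apply.
rewrite /clamp; have : Order.min 1 x <= Order.min 1 y.
  by rewrite le_min !ge_min lexx xy orbT.
by rewrite ge_max !le_max lexx /= => ->; rewrite orbT.
Qed.

Definition arg z : R :=
  if 0 <= complex.Im (circle_val z) then acos (complex.Re (circle_val z)) / (2 * pi)
  else 1 - acos (complex.Re (circle_val z)) / (2 * pi).

Let Re_itv z : -1 <= complex.Re (circle_val z) <= 1.
Proof. by have := normr_Re_le (circle_val z); rewrite normc_circle ler_norml. Qed.

Lemma measurable_arg : measurable_fun [set: circle R] arg.
Proof.
have [mRe mIm] := @cmeasurable_circle_val R.
have ma : measurable_fun [set: circle R]
    (fun z => acos (complex.Re (circle_val z)) / (2 * pi)).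
  apply: measurable_funM; last exact: measurable_cst.
  rewrite (_ : (fun _ => _) = (fun x => acos (clamp x)) \o (@complex.Re R \o @circle_val R)).
    exact: (measurableT_comp measurable_acos_clamp mRe).
  by apply/funext => z /=; rewrite clampE.
apply: measurable_fun_ifT => //.
  by apply: measurable_fun_ler => //; exact: measurable_cst.
by apply: measurable_funB => //; exact: measurable_cst.
Qed.

Let two_pi_gt0 : 0 < 2 * pi :> R. Proof. by rewrite mulr_gt0// pi_gt0. Qed.

Lemma circle_expK z : circle_exp (arg z) = z.
Proof.
apply: circle_val_inj; rewrite /circle_exp/= /arg.
have := sqr_normcE (circle_val z); have := Re_itv z; rewrite normc_circle expr1n.
case: (circle_val z) => a b /= a1 ab.
have sE : sin (acos a) = `|b|.
  by rewrite sin_acos// ab addrAC subrr add0r sqrtr_sqr.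
have cE : cos (acos a) = a by rewrite acosK// in_itv.
case: ifPn => b0.
  by rewrite mulrC divfK ?gt_eqF// cE sE ger0_norm.
rewrite mulrBr mulr1 [_ * (_ / _)]mulrC divfK ?gt_eqF//.
have p2 : 2 * pi = pi *+ 2 :> R by rewrite mulr_natl.
by rewrite p2 cosB sinB cos2pi sin2pi cE sE ltr0_norm ?ltNge//; congr (_ +i* _)%C; ring.
Qed.

Lemma arg_ge0 z : 0 <= arg z.
Proof.
have p0 := pi_gt0 R.
rewrite /arg; case: ifP => _; first by rewrite divr_ge0 ?acos_ge0// ltW.
rewrite subr_ge0 ler_pdivrMr// mul1r.
by apply: (le_trans (acos_lepi (Re_itv z))); lra.
Qed.

Lemma arg_lt1 z : arg z < 1.
Proof.
have p0 := pi_gt0 R.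
rewrite /arg; case: ifPn => b0.
  rewrite ltr_pdivrMr// mul1r.
  by apply: (le_lt_trans (acos_lepi (Re_itv z))); lra.
rewrite ltrBlDr ltrDl divr_gt0//; apply: acos_gt0.
have /andP[-> h] /= := Re_itv z; rewrite lt_neqAle h andbT.
apply: contra b0 => /eqP E.
have := sqr_normcE (circle_val z); rewrite normc_circle E !expr1n => /eqP.
by rewrite addrC -subr_eq subrr eq_sym sqrf_eq0 => /eqP ->.
Qed.

Lemma argK t : 0 <= t -> t < 1 -> arg (circle_exp t) = t.
Proof.
move=> t0 t1; have a0 := arg_ge0 (circle_exp t); have a1 := arg_lt1 (circle_exp t).
have at1 : `|arg (circle_exp t) - t| < 1 by rewrite ltr_norml; lra.
have := chord_ge (ltW at1); rewrite circle_expK subrr normc0 ge_min.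
case/orP; last by lra.
by rewrite normr_le0 subr_eq0 => /eqP.
Qed.

End argument.

(** * Local majorants of functions of bounded variation *)

Section bounded_variation_majorant.
Variable R : realType.
Local Notation m := (@haar R).
Local Notation leb := (@lebesgue_measure R).

Section monotone_shift.
Variables (G : R -> R) (K e : R).
Hypothesis Gmono : {homo G : x y / x <= y}.
Hypothesis GK : forall x, `|G x| <= K.
Hypothesis e0 : 0 < e.

Let h t : \bar R := (G (t + e) - G (t - e))%:E.

Lemma measurable_monotone_shift : measurable_fun [set: R] (fun t => G (t + e) - G (t - e)).
Proof.
apply: measurable_funB; apply: nondecreasing_measurable => // x y xy;
  by apply: Gmono; rewrite lerD2r.
Qed.

Let h_ge0 t : (0 <= h t)%E.
Proof. by rewrite lee_fin subr_ge0; apply: Gmono; have := e0; lra. Qed.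

(** On the k-th cell of length e the integrand is at most G ((k + 2) e) - G ((k - 1) e), which is
    Phi (k + 1) - Phi k. The sum telescopes to a difference of three values of G on each side,
    whence the 6 of the next lemma. *)
Let Phi k := G (k.+1%:R * e) + G (k%:R * e) + G ((k%:R - 1) * e).

Let shift_step k :
  (\int[leb]_(t in `[0%R, (k%:R * e)%R[) h t <= (e * (Phi k - Phi 0))%:E)%E.
Proof.
elim: k => [|k IHk].
  by rewrite mul0r set_itvco0 integral_set0 subrr mulr0.
have k0 : 0 <= k%:R * e by rewrite mulr_ge0// ltW.
have kk : k%:R * e <= k.+1%:R * e by rewrite ler_pM2r// ler_nat.
have mh D : measurable_fun D h.
  by apply: measurable_funTS; apply/measurable_EFinP; exact: measurable_monotone_shift.
rewrite (@itv_bndbnd_setU _ R (BLeft 0) (BLeft (k%:R * e)) (BLeft (k.+1%:R * e)));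
  [|by rewrite bnd_simp|by rewrite bnd_simp].
rewrite ge0_integral_setU//=; last 2 first.
- exact: mh.
- apply/disj_setPS => t /= []; rewrite !in_itv/= => /andP[_ h1] /andP[h2 _].
  by move: h1; rewrite ltNge h2.
have -> : e * (Phi k.+1 - Phi 0) = e * (Phi k - Phi 0) +
    (G (k.+2%:R * e) - G ((k%:R - 1) * e)) * e.
  rewrite /Phi (_ : (k.+1%:R - 1) * e = k%:R * e); first by ring.
  by rewrite -natr1 addrK.
rewrite EFinD; apply: leeD => //.
apply: (@le_trans _ _ (\int[leb]_(t in `[(k%:R * e)%R, (k.+1%:R * e)%R[)
    cst (G (k.+2%:R * e) - G ((k%:R - 1) * e))%:E t)%E).
  apply: ge0_le_integral => //.
  - exact: mh.
  - move=> t /=; rewrite in_itv/= => /andP[h1 h2]; rewrite lee_fin; apply: lerB.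
      by apply: Gmono; rewrite -[k.+2%:R]natr1 mulrDl mul1r; lra.
    by apply: Gmono; rewrite mulrBl mul1r; lra.
rewrite integral_cst//= lebesgue_measure_itv/= lte_fin.
case: ifPn => _.
  rewrite -EFinD -EFinM lee_fin; apply: ler_wpM2l.
    rewrite subr_ge0; apply: Gmono; apply: ler_wpM2r; first exact: ltW.
    have : k%:R <= k.+2%:R :> R by rewrite ler_nat !leqW.
    lra.
  by rewrite -natr1; lra.
rewrite mule0 lee_fin; apply: mulr_ge0; last exact: ltW.
rewrite subr_ge0; apply: Gmono.
apply: ler_wpM2r; first exact: ltW.
have : k%:R <= k.+2%:R :> R by rewrite ler_nat !leqW.
lra.
Qed.

Lemma integral_monotone_shift :
  (\int[leb]_(t in `[0%R, 1%R[) (G (t + e) - G (t - e))%:E <= (6 * K * e)%:E)%E.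
Proof.
have [k kE] := exists_nat_gt e^-1.
have k1 : 1 <= k%:R * e by rewrite -ler_pdivrMr// div1r ltW.
apply: (@le_trans _ _ (\int[leb]_(t in `[0%R, (k%:R * e)%R[) h t)%E).
  apply: ge0_subset_integral => //.
    by apply: measurable_funTS; apply/measurable_EFinP; exact: measurable_monotone_shift.
    by move=> t _; exact: h_ge0.
  by move=> t /=; rewrite !in_itv/= => /andP[-> t1]/=; exact: lt_le_trans k1.
apply: (le_trans (shift_step k)); rewrite lee_fin.
have hG x : - K <= G x /\ G x <= K by have := GK x; rewrite ler_norml => /andP[].
rewrite mulrC ler_pM2r// /Phi.
have [? ?] := hG (k.+1%:R * e); have [? ?] := hG (k%:R * e).
have [? ?] := hG ((k%:R - 1) * e); have [? ?] := hG (1%:R * e).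
have [? ?] := hG (0%:R * e); have [? ?] := hG ((0%:R - 1) * e).
lra.
Qed.

End monotone_shift.

(* [V] is extended by jumps of size 2 M at 0 and 1, which account for the points
   that are close on the circle but on both sides of the cut of the argument. *)
Section jumps.
Variables (F V : R -> R) (T M : R).
Hypothesis FV : forall x y, x <= y -> `|F y - F x| <= V y - V x.
Hypothesis VT : forall x, 0 <= V x <= T.
Hypothesis FM : forall x, `|F x| <= M.

Definition jumps x := if x < 0 then - (2 * M) else if 1 < x then T + 2 * M else V x.

Let M_ge0 : 0 <= M. Proof. exact: le_trans (FM 0). Qed.

Let T_ge0 : 0 <= T. Proof. by have /andP[h1 h2] := VT 0; exact: le_trans h2. Qed.

Let V_mono x y : x <= y -> V x <= V y.
Proof. by move=> xy; rewrite -subr_ge0; apply: le_trans (FV xy). Qed.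

Let jumps_lt0 x : x < 0 -> jumps x = - (2 * M).
Proof. by rewrite /jumps => ->. Qed.

Let jumps_gt1 x : 1 < x -> jumps x = T + 2 * M.
Proof. by move=> x1; rewrite /jumps ltNge (le_trans ler01 (ltW x1)) x1. Qed.

Let jumps_itv x : 0 <= x -> x <= 1 -> jumps x = V x.
Proof. by move=> x0 x1; rewrite /jumps !ltNge x0 x1. Qed.

Let M2_ge0 : 0 <= 2 * M. Proof. by rewrite mulr_ge0. Qed.

Lemma jumps_ge0 x : 0 <= x -> 0 <= jumps x.
Proof.
move=> x0; have [x1|x1] := leP x 1.
  by rewrite jumps_itv//; have /andP[] := VT x.
by rewrite jumps_gt1// addr_ge0.
Qed.

Lemma jumps_leT x : x <= 1 -> jumps x <= T.
Proof.
move=> x1; have [x0|x0] := leP 0 x.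
  by rewrite jumps_itv//; have /andP[] := VT x.
by rewrite jumps_lt0//; apply: le_trans T_ge0; rewrite oppr_le0.
Qed.

Lemma jumps_mono : {homo jumps : x y / x <= y}.
Proof.
move=> x y xy; have [x0|x0] := leP 0 x; have [y1|y1] := leP y 1.
- by rewrite !jumps_itv ?V_mono// ?(le_trans xy)// (le_trans x0).
- rewrite (jumps_gt1 y1); have [x1|x1] := leP x 1; last by rewrite jumps_gt1.
  by apply: (le_trans (jumps_leT x1)); rewrite lerDl.
- rewrite (jumps_lt0 x0); have [y0|y0] := leP 0 y; last by rewrite jumps_lt0.
  by apply: le_trans (jumps_ge0 y0); rewrite oppr_le0.
- rewrite (jumps_lt0 x0) (jumps_gt1 y1); apply: (@le_trans _ _ 0).
    by rewrite oppr_le0.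
  by rewrite addr_ge0.
Qed.

Lemma normr_jumps_le x : `|jumps x| <= 2 * M + T.
Proof.
have lo : - (2 * M) <= jumps x.
  have [x0|x0] := leP 0 x; last by rewrite jumps_lt0.
  by apply: le_trans (jumps_ge0 x0); rewrite oppr_le0.
have hi : jumps x <= T + 2 * M.
  have [x1|x1] := leP x 1; last by rewrite jumps_gt1.
  by apply: (le_trans (jumps_leT x1)); rewrite lerDl.
rewrite ler_norml addrC hi andbT; apply: le_trans lo.
by rewrite lerN2 addrC lerDl.
Qed.

Lemma le_jumps_near s t e : 0 <= s -> s < 1 -> 0 <= t -> t < 1 -> 0 < e ->
  Order.min `|s - t| (1 - `|s - t|) < e ->
  F t <= F s + (jumps (s + e) - jumps (s - e)).
Proof.
move=> s0 s1 t0 t1 e0.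
have /andP[Fs _] : - M <= F s <= M by rewrite -ler_norml.
have /andP[_ Ft] : - M <= F t <= M by rewrite -ler_norml.
have se0 : 0 <= s + e by rewrite addr_ge0// ltW.
(* A window around s that leaves [0, 1] meets a jump of 2 M, which dominates any difference of
   values of F. There remain windows inside [0, 1], for which s and t cannot be close across the
   cut. *)
have far : 2 * M <= jumps (s + e) - jumps (s - e) ->
    F t <= F s + (jumps (s + e) - jumps (s - e)).
  move=> h; apply: (le_trans Ft); apply: le_trans (lerD Fs h).
  by rewrite [2 * M]mulr_natl mulr2n addKr.
have [se|se] := ltP (s - e) 0.
  by move=> _; apply: far; rewrite (jumps_lt0 se) opprK lerDr jumps_ge0.
have [se'|se'] := ltP 1 (s + e).
  have s'1 : s - e <= 1 by rewrite lerBlDr (le_trans (ltW s1))// lerDl ltW.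
  move=> _; apply: far; rewrite (jumps_gt1 se') lerBrDr addrC lerD2r.
  exact: jumps_leT.
have s'1 : s - e <= 1 by rewrite lerBlDr (le_trans (ltW s1))// lerDl ltW.
rewrite (jumps_itv se0 se') (jumps_itv se s'1) gt_min => /orP[|]; last first.
  rewrite ltrBlDl => h; exfalso.
  by move: h; have [_|_] := ger0P (s - t); lra.
rewrite ltr_distl => /andP[h1 h2].
have h1' : s - e <= t by rewrite lerBlDr ltW.
have h2' : t <= s + e by rewrite -lerBlDr ltW.
rewrite -lerBlDl; apply: (le_trans (ler_norm _)).
have [ts|ts] := leP t s.
  rewrite distrC; apply: (le_trans (FV ts)); apply: lerB; apply: V_mono => //.
  by rewrite lerDl ltW.
apply: (le_trans (FV (ltW ts))); apply: lerB; apply: V_mono => //.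
by rewrite gerBl ltW.
Qed.

End jumps.

(** The majorant adds to f the increment, over a window of half-width eta, of the variation function
    extended with jumps. This function is bounded and monotone, so the increment has mean of order
    eta. *)
Lemma majorizable_bounded_variation (f : circle R -> R) :
  (circle_var f < +oo)%E -> exists M L, majorizable M L f.
Proof.
rewrite /circle_var; set F := f \o _ => hF.
have TVfin x : 0 <= x -> x <= 1 -> total_variation 0 x F \is a fin_num.
  move=> x0 x1; rewrite ge0_fin_numE ?total_variation_ge0//.
  apply: le_lt_trans hF; rewrite (total_variationD F x0 x1).
  by rewrite leeDl// total_variation_ge0.
pose v x := fine (total_variation 0 x F).
have vB x y : 0 <= x -> x <= y -> y <= 1 -> `|F y - F x| <= v y - v x.
  move=> x0 xy y1; have y0 := le_trans x0 xy; have x1 := le_trans xy y1.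
  have := total_variation_ge F xy; have hD := total_variationD F x0 xy.
  have fy := TVfin y y0 y1; have fx := TVfin x x0 x1.
  have fxy : total_variation x y F \is a fin_num.
    rewrite ge0_fin_numE ?total_variation_ge0//.
    apply: (@le_lt_trans _ _ (total_variation 0 y F)); last by rewrite -ge0_fin_numE ?total_variation_ge0.
    by rewrite hD leeDr// total_variation_ge0.
  by rewrite /v hD fineD// addrAC subrr add0r -(fineK fxy) lee_fin.
have v00 : v 0 = 0 by rewrite /v total_variationxx.
pose c x : R := Order.max 0 (Order.min 1 x).
have cI x : 0 <= c x <= 1 by rewrite le_max lexx/= ge_max ge_min lexx/= andbT.
have cE x : 0 <= x -> x <= 1 -> c x = x by move=> x0 x1; rewrite /c min_r// max_r.
have cmono x y : x <= y -> c x <= c y.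
  move=> xy; rewrite /c; have : Order.min 1 x <= Order.min 1 y.
    by rewrite le_min !ge_min lexx xy orbT.
  by rewrite ge_max !le_max lexx /= => ->; rewrite orbT.
pose V x := v (c x).
have VB x y : x <= y -> `|F (c y) - F (c x)| <= V y - V x.
  move=> xy; have /andP[? _] := cI x; have /andP[_ ?] := cI y.
  by apply: vB => //; exact: cmono.
have Vmono : {homo V : x y / x <= y}.
  by move=> x y xy; rewrite -subr_ge0; apply: le_trans (VB _ _ xy).
pose T := v 1.
have VT x : 0 <= V x <= T.
  have /andP[c0 c1] := cI x; apply/andP; split.
    by rewrite -v00 -subr_ge0; apply: le_trans (vB _ _ _ c0 c1).
  by rewrite -subr_ge0; apply: le_trans (vB _ _ c0 c1 _).
have T0 : 0 <= T by have /andP[h1 h2] := VT 0; exact: le_trans h2.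
have arg01 (z : circle R) : 0 <= arg z <= 1 by rewrite arg_ge0 ltW// arg_lt1.
have fE (z : circle R) : f z = F (c (arg z)).
  by rewrite cE ?arg_ge0 ?(ltW (arg_lt1 z))// /F/= circle_expK.
pose M := `|F 0| + T.
have fM (z : circle R) : `|f z| <= M.
  have /andP[a0 a1] := arg01 z.
  rewrite fE cE// -(subrK (F 0) (F _)); apply: (le_trans (ler_normD _ _)).
  rewrite addrC lerD2l; apply: (le_trans (vB _ _ (lexx 0) a0 a1)).
  by rewrite v00 subr0 -{1}(cE _ a0 a1); have /andP[] := VT (arg z).
have M_ge0 : 0 <= M by apply: le_trans (fM point); exact: normr_ge0.
have mf : measurable_fun setT f.
  (* Jordan decomposition: V and V - F are both nondecreasing, hence measurable. *)
  rewrite (_ : f = (fun x => V x - (V x - F (c x))) \o @arg R); last first.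
    by apply/funext => z /=; rewrite fE; ring.
  apply: measurableT_comp; last exact: measurable_arg.
  apply: measurable_funB; apply: nondecreasing_measurable => // x y xy.
  have := le_trans (ler_norm _) (VB x y xy); lra.
pose Fc x := F (c x).
have FcM x : `|Fc x| <= M.
  have /andP[c0 c1] := cI x; rewrite -(subrK (F 0) (Fc x)) /M.
  apply: (le_trans (ler_normD _ _)); rewrite addrC lerD2l.
  apply: (le_trans (vB _ _ (lexx 0) c0 c1)); rewrite v00 subr0.
  by have /andP[] := VT x.
exists M, (6 * (2 * M + T)); split.
- exact: mf.
- exact: fM.
- by rewrite mulr_ge0// addr_ge0// mulr_ge0.
move=> e e0 e1.
pose G := jumps V T M.
have Gmono : {homo G : x y / x <= y} by exact: (jumps_mono VB VT FcM).
have GK x : `|G x| <= 2 * M + T by exact: (normr_jumps_le VT FcM).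
pose W s := G (s + e) - G (s - e).
have W0 s : 0 <= W s.
  by rewrite subr_ge0 Gmono// lerD2l; apply: (@le_trans _ _ 0); rewrite ?oppr_le0 ltW.
have mW : measurable_fun setT W by exact: measurable_monotone_shift.
(* The same M must bound f and its majorant, hence the truncation. *)
pose fp z := Order.min M (f z + W (arg z)).
have mfp : measurable_fun setT fp.
  apply: measurable_minr; first exact: measurable_cst.
  apply: measurable_funD => //; exact: (measurableT_comp mW (@measurable_arg R)).
have ffp z : f z <= fp z.
  by rewrite le_min lerDl W0 andbT (le_trans (ler_norm _)).
have fpM z : `|fp z| <= M.
  rewrite ler_norml ge_min lexx/= andbT; apply: le_trans (ffp z).
  by have := fM z; rewrite ler_norml => /andP[].
exists fp; split => //.
- move=> y z yz.
  have st1 : `|arg y - arg z| <= 1.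
    have /andP[s0 s1] := arg01 y; have /andP[t0 t1] := arg01 z.
    by rewrite ler_norml lerBrDr lerBlDr (le_trans _ s0) ?(le_trans s1) ?lerDl// addrC subr_le0.
  have := chord_ge st1; rewrite !circle_expK => /le_lt_trans/(_ yz) near_yz.
  rewrite le_min (le_trans (ler_norm _) (fM z))/= !fE.
  apply: (le_jumps_near VB VT FcM) => //; rewrite ?arg_ge0 ?arg_lt1//.
- have i1 : m.-integrable setT (EFin \o fp) by exact: bounded_integrable mfp fpM.
  have i2 : m.-integrable setT (EFin \o f) by exact: bounded_integrable mf fM.
  rewrite -lerBlDl -(RintegralB measurableT i1 i2) -lee_fin /Rintegral fineK; last first.
    apply: integrable_fin_num => //; exact: (integrableB measurableT i1 i2).
  rewrite ge0_integral_haar; last 2 first.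
  - by apply/measurable_EFinP; exact: measurable_funB.
  - by move=> z; rewrite lee_fin subr_ge0.
  rewrite -integral_itv_bndo_bndc; last first.
    apply: measurable_funTS; apply/measurable_EFinP.
    have := measurable_funB mfp mf => h.
    exact: (measurableT_comp h (@measurable_circle_exp R)).
  apply: le_trans (integral_monotone_shift Gmono GK e0).
  apply: ge0_le_integral => //.
  - by move=> t _; rewrite lee_fin subr_ge0.
  - apply: measurable_funTS; apply/measurable_EFinP.
    have := measurable_funB mfp mf => h.
    exact: (measurableT_comp h (@measurable_circle_exp R)).
  - by apply: measurable_funTS; apply/measurable_EFinP.
  - move=> t /=; rewrite in_itv/= => /andP[t0 t1]; rewrite lee_fin lerBlDl.
    by rewrite ge_min argK// lexx orbT.
Qed.

Lemma majorizable_lipschitz (f : circle R -> R) (M K : R) :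
  measurable_fun [set: circle R] f -> (forall z, `|f z| <= M) -> 0 <= K ->
  chord_lipschitz K f -> majorizable (M + K) K f.
Proof.
move=> mf fM K0 fK; split => //.
  by move=> z; apply: le_trans (fM z) _; rewrite lerDl.
move=> e e0 e1; exists (fun z => f z + K * e); split.
- apply: measurable_funD => //; exact: measurable_cst.
- move=> z; apply: (le_trans (ler_normD _ _)); apply: lerD => //.
  by rewrite ger0_norm ?mulr_ge0 ?(ltW e0)// ler_piMr.
- move=> y z yz; rewrite -lerBlDl; apply: (le_trans (ler_norm _)).
  apply: (le_trans (fK _ _)); apply: ler_wpM2l => //.
  by rewrite normc_subC ltW.
- rewrite RintegralD// ?Rintegral_haar_cst//; first exact: bounded_integrable mf fM.
  exact: finite_measure_integrable_cst.
Qed.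

End bounded_variation_majorant.

(** * Transfer operators *)

Section transfer_operator.
Variable R : realType.
Local Notation C := R[i].
Local Notation m := (@haar R).
Implicit Types (S : C -> C) (Sc : circle R -> circle R).

(** The choice in [transfer] would fall back to 0 if no function qualified. One does: the image of
    the charge with density f is absolutely continuous, because preimages of null sets under [Sc]
    are null by [haar_inner_map], and its Radon-Nikodym derivative has the required integrals. *)
Lemma transfer_spec S Sc (f : circle R -> \bar R) : inner_map S Sc ->
  m.-integrable [set: circle R] f ->
  m.-integrable [set: circle R] (transfer Sc f) /\
  forall A, measurable A ->
    (\int[m]_(z in A) transfer Sc f z = \int[m]_(z in Sc @^-1` A) f z)%E.
Proof.
move=> hS intf; have mS := measurable_inner_map hS.
rewrite /transfer; set D := [set g | _]; suff : exists g, D g by apply: xgetPex.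
pose nu0 : {charge set (circle R) -> \bar R} :=
  pushforward (induced_charge intf) Sc.
pose nu := nu0 mS.
have dom : nu `<< m.
  apply/null_content_dominatesP => A mA mA0.
  have SA0 : m (Sc @^-1` A) = 0%E.
    rewrite (haar_inner_map hS mA).
    have /null_content_dominatesP := @harmonic_measure_dominates R (S 0); exact.
  rewrite /nu/= /pushforward/= /induced_charge; apply: null_set_integral => //.
    by rewrite -[X in measurable X]setTI; exact: (mS measurableT).
  exact: measurable_funTS (measurable_int _ intf).
exists (Radon_Nikodym nu m); split; first exact: Radon_Nikodym_integrable.
by move=> A mA; rewrite -Radon_Nikodym_integral.
Qed.

Lemma ae_le_of_integral_le (q : circle R -> \bar R) (c : R) :
  m.-integrable [set: circle R] q ->
  (forall A, measurable A -> (\int[m]_(z in A) q z <= c%:E * m A)%E) ->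
  {ae m, forall z, (q z <= c%:E)%E}.
Proof.
move=> iq hq; have mq := measurable_int _ iq.
pose A := [set z | (c%:E < q z)%E].
have mA : measurable A.
  rewrite -[A]setTI; apply: emeasurable_fun_lt => //; exact: measurable_cst.
have iA : m.-integrable A q by apply: integrableS iq.
have ic : m.-integrable A (cst c%:E).
  by apply: (@integrableS _ _ _ m setT) => //; exact: finite_measure_integrable_cst.
have mqc : measurable_fun A (fun z => q z - c%:E)%E.
  exact: (emeasurable_funB (measurable_funTS mq) (measurable_cst _)).
have qc0 z : A z -> (0 <= q z - c%:E)%E.
  by rewrite /A/= => /ltW; rewrite -sube_ge0.
have /(ae_eq_integral_abs m mA mqc) : (\int[m]_(z in A) `|q z - c%:E| = 0)%E.
  apply/eqP; rewrite eq_le integral_ge0// andbT.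
  have -> : (\int[m]_(z in A) `|q z - c%:E| = \int[m]_(z in A) (q z - c%:E))%E.
    by apply: eq_integral => z; rewrite inE => /qc0 h; rewrite gee0_abs.
  rewrite (integralB mA iA ic) integral_cst// sube_le0; first exact: hq.
apply: filterS => z h; rewrite leNgt; apply/negP => Az.
have := h Az; move: Az; rewrite /cst; case: (q z) => [r||]//=.
by rewrite lte_fin => cr [] /eqP; rewrite subr_eq0 gt_eqF.
Qed.

Lemma integral_indic_EFin d (T : measurableType d) (mu : {measure set T -> \bar R})
    (f : T -> R) (A : set T) : measurable A ->
  mu.-integrable [set: T] (EFin \o f) ->
  (\int[mu]_(x in A) (f x)%:E = (\int[mu]_x (f x * \1_A x))%:E)%E.
Proof.
move=> mA intf; rewrite /Rintegral integral_mkcond.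
have -> : (EFin \o f) \_ A = (fun x => (f x * \1_A x)%:E).
  apply/funext => x; rewrite patchE indicE; case: ifPn => _ /=; first by rewrite mulr1.
  by rewrite mulr0.
rewrite fineK//; apply: integrable_fin_num => //.
apply: (le_integrable measurableT _ _ intf).
  apply/measurable_EFinP; apply: measurable_funM; last exact: measurable_indic.
  by apply/measurable_EFinP; exact: measurable_int intf.
move=> x _ /=; rewrite lee_fin normrM indicE; case: (_ \in _); rewrite ?normr1 ?mulr1//.
by rewrite normr0 mulr0.
Qed.

End transfer_operator.

(** * Exponential decay for the transfer cocycle *)

Section random_transfer.
Context d (Omega : measurableType d) (R : realType).
Variables (sigma sigmaV : Omega -> Omega) (B : blaschke_cocycle Omega R).
Local Notation C := R[i].
Local Notation m := (@haar R).
Local Notation L := (fun w => transfer (bcircle B w)).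

Lemma cocycle_transfer n w (f : circle R -> \bar R) :
  m.-integrable [set: circle R] f ->
  m.-integrable [set: circle R] (cocycle sigma L n w f) /\
  forall A, measurable A ->
    (\int[m]_(z in A) cocycle sigma L n w f z =
     \int[m]_(z in cocycle sigma (bcircle B) n w @^-1` A) f z)%E.
Proof.
move=> intf; elim: n => [|n [iI IHn]] //=.
have [i1 h1] := transfer_spec (inner_map_bmap B (iter n sigma w)) iI.
split => // A mA; rewrite h1// IHn//.
by rewrite -[X in measurable X]setTI; exact: measurable_bcircle.
Qed.

Lemma transfer_harmonic_measure w (x : C) : normc x < 1 ->
  ae_eq m [set: circle R]
    (transfer (bcircle B w) (Radon_Nikodym (charge_of_finite_measure (harmonic_measure x)) m))
    (Radon_Nikodym (charge_of_finite_measure (harmonic_measure (bmap B w x))) m).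
Proof.
move=> x1; have dom c := @harmonic_measure_dominates R c.
have iRN c : m.-integrable [set: circle R]
    (Radon_Nikodym (charge_of_finite_measure (harmonic_measure c)) m).
  have h := @Radon_Nikodym_integrable _ _ _
    (charge_of_finite_measure (harmonic_measure c)) m (dom c).
  exact: h.
have [i1 h1] := transfer_spec (inner_map_bmap B w) (iRN x).
have mS A : measurable A -> measurable (bcircle B w @^-1` A).
  by move=> mA; rewrite -[X in measurable X]setTI; exact: measurable_bcircle.
apply: integral_ae_eq => //.
- exact: measurable_int (iRN _).
- move=> A _ mA; apply: (etrans (h1 A mA)).
  have e1 := @Radon_Nikodym_integral _ _ _
    (charge_of_finite_measure (harmonic_measure x)) m _ (dom x) (mS _ mA).
  have e2 := @Radon_Nikodym_integral _ _ _
    (charge_of_finite_measure (harmonic_measure (bmap B w x))) m _ (dom _) mA.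
  apply: (etrans (esym e1)); apply: etrans e2.
  exact: harmonic_measure_inner_map (inner_map_bmap B w) x1 mA.
Qed.

Lemma random_exponential_decay w (x : C) (h : circle R -> \bar R)
    (hs : circle R -> R) :
  backward_attractor sigma sigmaV B w x ->
  ae_eq m [set: circle R] h (EFin \o poisson x) ->
  (circle_var hs < +oo)%E -> {ae m, forall z, 0 <= hs z} ->
  ('N[m]_1[EFin \o hs] = 1)%E ->
  exists (n0 : nat) (r : R), r < 1 /\ forall n, (n0 <= n)%N ->
    ('N[m]_+oo[cocycle sigma L n (iter n sigmaV w) (EFin \o hs) \- h]
     <= (r ^+ n)%:E)%E.
Proof.
move=> hx hh hvar hs0 hs1.
have x1 : normc x < 1 by have [a [r [A [k0 [n1 [[]]]]]]] := hx.
have [M1 [L1 maj1]] := majorizable_bounded_variation hvar.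
(* The estimate of [random_mass_le] is one-sided; the opposite function yields the lower bound. *)
pose hsN : circle R -> R := \- hs.
have hvarN : (circle_var hsN < +oo)%E.
  by rewrite /circle_var -total_variationN (_ : \- _ = hs \o @circle_exp R)//;
    apply/funext => s /=; rewrite opprK.
have [M2 [L2 maj2]] := majorizable_bounded_variation hvarN.
have [mhs hsM _ _] := maj1.
have ihs : m.-integrable setT (EFin \o hs) by exact: bounded_integrable mhs hsM.
have I1 : \int[m]_z hs z = 1.
  rewrite /Rintegral -[RHS]/(fine 1%E) -hs1 Lnorm1; congr fine.
  have mE := measurable_int _ ihs.
  have mE' : measurable_fun setT (fun z => `|(EFin \o hs) z|)%E.
    by apply: measurableT_comp mE.
  apply: (ae_eq_integral _ _ measurableT mE mE').
  by apply: filterS hs0 => z hz _ /=; rewrite ger0_norm.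
have IN : \int[m]_z hsN z = -1.
  have E : hsN = (fun z => -1 * hs z).
    by apply/funext => z /=; rewrite mulN1r.
  by rewrite E (RintegralZl _ measurableT ihs) I1 mulr1.
have [K1 [t1 [n1 [K10 t10 t11 h1]]]] := random_mass_le hx maj1.
have [K2 [t2 [n2 [K20 t20 t21 h2]]]] := random_mass_le hx maj2.
pose t := Num.max t1 t2; pose K := K1 + K2.
have t0 : 0 < t by rewrite lt_max t10.
have tt1 : t < 1 by rewrite gt_max t11.
have K0 : 0 <= K by exact: addr_ge0.
(* The statement has no constant in front of the rate: since t^n = s^n s^n, one factor s^n absorbs K
   for large n. *)
pose s := Num.sqrt t.
have s0 : 0 < s by rewrite sqrtr_gt0.
have s1 : s < 1 by rewrite -sqrtr1 ltr_sqrt.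
have K1_gt0 : 0 < K + 1 by rewrite ltr_wpDl.
have KV0 : 0 < (K + 1)^-1 by rewrite invr_gt0.
have [n3 hn3] := geometric_lt (ltW s0) s1 KV0.
exists (maxn n3 (maxn n1 n2)), s; split => // n; rewrite !geq_max => /and3P[nn3 nn1 nn2].
apply: (@le_trans _ _ (K * t ^+ n)%:E); last first.
  have -> : t ^+ n = s ^+ n * s ^+ n by rewrite -exprMn -expr2 sqr_sqrtr ?(ltW t0).
  rewrite lee_fin mulrA; apply: ler_piMl; first by rewrite exprn_ge0 ?(ltW s0).
  have : s ^+ n <= (K + 1)^-1.
    by apply: le_trans (ltW hn3); rewrite ler_wiXn2l ?(ltW s0) ?(ltW s1).
  rewrite -[(K + 1)^-1]mul1r ler_pdivlMr// mulrC; apply: le_trans.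
  by rewrite ler_wpM2r ?exprn_ge0 ?(ltW s0)// lerDl.
have [ig hg] := cocycle_transfer n (iter n sigmaV w) ihs.
set g := cocycle _ _ _ _ _ in ig hg *.
set Sn := cocycle sigma (bcircle B) n (iter n sigmaV w) in hg h1 h2.
have mSn : measurable_fun setT Sn.
  exact: measurable_inner_map (inner_map_cocycle sigma B n (iter n sigmaV w)).
have iP := integrable_poisson m x1.
have kt1 : K1 * t1 ^+ n <= K * t ^+ n.
  apply: ler_pM => //; rewrite ?exprn_ge0 ?(ltW t10) ?lerDl//.
  by apply: lerXn2r; rewrite ?nnegrE ?(ltW t10) ?(ltW t0)// le_max lexx.
have kt2 : K2 * t2 ^+ n <= K * t ^+ n.
  apply: ler_pM => //; rewrite ?exprn_ge0 ?(ltW t20) ?lerDr//.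
  by apply: lerXn2r; rewrite ?nnegrE ?(ltW t20) ?(ltW t0)// le_max lexx orbT.
have indic01 A (z : circle R) : 0 <= (\1_A z : R) <= 1.
  by rewrite indicE; case: (_ \in _); rewrite /= ?lexx ?ler01.
have fA A : measurable A -> m A = (\int[m]_z (\1_A z : R))%:E.
  move=> mA; rewrite /Rintegral integral_indic// setIT fineK//.
  exact: fin_num_measure.
have gA A : measurable A ->
    (\int[m]_(z in A) g z = (\int[m]_z (hs z * \1_A (Sn z)))%:E)%E.
  move=> mA; rewrite hg// integral_indic_EFin//.
  by rewrite -[X in measurable X]setTI; exact: mSn.
have PA A : measurable A -> (\int[m]_(z in A) (EFin \o poisson x) z =
    (\int[m]_z (\1_A z * poisson x z))%:E)%E.
  move=> mA; rewrite integral_indic_EFin//; congr EFin.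
  by apply: eq_Rintegral => z _; rewrite mulrC.
have iAS A : measurable A -> m.-integrable setT (EFin \o (fun z => hs z * \1_A (Sn z))).
  move=> mA; have mi : measurable_fun setT (fun z => (\1_A (Sn z) : R)).
    by apply: (measurableT_comp (f := \1_A : circle R -> R)) => //; exact: measurable_indic.
  apply: (bounded_integrable m (M := M1 * 1)) => [|z]; first exact: measurable_funM.
  rewrite normrM; apply: ler_pM => //; have /andP[? ?] := indic01 A (Sn z).
  by rewrite ger0_norm.
have le1 : {ae m, forall z, (g z - (poisson x z)%:E <= (K * t ^+ n)%:E)%E}.
  apply: ae_le_of_integral_le; first exact: (integrableB measurableT ig iP).
  move=> A mA; rewrite (integralB mA (integrableS measurableT mA (@subsetT _ _) ig)
    (integrableS measurableT mA (@subsetT _ _) iP)).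
  rewrite gA// PA// fA// -EFinB -EFinM lee_fin lerBlDl.
  have := h1 n \1_A nn1 (measurable_indic mA) (indic01 A).
  rewrite I1 mul1r => /le_trans; apply; rewrite lerD2l.
  by apply: ler_wpM2r => //; apply: Rintegral_ge0 => z _; have /andP[] := indic01 A z.
have le2 : {ae m, forall z, ((poisson x z)%:E - g z <= (K * t ^+ n)%:E)%E}.
  apply: ae_le_of_integral_le; first exact: (integrableB measurableT iP ig).
  move=> A mA; rewrite (integralB mA (integrableS measurableT mA (@subsetT _ _) iP)
    (integrableS measurableT mA (@subsetT _ _) ig)).
  rewrite gA// PA// fA// -EFinB -EFinM lee_fin lerBlDl.
  have := h2 n \1_A nn2 (measurable_indic mA) (indic01 A).
  have -> : \int[m]_z (hsN z * \1_A (Sn z)) = - \int[m]_z (hs z * \1_A (Sn z)).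
    rewrite -mulN1r -(RintegralZl _ measurableT (iAS A mA)).
    by apply: eq_Rintegral => z _ /=; rewrite mulN1r mulNr.
  have G0 : 0 <= \int[m]_z (\1_A z : R).
    by apply: Rintegral_ge0 => z _; have /andP[] := indic01 A z.
  have := ler_wpM2r G0 kt2; rewrite IN mulN1r.
  by clear; move: (\int[m]_z (\1_A z : R)) => ?; lra.
rewrite unlock /Lnorm; case: ifPn => _; last first.
  by rewrite lee_fin mulr_ge0 ?exprn_ge0 ?(ltW t0).
apply: ereal_inf_lbound => /=.
have gfin : {ae m, forall z, g z \is a fin_num}.
  by have := integrable_ae measurableT ig; apply: filterS => z; apply.
near=> z.
have E : h z = (poisson x z)%:E by near: z; apply: filterS hh => z; apply.
have l1 : (g z - (poisson x z)%:E <= (K * t ^+ n)%:E)%E by near: z.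
have l2 : ((poisson x z)%:E - g z <= (K * t ^+ n)%:E)%E by near: z.
have gz : g z \is a fin_num by near: z.
move: l1 l2; rewrite /= E -(fineK gz) -!EFinB !lee_fin => l1 l2.
by rewrite ler_norml l1 andbT lerNl opprB.
Unshelve. all: by end_near.
Qed.

End random_transfer.

(** * Uniqueness *)

Section weak_convergence.
Context d (T : measurableType d) (R : realType).
Variable lam : {finite_measure set T -> \bar R}.
Variable psi : nat -> T -> R.
Hypothesis mpsi : forall n, measurable_fun [set: T] (psi n).
Hypothesis psi1 : forall n x, `|psi n x| <= 1.
Implicit Type f : T -> R.

(** For the fixed sequence [psi], bounded by 1, the integrable functions with this property form a
    closed subspace of L^1; that it contains all of them is the weak-star convergence of [psi] to
    0. *)
Definition weak_null f := \int[lam]_x (f x * psi n x) @[n --> \oo] --> (0 : R).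

Lemma integrable_mul_psi f n : lam.-integrable [set: T] (EFin \o f) ->
  lam.-integrable [set: T] (EFin \o (fun x => f x * psi n x)).
Proof.
move=> intf; apply: (le_integrable measurableT _ _ intf).
  apply/measurable_EFinP; apply: measurable_funM; last exact: mpsi.
  by apply/measurable_EFinP; exact: measurable_int intf.
by move=> x _ /=; rewrite lee_fin normrM ler_piMr.
Qed.

Lemma weak_nullD c f f' : lam.-integrable [set: T] (EFin \o f) ->
  lam.-integrable [set: T] (EFin \o f') -> weak_null f -> weak_null f' ->
  weak_null (fun x => f x + c * f' x).
Proof.
move=> i i' h h'; rewrite /weak_null.
have ip' := integrable_mul_psi _ i'.
rewrite (_ : (fun n => _) = (fun n =>
    \int[lam]_x (f x * psi n x) + c * \int[lam]_x (f' x * psi n x))).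
  rewrite -[0](addr0 0) -[X in _ + X](mulr0 c).
  by apply: cvgD => //; apply: cvgM => //; exact: cvg_cst.
apply/funext => n; have iZ := integrableZl measurableT c (ip' n).
rewrite -(RintegralZl c measurableT (ip' n)).
rewrite -(RintegralD measurableT (integrable_mul_psi n i) iZ).
by apply: eq_Rintegral => x _; rewrite mulrDl mulrA.
Qed.

Lemma weak_null_approx f : lam.-integrable [set: T] (EFin \o f) ->
  (forall e, 0 < e -> exists f', [/\ lam.-integrable [set: T] (EFin \o f'),
    weak_null f' & \int[lam]_x `|f x - f' x| <= e]) -> weak_null f.
Proof.
move=> i h; apply/cvgrPdist_lt => e e0.
have e20 : 0 < e / 2 by rewrite divr_gt0.
have [f' [i' h' fe]] := h _ e20.
have [N _ hN] := (@cvgrPdist_lt _ _ _ _ _ _ _).1 h' _ e20.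
exists N => // n Nn; have := hN n Nn; rewrite /= !sub0r !normrN => hn.
have iB := integrableB measurableT i i'.
have E : \int[lam]_x (f x * psi n x) =
    \int[lam]_x (f' x * psi n x) + \int[lam]_x ((f x - f' x) * psi n x).
  have iBp : lam.-integrable [set: T] (EFin \o (fun x => (f x - f' x) * psi n x)).
    exact: (integrable_mul_psi n iB).
  rewrite -(RintegralD measurableT (integrable_mul_psi n i') iBp).
  by apply: eq_Rintegral => x _; rewrite -mulrDl addrC subrK.
rewrite E [e]splitr; apply: (le_lt_trans (ler_normD _ _)); apply: ltr_leD => //.
have iBp : lam.-integrable [set: T] (EFin \o (fun x => (f x - f' x) * psi n x)).
  exact: (integrable_mul_psi n iB).
apply: (le_trans (le_normr_Rintegral measurableT iBp)); apply: le_trans fe.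
apply: (le_Rintegral measurableT).
- exact: (integrable_norm iBp).
- exact: (integrable_norm iB).
- by move=> x _; rewrite normrM ler_piMr.
Qed.

Let iindic A : measurable A -> lam.-integrable [set: T] (EFin \o (\1_A : T -> R)).
Proof.
move=> mA; apply: (bounded_integrable lam (M := 1)) => [|x].
  exact: measurable_indic.
by rewrite indicE; case: (_ \in _); rewrite /= ?normr1 ?normr0.
Qed.

(** A lambda-system argument: proper differences are handled by linearity, and increasing unions by
    closedness in L^1. *)
Lemma weak_null_measurable (C : set (set T)) : setI_closed C ->
  (measurable : set (set T)) = <<s C >> -> C [set: T] ->
  (forall A, C A -> weak_null \1_A) ->
  forall A, measurable A -> weak_null \1_A.
Proof.
move=> CI mC CT hC.
pose H : set (set T) := [set A | measurable A /\ weak_null \1_A].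
suff : measurable `<=` H by move=> + A => /[apply] -[].
rewrite mC; apply: lambda_system_subset => //; last first.
- by move=> A CA; split; [rewrite mC; exact: sub_sigma_algebra|exact: hC].
- split => //.
  + by split; [rewrite mC; exact: sub_sigma_algebra|exact: hC].
  + move=> A A' A'A [mA hA] [mA' hA']; split; first exact: measurableD.
    rewrite (_ : \1_(A `\` A') = (fun x => \1_A x + (-1) * \1_A' x :> R)).
      by apply: weak_nullD => //; exact: iindic.
    apply/funext => x; rewrite mulN1r !indicE in_setD.
    have [/set_mem/A'A/mem_set -> |] := boolP (x \in A'); first by rewrite subrr.
    by rewrite subr0 andbT.
  + move=> F ndF hF; have mF n : measurable (F n) by have [] := hF n.
    have mU : measurable (\bigcup_n F n) by exact: bigcup_measurable.
    split => //; apply: weak_null_approx => [|e e0]; first exact: iindic.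
    have cv : \int[lam]_x (\1_(F n) x : R) @[n --> \oo] -->
        \int[lam]_x (\1_(\bigcup_n F n) x : R).
      apply: (bounded_convergence (M := 1)).
      * by move=> n; exact: measurable_indic.
      * exact: measurable_indic.
      * by move=> n x; rewrite indicE; case: (_ \in _); rewrite /= ?normr1 ?normr0.
      * apply: aeW => x; apply: cvg_near_cst.
        have [/set_mem[k _ Fk]|nx] := boolP (x \in \bigcup_n F n).
          exists k => // n /= kn.
          have Fn : F n x by move/subsetPset : (ndF _ _ kn); exact.
          have Un : (\bigcup_n F n) x by exists k.
          by rewrite !indicE (mem_set Fn) (mem_set Un).
        exists 0%N => // n _; rewrite !indicE (negbTE nx).
        rewrite (_ : (x \in F n) = false)//; apply/negbTE; apply: contra nx.
        by move=> /set_mem Fx; apply/mem_set; exists n.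
    have [N _ hN] := (@cvgrPdist_le _ _ _ _ _ _ _).1 cv _ e0.
    exists \1_(F N); split; [exact: iindic|by have [] := hF N|].
    apply: le_trans (hN N (leqnn _)); apply: le_trans (ler_norm _).
    rewrite -(RintegralB measurableT (iindic mU) (iindic (mF N))).
    rewrite le_eqVlt; apply/orP; left; apply/eqP; apply: eq_Rintegral => x _.
    rewrite !indicE; have [/set_mem FN|_] := boolP (x \in F N); last first.
      by rewrite subr0 ger0_norm.
    have Un : (\bigcup_n F n) x by exists N.
    by rewrite (mem_set Un) subrr normr0.
Qed.

(* The number of positive integers below y, truncated at N. *)
Let count_below (N : nat) (y : R) : R := \sum_(j < N) (j.+1%:R <= y)%R%:R.

Let count_belowP N y : 0 <= y ->
  [/\ 0 <= count_below N y, count_below N y <= y &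
      y <= N%:R -> y - 1 <= count_below N y].
Proof.
move=> y0; suff [h1 h2] : (N%:R <= y -> count_below N y = N%:R) /\
    (y < N%:R -> y - 1 <= count_below N y /\ count_below N y <= y).
  have c0 : 0 <= count_below N y by apply: sumr_ge0.
  have [Ny|yN] := leP N%:R y; first by split=> //; rewrite h1//; lra.
  by have [? ?] := h2 yN; split.
elim: N => [|N [IH1 IH2]].
  by split; [rewrite /count_below big_ord0|move=> /lt_le_trans/(_ y0); rewrite ltxx].
rewrite /count_below big_ord_recr/= -/(count_below N y); split => [h|h].
  rewrite h IH1 ?natr1//; apply: le_trans h; by rewrite ler_nat.
rewrite (_ : (N.+1%:R <= y) = false); last by apply/negbTE; rewrite -ltNge.
rewrite addr0; have [Ny|yN] := leP N%:R y; last exact: IH2.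
by rewrite IH1//; move: h; rewrite -natr1; lra.
Qed.

Let weak_null_ge0 : (forall A, measurable A -> weak_null \1_A) ->
  forall f, (forall x, 0 <= f x) -> lam.-integrable [set: T] (EFin \o f) ->
  weak_null f.
Proof.
move=> hA f f0 intf; have mf : measurable_fun setT f.
  by apply/measurable_EFinP; exact: measurable_int intf.
pose lay (k j : nat) : set T := [set x | j.+1%:R <= k.+1%:R * f x].
have mlay k j : measurable (lay k j).
  rewrite -[lay k j]setTI; apply: measurable_fun_le => //.
  exact: (measurable_funM (measurable_cst _) mf).
(* This is f rounded down to a multiple of 1/(k+1) and capped at k+1, written as a sum over its
   (k+1)^2 superlevel sets. *)
pose fk (k : nat) x : R := \sum_(j < k.+1 * k.+1) k.+1%:R^-1 * \1_(lay k j) x.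
have fkE k x : fk k x = k.+1%:R^-1 * count_below (k.+1 * k.+1) (k.+1%:R * f x).
  rewrite /fk -mulr_sumr; congr (_ * _); apply: eq_bigr => j _.
  rewrite indicE (_ : (x \in lay k j) = (j.+1%:R <= k.+1%:R * f x))//.
  by apply/idP/idP => [/set_mem|h]; [|apply/mem_set].
have k0 (k : nat) : 0 < k.+1%:R :> R by rewrite ltr0n.
have fkP k x : [/\ 0 <= fk k x, fk k x <= f x & f x <= k.+1%:R -> f x - k.+1%:R^-1 <= fk k x].
  have kf0 : 0 <= k.+1%:R * f x by rewrite mulr_ge0// ltW.
  have [c0 c1 c2] := count_belowP (k.+1 * k.+1) kf0.
  rewrite fkE; split.
  - by rewrite mulr_ge0// invr_ge0 ltW.
  - by rewrite ler_pdivrMl.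
  - move=> fx; rewrite ler_pdivlMl// mulrBr divff ?gt_eqF//; apply: c2.
    by rewrite natrM ler_pM2l.
have mfk k : measurable_fun setT (fk k).
  apply: measurable_sum => j; apply: measurable_funM; first exact: measurable_cst.
  exact: measurable_indic.
have ifk k : lam.-integrable setT (EFin \o fk k).
  apply: (le_integrable measurableT _ _ intf); first exact/measurable_EFinP.
  move=> x _ /=; rewrite lee_fin; have [c0 c1 _] := fkP k x.
  by rewrite !ger0_norm.
have nfk k : weak_null (fk k).
  rewrite /fk; have : forall N : nat, lam.-integrable setT
        (EFin \o (fun x => \sum_(j < N) k.+1%:R^-1 * \1_(lay k j) x)) /\
      weak_null (fun x => \sum_(j < N) k.+1%:R^-1 * \1_(lay k j) x).
    elim=> [|N [iN IHN]].
      have E : (fun x : T => \sum_(j < 0) k.+1%:R^-1 * \1_(lay k j) x : R) = cst 0.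
        by apply/funext => x; rewrite big_ord0.
      rewrite E; split; first exact: finite_measure_integrable_cst.
      rewrite /weak_null (_ : (fun n => _) = cst 0); first exact: cvg_cst.
      by apply/funext => n; rewrite /Rintegral integral0_eq// => x _; rewrite mul0r.
    have E : (fun x : T => \sum_(j < N.+1) k.+1%:R^-1 * \1_(lay k j) x : R) =
        (fun x : T => \sum_(j < N) k.+1%:R^-1 * \1_(lay k j) x + k.+1%:R^-1 * \1_(lay k N) x).
      by apply/funext => x; rewrite big_ord_recr.
    have iZ := integrableZl measurableT k.+1%:R^-1 (iindic (mlay k N)).
    rewrite E; split; first exact: (integrableD measurableT iN iZ).
    by apply: weak_nullD => //; [exact: iindic|exact: hA].
  by move=> /(_ (k.+1 * k.+1)%N)[].
apply: weak_null_approx => // e e0.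
have cv : (\int[lam]_x `|f x - fk k x|) @[k --> \oo] --> (0 : R).
  have [ig _ cv] : [/\ lam.-integrable setT (cst 0%E),
      ([sequence \int[lam]_x `|(`|f x - fk n x|)%:E - cst 0%E x|]_n @ \oo --> 0)%E &
      ([sequence \int[lam]_x (`|f x - fk n x|)%:E]_n @ \oo --> \int[lam]_x cst 0 x)%E].
    apply: (@dominated_convergence _ _ _ lam setT measurableT
      (fun n x => (`|f x - fk n x|)%:E) _ (EFin \o f)) => //.
    - move=> n; apply/measurable_EFinP; apply: measurableT_comp => //.
      exact: measurable_funB.
    - apply: aeW => x _; apply/fine_cvgP; split; first exact: nearW.
      apply/cvgrPdist_le => r r0.
      have [N1 hN1] := exists_nat_gt (f x); have [N2 hN2] := exists_nat_gt r^-1.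
      exists (maxn N1 N2) => // n /=; rewrite geq_max => /andP[nN1 nN2].
      have [c0 c1 c2] := fkP n x.
      rewrite sub0r normrN normr_id ger0_norm ?subr_ge0//.
      have : f x - n.+1%:R^-1 <= fk n x.
        by apply: c2; rewrite (le_trans (ltW hN1))// ler_nat leqW.
      have : n.+1%:R^-1 <= r.
        rewrite invf_ple ?posrE//; apply: (le_trans (ltW hN2)).
        by rewrite ler_nat leqW.
      by move: n.+1%:R^-1 (fk n x) (f x) => *; lra.
    - apply: aeW => x n _ /=; rewrite lee_fin normr_id; have [c0 c1 _] := fkP n x.
      by rewrite ger0_norm ?subr_ge0// gerBl.
  move: cv; rewrite integral0 => cv.
  by have := fine_cvg cv; apply.
have [N _ hN] := (@cvgrPdist_le _ _ _ _ _ _ _).1 cv _ e0.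
exists (fk N); split => //; have := hN N (leqnn _); rewrite /= sub0r normrN.
by apply: le_trans; exact: ler_norm.
Qed.

Lemma weak_null_integrable : (forall A, measurable A -> weak_null \1_A) ->
  forall f, lam.-integrable [set: T] (EFin \o f) -> weak_null f.
Proof.
move=> hA f intf; have mf : measurable_fun setT f.
  by apply/measurable_EFinP; exact: measurable_int intf.
have ipos (g : T -> R) : measurable_fun setT g -> (forall x, `|g x| = `|f x|) ->
    lam.-integrable setT (EFin \o (fun x => Order.max (g x) 0)).
  move=> mg gf; apply: (le_integrable measurableT _ _ intf).
    by apply/measurable_EFinP; apply: measurable_maxr => //; exact: measurable_cst.
  move=> x _ /=; rewrite lee_fin -gf ger0_norm ?le_max ?lexx ?orbT//.
  by rewrite ge_max ler_norm normr_ge0.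
have i1 := ipos f mf (fun=> erefl).
have i2 := ipos (\- f) (measurable_funN mf) (fun x => normrN (f x)).
have E : f = (fun x => Order.max (f x) 0 + (-1) * Order.max ((\- f) x) 0).
  apply/funext => x /=; rewrite mulN1r.
  by case: (leP (f x) 0) => h; rewrite /Order.max; case: ifPn; rewrite -?leNgt; lra.
rewrite E; apply: weak_nullD => //; apply: weak_null_ge0 => // x;
  by rewrite le_max lexx orbT.
Qed.

End weak_convergence.

Lemma two_geometric_lt (R : realType) (K1 K2 t1 t2 e : R) : 0 <= K1 -> 0 <= K2 ->
  0 <= t1 -> t1 < 1 -> 0 <= t2 -> t2 < 1 -> 0 < e ->
  exists N, forall n, (N <= n)%N -> K1 * t1 ^+ n + K2 * t2 ^+ n < e.
Proof.
move=> K10 K20 t10 t11 t20 t21 e0.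
have K0 : 0 < 2 * (K1 + K2 + 1) by rewrite mulr_gt0// ltr_wpDl// addr_ge0.
have s0 : 0 < e / (2 * (K1 + K2 + 1)) by rewrite divr_gt0.
have [N1 hN1] := geometric_lt t10 t11 s0.
have [N2 hN2] := geometric_lt t20 t21 s0.
exists (maxn N1 N2) => n; rewrite geq_max => /andP[nN1 nN2].
have l1 : t1 ^+ n < e / (2 * (K1 + K2 + 1)).
  by apply: le_lt_trans hN1; rewrite ler_wiXn2l// ltW.
have l2 : t2 ^+ n < e / (2 * (K1 + K2 + 1)).
  by apply: le_lt_trans hN2; rewrite ler_wiXn2l// ltW.
move: (t1 ^+ n) (t2 ^+ n) l1 l2 => u v.
set s := e / _ in s0 * => l1 l2.
have -> : e = 2 * (K1 + K2 + 1) * s by rewrite /s mulrCA divff ?mulr1// gt_eqF.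
have a1 := ler_wpM2l K10 (ltW l1); have a2 := ler_wpM2l K20 (ltW l2).
have a3 : 0 <= K1 * s by rewrite mulr_ge0// ltW.
have a4 : 0 <= K2 * s by rewrite mulr_ge0// ltW.
by clear -a1 a2 a3 a4 s0; move: s s0 a1 a2 a3 a4 => s *; lra.
Qed.

(** * Mixing along the backward orbit of one fiber *)

Section fiber_mixing.
Context d (Omega : measurableType d) (R : realType).
Variables (sigma sigmaV : Omega -> Omega) (B : blaschke_cocycle Omega R).
Local Notation C := R[i].
Local Notation m := (@haar R).
Variables (w : Omega) (x : C).
Hypothesis hx : backward_attractor sigma sigmaV B w x.
Variable A : set (circle R).
Hypothesis mA : measurable A.

Let x1 : normc x < 1.
Proof. by have [a [r [A' [k0 [n1 [[]]]]]]] := hx. Qed.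

Let Sn n := cocycle sigma (bcircle B) n (iter n sigmaV w).

Let p : R := fine (harmonic_measure x A).

Let psi n z : R := \1_A (Sn n z) - p.

Let pE : p = \int[m]_z (\1_A z * poisson x z).
Proof.
have iM (z : circle R) : `|\1_A z : R| <= 1.
  by rewrite indicE; case: (_ \in _); rewrite /= ?normr1 ?normr0.
have := @Rintegral_harmonic_measure _ x _ 1 (measurable_indic mA) iM.
rewrite to_discE// => <-; rewrite /p; symmetry.
exact: (Rintegral_indic (harmonic_measure x) mA).
Qed.

Let p01 : 0 <= p <= 1.
Proof.
have h1 : (harmonic_measure x A <= 1)%E by exact: probability_le1.
rewrite /p fine_ge0//= -lee_fin fineK// ge0_fin_numE//.
exact: le_lt_trans h1 (ltry _).
Qed.

Let mSn n : measurable_fun [set: circle R] (Sn n).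
Proof. exact: measurable_inner_map (inner_map_cocycle sigma B n (iter n sigmaV w)). Qed.

Let mind n : measurable_fun [set: circle R] (fun z => \1_A (Sn n z) : R).
Proof. exact: (measurableT_comp (@measurable_indic _ _ R setT _ mA) (mSn n)). Qed.

Let mpsi n : measurable_fun [set: circle R] (psi n).
Proof. by apply: measurable_funB; [exact: mind|exact: measurable_cst]. Qed.

Let psi1 n z : `|psi n z| <= 1.
Proof.
have /andP[p0 p1] := p01; rewrite ler_norml /psi indicE.
by case: (_ \in _); rewrite /=; apply/andP; split; lra.
Qed.

Let weak_null_lipschitz (f : circle R -> R) (K : R) :
  measurable_fun [set: circle R] f -> (forall z, 0 <= f z <= 1) -> 0 <= K ->
  chord_lipschitz K f -> weak_null m psi f.
Proof.
move=> mf f01 K0 fK.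
have fM z : `|f z| <= 1 by have /andP[? ?] := f01 z; rewrite ger0_norm.
pose fN : circle R -> R := fun z => - f z.
have mfN : measurable_fun setT fN by exact: measurable_funN.
have fNM z : `|fN z| <= 1 by rewrite /fN normrN.
have fNK : chord_lipschitz K fN.
  by move=> y z; rewrite /fN -opprD normrN; exact: fK.
have [K1 [t1 [n1 [K10 t10 t11 h1]]]] :=
  random_mass_le hx (majorizable_lipschitz mf fM K0 fK).
have [K2 [t2 [n2 [K20 t20 t21 h2]]]] :=
  random_mass_le hx (majorizable_lipschitz mfN fNM K0 fNK).
have i01 (z : circle R) : 0 <= (\1_A z : R) <= 1.
  by rewrite indicE; case: (_ \in _); rewrite /= ?lexx ?ler01.
have iA : m.-integrable setT (EFin \o (\1_A : circle R -> R)).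
  apply: (bounded_integrable m (M := 1)) => [|z]; first exact: measurable_indic.
  by have /andP[? ?] := i01 z; rewrite ger0_norm.
have G0 : 0 <= \int[m]_z (\1_A z : R).
  by apply: Rintegral_ge0 => z _; have /andP[] := i01 z.
have G1 : \int[m]_z (\1_A z : R) <= 1.
  rewrite -[leRHS](Rintegral_haar_cst 1); apply: (le_Rintegral measurableT iA).
    exact: finite_measure_integrable_cst.
  by move=> z _; have /andP[] := i01 z.
have intf := bounded_integrable m mf fM.
have mfi n : measurable_fun setT (fun z => f z * \1_A (Sn n z)).
  exact: (measurable_funM mf (mind n)).
have ifi n : m.-integrable setT (EFin \o (fun z => f z * \1_A (Sn n z))).
  apply: (bounded_integrable m (mfi n) (M := 1 * 1)) => z.
  rewrite normrM; apply: ler_pM => //; have /andP[? ?] := i01 (Sn n z).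
  by rewrite ger0_norm.
have E n : \int[m]_z (f z * psi n z) =
    \int[m]_z (f z * \1_A (Sn n z)) - (\int[m]_z f z) * p.
  have iZ := integrableZl measurableT p intf.
  rewrite mulrC -(RintegralZl p measurableT intf) -(RintegralB measurableT (ifi n) iZ).
  by apply: eq_Rintegral => z _; rewrite /psi mulrBr [p * _]mulrC.
have EN n : \int[m]_z (fN z * \1_A (Sn n z)) = - \int[m]_z (f z * \1_A (Sn n z)).
  rewrite -mulN1r -(RintegralZl _ measurableT (ifi n)).
  by apply: eq_Rintegral => z _; rewrite mulN1r mulNr.
have EN' : \int[m]_z fN z = - \int[m]_z f z.
  rewrite -mulN1r -(RintegralZl _ measurableT intf).
  by apply: eq_Rintegral => z _; rewrite mulN1r.
have bound n : (n1 <= n)%N -> (n2 <= n)%N ->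
    `|\int[m]_z (f z * psi n z)| <= K1 * t1 ^+ n + K2 * t2 ^+ n.
  move=> nn1 nn2.
  have b1 := h1 n \1_A nn1 (measurable_indic mA) i01.
  have b2 := h2 n \1_A nn2 (measurable_indic mA) i01.
  rewrite -/(Sn n) -pE in b1; rewrite -/(Sn n) -pE EN EN' in b2.
  have e1 : 0 <= K1 * t1 ^+ n by rewrite mulr_ge0 ?exprn_ge0 ?(ltW t10).
  have e2 : 0 <= K2 * t2 ^+ n by rewrite mulr_ge0 ?exprn_ge0 ?(ltW t20).
  have g1 := ler_piMr e1 G1; have g2 := ler_piMr e2 G1.
  rewrite mulNr in b2; rewrite E; clear -b1 b2 g1 g2 e1 e2.
  move: b1 b2 g1 g2 e1 e2; move: (\int[m]_z (f z * _)) ((\int[m]_z f z) * p) (\int[m]_z (\1_A z : R))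
    (K1 * t1 ^+ n) (K2 * t2 ^+ n) => I J G u v b1 b2 g1 g2 e1 e2.
  by rewrite ler_norml; apply/andP; split; lra.
apply/cvgrPdist_lt => e e0.
have [N hN] := two_geometric_lt K10 K20 (ltW t10) t11 (ltW t20) t21 e0.
exists (maxn (maxn n1 n2) N) => // n /=.
rewrite !geq_max => /andP[/andP[nn1 nn2] nN].
by rewrite sub0r normrN; apply: (le_lt_trans (bound n nn1 nn2)); exact: hN.
Qed.

(** The exponential estimate holds for Lipschitz functions, of either sign. It reaches the
    indicators of open sets by approximation in L^1, and all measurable sets because the open sets
    generate and are stable under intersection. *)
Lemma fiber_mixing U : measurable U ->
  weak_null m (fun n z => \1_A (cocycle sigma (bcircle B) n (iter n sigmaV w) z) -
    fine (harmonic_measure x A)) \1_U.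
Proof.
move=> mU; apply: (weak_null_measurable mpsi psi1 (C := @circle_open R)) => //.
- move=> _ _ [V oV <-] [W oW <-]; exists (V `&` W); first exact: openI.
  by rewrite !setTI preimage_setI.
- by exists setT; [exact: openT|rewrite setTI preimage_setT].
- move=> _ [V oV <-]; rewrite setTI.
  have [f [mf f01 fL fc]] := open_lipschitz_approx oV.
  have mV : measurable (@circle_val R @^-1` V).
    by apply: sub_sigma_algebra; exists V => //; rewrite setTI.
  have iV : m.-integrable setT (EFin \o (\1_(@circle_val R @^-1` V) : circle R -> R)).
    apply: (bounded_integrable m (M := 1)) => [|z]; first exact: measurable_indic.
    by rewrite indicE; case: (_ \in _); rewrite /= ?normr1 ?normr0.
  have fM n z : `|f n z| <= 1 by have /andP[? ?] := f01 n z; rewrite ger0_norm.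
  apply: (weak_null_approx mpsi psi1) => // e e0.
  have cv : \int[m]_z `|\1_(@circle_val R @^-1` V) z - f n z| @[n --> \oo] -->
      \int[m]_z (cst 0 z : R).
    apply: (bounded_convergence (M := 1)).
    - move=> n; apply: measurableT_comp => //; apply: measurable_funB => //.
    - exact: measurable_cst.
    - move=> n z; rewrite normr_id indicE; have /andP[? ?] := f01 n z.
      by rewrite ler_norml; case: (_ \in _); rewrite /=; apply/andP; split; lra.
    - apply: aeW => z; apply/cvgrPdist_le => r r0.
      have [N _ hN] := (@cvgrPdist_le _ _ _ _ _ _ _).1 (fc z) _ r0.
      exists N => // n /hN; by rewrite /= sub0r normrN normr_id.
  rewrite Rintegral_haar_cst in cv.
  have [N _ hN] := (@cvgrPdist_le _ _ _ _ _ _ _).1 cv _ e0.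
  exists (f N); split.
  - exact: bounded_integrable (mf N) (fM N).
  - exact: (weak_null_lipschitz (mf N) (f01 N) (ler0n _ _) (fL N)).
  - have := hN N (leqnn _); rewrite /= sub0r normrN; apply: le_trans; exact: ler_norm.
Qed.

End fiber_mixing.

(** * Measures on the product from measurable families on the fibers *)

Section fiber_measure.
Context d d' (X : measurableType d) (Y : measurableType d') (R : realType).
Variables (P : probability X R) (k_ : X -> probability Y R).
Hypothesis mk : forall A, measurable A -> measurable_fun [set: X] (fun w => k_ w A).

Let kern : X -> {measure set Y -> \bar R} := fun w => k_ w.

HB.instance Definition _ := @isKernel.Build _ _ X Y R kern mk.

Let kern1 w : kern w [set: Y] = 1%E. Proof. exact: probability_setT. Qed.

HB.instance Definition _ := @Kernel_isProbability.Build _ _ X Y R kern kern1.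

Lemma measurable_xsection_kernel (A : set (X * Y)) : measurable A ->
  measurable_fun [set: X] (fun w => k_ w (xsection A w)).
Proof.
by move=> mA; apply: (measurable_fun_xsection_finite_kernel kern); rewrite inE.
Qed.

(** The measurability proof is an argument so that the measure structure, whose construction depends
    on it, can be attached to the term itself. *)
Definition fiber_measure of (forall A, measurable A ->
    measurable_fun [set: X] (fun w => k_ w A)) : set (X * Y) -> \bar R :=
  fun A => (\int[P]_w k_ w (xsection A w))%E.

Local Notation nu := (fiber_measure mk).

Let fiber_measure0 : nu set0 = 0%E.
Proof. by rewrite /fiber_measure integral0_eq// => w _; rewrite xsection0. Qed.

Let fiber_measure_ge0 A : (0 <= nu A)%E.
Proof. by apply: integral_ge0. Qed.

Let fiber_measure_sigma_additive : semi_sigma_additive nu.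
Proof.
move=> F mF tF mUF.
rewrite [X in _ --> X](_ : _ = \sum_(n <oo) nu (F n))%E.
  by apply: is_cvg_nneseries => n _ _; exact: fiber_measure_ge0.
rewrite /fiber_measure -integral_nneseries//; last first.
  by move=> n; exact: measurable_xsection_kernel.
apply: eq_integral => w _; rewrite xsection_bigcup.
apply/esym/cvg_lim => //; apply: measure_semi_sigma_additive.
- by move=> n; exact: measurable_xsection.
- exact: trivIset_xsection.
- by apply: bigcup_measurable => n _; exact: measurable_xsection.
Qed.

HB.instance Definition _ := isMeasure.Build _ _ _ nu
  fiber_measure0 fiber_measure_ge0 fiber_measure_sigma_additive.

Let fiber_measure_setT : nu [set: X * Y] = 1%E.
Proof.
rewrite /fiber_measure.
rewrite (eq_integral (cst 1%E)) ?integral_cst//= ?probability_setT ?mule1//.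
move=> w _; rewrite -(probability_setT (k_ w)); congr (k_ w _).
by apply/seteqP; split=> y //= _; rewrite /xsection/= in_setT.
Qed.

HB.instance Definition _ := @Measure_isProbability.Build _ _ R nu fiber_measure_setT.

Lemma fiber_measure_ae (A : set (X * Y)) (g : X -> \bar R) : measurable A ->
  measurable_fun [set: X] g -> (forall w, 0 <= g w)%E ->
  {ae P, forall w, k_ w (xsection A w) = g w} -> nu A = (\int[P]_w g w)%E.
Proof.
move=> mA mg g0 h; apply: ge0_ae_eq_integral => //.
  exact: measurable_xsection_kernel.
by apply: filterS h => w.
Qed.

Lemma fiber_measure_dominated (m : {sigma_finite_measure set Y -> \bar R}) :
  {ae P, forall w, k_ w `<< m} -> nu `<< (P \x m)%E.
Proof.
move=> hk; apply/null_content_dominatesP => A mA.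
rewrite /product_measure1/= => A0.
have mmA : measurable_fun [set: X] (fun w => m (xsection A w)).
  exact: measurable_fun_xsection.
have /(ae_eq_integral_abs P measurableT mmA) h :
    (\int[P]_w `|m (xsection A w)| = 0)%E.
  rewrite -[RHS]A0; apply: eq_integral => w _; rewrite gee0_abs//.
rewrite (@fiber_measure_ae A (cst 0%E))//; first exact: integral0.
apply: filterS2 h hk => w /(_ I) mA0 /null_content_dominatesP; apply => //.
exact: measurable_xsection.
Qed.

Lemma fiber_measure_fst (q : X -> R) (M : R) : measurable_fun [set: X] q ->
  (forall w, `|q w| <= M) -> \int[nu]_p q p.1 = \int[P]_w q w.
Proof.
move=> mq qM.
have PE A : measurable A -> P A = nu (fst @^-1` A).
  move=> mA; rewrite -{1}[A]setIT -integral_indic// /fiber_measure.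
  apply: eq_integral => w _; rewrite indicE.
  have E : xsection (fst @^-1` A) w = if w \in A then [set: Y] else set0 :> set Y.
    apply/seteqP; split=> y; rewrite /xsection/= inE/=.
      by move=> /mem_set ->.
    by case: ifPn => // /set_mem.
  by rewrite E; case: ifPn => _; [rewrite probability_setT|rewrite measure0].
by rewrite (Rintegral_transport measurable_fst PE mq).
Qed.

End fiber_measure.

Lemma Rintegral_prod d1 d2 (X : measurableType d1) (Y : measurableType d2)
    (R : realType) (m1 : {finite_measure set X -> \bar R})
    (m2 : {finite_measure set Y -> \bar R}) (f : X * Y -> R) (M : R) :
  measurable_fun [set: X * Y] f -> (forall p, `|f p| <= M) ->
  \int[(m1 \x m2)%E]_p f p = \int[m1]_x \int[m2]_y f (x, y).
Proof.
move=> mf fM.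
have intf : (m1 \x m2)%E.-integrable [set: X * Y] (EFin \o f).
  apply: measurable_bounded_integrable => //.
    rewrite -setXTT [X in (X < _)%E](_ : _ = m1 setT * m2 setT)%E.
      by rewrite lte_mul_pinfty// ?fin_num_measure// -ge0_fin_numE// fin_num_measure.
    exact: product_measure1E.
  exists M; split; first exact: num_real.
  by move=> x Mx y _; exact: le_trans (fM y) (ltW Mx).
rewrite /Rintegral -(integral12_prod_meas1 intf); congr fine.
apply: eq_integral => x _; rewrite /fubini_F fineK//.
apply: integrable_fin_num => //; apply: (bounded_integrable m2 (M := M)) => //.
exact: (measurableT_comp mf).
Qed.

Lemma xsection_setX d1 d2 (X : measurableType d1) (Y : measurableType d2)
    (A : set X) (B : set Y) x :
  xsection (A `*` B) x = if x \in A then B else set0.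
Proof. by case: ifPn => h; [rewrite in_xsectionX|rewrite notin_xsectionX]. Qed.

(** * Mixing of the skew product and uniqueness of the invariant measure *)

Section uniqueness.
Context d (Omega : measurableType d) (R : realType) (P : probability Omega R).
Variables (sigma sigmaV : Omega -> Omega) (B : blaschke_cocycle Omega R).
Hypothesis hsigma : invertible_mpt P sigma sigmaV.
Local Notation C := R[i].
Local Notation m := (@haar R).
Variable x : Omega -> C.
Hypothesis x1 : forall w, normc (x w) < 1.
Hypothesis mx : cmeasurable [set: Omega] x.

Lemma measurable_harmonic_measure A : measurable A ->
  measurable_fun [set: Omega] (fun w => harmonic_measure (x w) A).
Proof.
move=> mA.
pose f (p : Omega * circle R) : \bar R := (poisson (x p.1) p.2 * \1_A p.2)%:E.
have mf : measurable_fun setT f.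
  apply/measurable_EFinP; apply: measurable_funM.
    apply: measurable_poisson2; last exact: measurable_snd.
    exact: (cmeasurable_comp mx measurable_fst).
  exact: (measurableT_comp (@measurable_indic _ _ R setT _ mA) measurable_snd).
have f0 p : (0 <= f p)%E by rewrite lee_fin mulr_ge0// poisson_ge0.
have := measurable_fun_fubini_tonelli_F (m2 := m) f mf f0.
apply: eq_measurable_fun => w _.
rewrite /fubini_F /harmonic_measure to_discE// [RHS]integral_mkcond.
apply: eq_integral => z _; rewrite patchE /f/= indicE.
by case: ifPn => _; rewrite ?mulr1 ?mulr0.
Qed.

Hypothesis hx : {ae P, forall w, backward_attractor sigma sigmaV B w (x w)}.
Variable nu_ : Omega -> probability (circle R) R.
Hypothesis mnu : forall A, measurable A ->
  measurable_fun [set: Omega] (fun w => nu_ w A).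
Hypothesis nu_inv : {ae P, forall w, forall A, measurable A ->
  nu_ w (bcircle B w @^-1` A) = nu_ (sigma w) A}.
Hypothesis nu_ac : {ae P, forall w, nu_ w `<< m}.

Local Notation nu := (fiber_measure P mnu).
Local Notation mu := (fiber_measure P measurable_harmonic_measure).
Local Notation lam := ((P \x m)%E : probability (Omega * circle R)%type R).
Local Notation Tn n := (cocycle sigma (bcircle B) n).

Let measurable_iter_sigma n : measurable_fun [set: Omega] (iter n sigma).
Proof.
elim: n => [|n IHn]; first exact: measurable_id.
by apply: measurableT_comp => //; exact: measurable_sigma hsigma.
Qed.

Let iter_sigma_mpt n A : measurable A -> P A = P (iter n sigma @^-1` A).
Proof.
elim: n A => [//|n IHn] A mA.
have msA : measurable (sigma @^-1` A).
  by rewrite -[X in measurable X]setTI; exact: measurable_sigma hsigma _ _ mA.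
by rewrite -(sigma_mpt hsigma mA) (IHn _ msA).
Qed.

Let iter_sigmaK n w : iter n sigma (iter n sigmaV w) = w.
Proof.
have [_ K _ _ _] := hsigma.
by elim: n w => [//|n IHn] w; rewrite iterSr /= K IHn.
Qed.

Let measurable_iter_sigmaV n : measurable_fun [set: Omega] (iter n sigmaV).
Proof.
elim: n => [|n IHn]; first exact: measurable_id.
by apply: measurableT_comp => //; exact: measurable_sigmaV hsigma.
Qed.

Let iter_sigmaV_mpt n A : measurable A -> P A = P (iter n sigmaV @^-1` A).
Proof.
elim: n A => [//|n IHn] A mA.
have msA : measurable (sigmaV @^-1` A).
  by rewrite -[X in measurable X]setTI; exact: measurable_sigmaV hsigma _ _ mA.
by rewrite -(sigmaV_mpt hsigma mA) (IHn _ msA).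
Qed.

Let measurable_Tn n :
  measurable_fun [set: Omega * circle R] (fun p => Tn n p.1 p.2).
Proof.
elim: n => [|n IHn] /=; first exact: measurable_snd.
apply: measurable_skew => //.
exact: (measurableT_comp (measurable_iter_sigma n) measurable_fst).
Qed.

Let nu_inv_iter : {ae P, forall w, forall n A, measurable A ->
  nu_ w (Tn n w @^-1` A) = nu_ (iter n sigma w) A}.
Proof.
have := ae_comp_mpt_iter (measurable_sigma hsigma) (sigma_mpt hsigma) nu_inv.
apply: filterS => w h; elim=> [//|n IHn] A mA.
rewrite -(h n A mA) -IHn//.
by rewrite -[X in measurable X]setTI; exact: measurable_bcircle.
Qed.

Section rectangle.
Variables (E : set Omega) (A : set (circle R)).
Hypotheses (mE : measurable E) (mA : measurable A).

Let q w : R := \1_E w * fine (harmonic_measure (x w) A).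

(** The indicator of the rectangle along the orbit, minus the fiberwise mass that mu gives it. Under
    any invariant measure with marginal P its integral does not depend on n, whereas with respect to
    [P \x m] it tends weakly to 0. *)
Let psi n (p : Omega * circle R) : R :=
  \1_E (iter n sigma p.1) * \1_A (Tn n p.1 p.2) - q (iter n sigma p.1).

Let indic01 (T : Type) (D : set T) t : 0 <= (\1_D t : R) <= 1.
Proof. by rewrite indicE; case: (_ \in _); rewrite /= ?lexx ?ler01. Qed.

Let harm01 w : 0 <= fine (harmonic_measure (x w) A) <= 1.
Proof.
have h1 : (harmonic_measure (x w) A <= 1)%E by exact: probability_le1.
rewrite fine_ge0//= -lee_fin fineK// ge0_fin_numE//.
exact: le_lt_trans h1 (ltry _).
Qed.

Let q01 w : 0 <= q w <= 1.
Proof.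
have /andP[? ?] := harm01 w; have /andP[? ?] := indic01 E w.
by rewrite /q mulr_ge0//= mulr_ile1.
Qed.

Let mq : measurable_fun [set: Omega] q.
Proof.
apply: measurable_funM; first exact: measurable_indic.
apply: (measurableT_comp (fine_measurable measurableT)).
exact: measurable_harmonic_measure.
Qed.

Let mB n : measurable [set p | iter n sigma p.1 \in E /\ Tn n p.1 p.2 \in A].
Proof.
have h1 : measurable ((iter n sigma \o @fst Omega (circle R)) @^-1` E).
  rewrite -[X in measurable X]setTI.
  exact: (measurableT_comp (measurable_iter_sigma n) measurable_fst).
have h2 : measurable ((fun p => Tn n p.1 p.2) @^-1` A).
  by rewrite -[X in measurable X]setTI; exact: measurable_Tn.
apply: (eq_ind _ measurable (measurableI _ _ h1 h2)).
by apply/seteqP; split=> p /=; rewrite !inE.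
Qed.

Let phi n (p : Omega * circle R) : R :=
  \1_E (iter n sigma p.1) * \1_A (Tn n p.1 p.2).

Let phiE n : phi n = \1_[set p | iter n sigma p.1 \in E /\ Tn n p.1 p.2 \in A].
Proof.
apply/funext => p; rewrite /phi !indicE -natrM mulnb; congr (nat_of_bool _)%:R.
by apply/andP/idP => [[h1 h2]|/set_mem[]//]; apply/mem_set.
Qed.

Let mphi n : measurable_fun setT (phi n).
Proof. by rewrite phiE; exact: measurable_indic. Qed.

Let mpsi n : measurable_fun setT (psi n).
Proof.
apply: measurable_funB; first exact: mphi.
apply: (measurableT_comp mq).
exact: (measurableT_comp (measurable_iter_sigma n) measurable_fst).
Qed.

Let psi1 n p : `|psi n p| <= 1.
Proof.
have /andP[a0 a1] := q01 (iter n sigma p.1).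
have /andP[b0 b1] := indic01 E (iter n sigma p.1).
have /andP[c0 c1] := indic01 A (Tn n p.1 p.2).
have d0 := mulr_ge0 b0 c0; have d1 := mulr_ile1 b0 c0 b1 c1.
rewrite /psi; move: (_ * _) (q _) a0 a1 d0 d1 => u v *.
by rewrite ler_norml; apply/andP; split; lra.
Qed.

Let integral_phi n : \int[nu]_p phi n p = fine (nu (E `*` A)).
Proof.
rewrite phiE Rintegral_indic//; congr fine.
pose k w := nu_ w (xsection (E `*` A) w).
have mk : measurable_fun setT k.
  by apply: measurable_xsection_kernel => //; exact: measurableX.
have k0 w : (0 <= k w)%E by exact: measure_ge0.
have kT := ge0_integral_transport (measurable_iter_sigma n) (@iter_sigma_mpt n) mk k0.
apply: etrans (esym kT).
apply: (fiber_measure_ae mnu (mB n)).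
- exact: (measurableT_comp mk (measurable_iter_sigma n)).
- by move=> w; exact: k0.
- apply: filterS nu_inv_iter => w h; rewrite /k/= xsection_setX.
  have -> : xsection [set p | iter n sigma p.1 \in E /\ Tn n p.1 p.2 \in A] w =
      if iter n sigma w \in E then Tn n w @^-1` A else set0.
    apply/seteqP; split=> z; rewrite /xsection/= inE/=.
      by move=> [-> /set_mem].
    by case: ifPn => // _ h'; split => //; exact/mem_set.
  by case: ifPn => _; rewrite ?measure0// h.
Qed.

Let integral_q n : \int[nu]_p q (iter n sigma p.1) = fine (mu (E `*` A)).
Proof.
have qM w : `|q w| <= 1 by have /andP[? ?] := q01 w; rewrite ger0_norm.
have mqn := measurableT_comp mq (measurable_iter_sigma n).
apply: (etrans (fiber_measure_fst P mnu mqn (fun w => qM _))).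
rewrite -(Rintegral_transport (measurable_iter_sigma n) (@iter_sigma_mpt n) mq).
congr fine; apply: eq_integral => w _; rewrite xsection_setX /q indicE.
case: ifPn => _; last by rewrite mul0r measure0.
rewrite mul1r fineK// ge0_fin_numE//.
have h1 : (harmonic_measure (x w) A <= 1)%E by exact: probability_le1.
exact: le_lt_trans h1 (ltry _).
Qed.

Let weak_null_psi G : measurable G -> weak_null lam psi \1_G.
Proof.
apply: (weak_null_measurable mpsi psi1 (C :=
  [set A `*` B | A in measurable & B in measurable])).
- move=> _ _ [E1 mE1 [A1 mA1 <-]] [E2 mE2 [A2 mA2 <-]].
  exists (E1 `&` E2); first exact: measurableI.
  by exists (A1 `&` A2); [exact: measurableI|rewrite setXI].
- exact: measurable_prod_measurableType.
- by exists setT => //; exists setT => //; rewrite setXTT.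
move=> _ [E' mE' [U mU <-]].
pose F n (p : Omega * circle R) := \1_U p.2 * psi n p.
have mF n : measurable_fun setT (F n).
  apply: measurable_funM; last exact: mpsi.
  exact: (measurableT_comp (@measurable_indic _ _ R setT _ mU) measurable_snd).
have F1 n p : `|F n p| <= 1.
  rewrite normrM; have /andP[? ?] := indic01 U p.2.
  by rewrite ger0_norm// mulr_ile1.
pose I n w := \int[m]_z F n (w, z).
have mI n : measurable_fun setT (I n).
  exact: (@measurable_Rintegral1 _ _ _ _ _ P m (F n) 1 (mF n) (F1 n)).
have I1 n w : `|I n w| <= 1.
  apply: normr_Rintegral_le => [|z]; last exact: F1.
  exact: (measurableT_comp (mF n)).
have mIV n : measurable_fun setT (fun w => `|I n (iter n sigmaV w)|).
  apply: measurableT_comp => //.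
  exact: measurableT_comp (mI n) (measurable_iter_sigmaV n).
(* Fiber mixing concerns orbits that end at a fixed fiber w, hence start at [iter n sigmaV w].
   Moving the base point there does not change the integral over the base. *)
have cv : \int[P]_w `|I n (iter n sigmaV w)| @[n --> \oo] --> \int[P]_w cst 0 w.
  apply: (bounded_convergence (M := 1)) => //.
    by move=> n w; rewrite normr_id.
  apply: filterS hx => w hw.
  have := fiber_mixing hw mA mU; rewrite /weak_null => hm.
  have E0 n : I n (iter n sigmaV w) = \1_E w * \int[m]_z (\1_U z *
      (\1_A (Tn n (iter n sigmaV w) z) - fine (harmonic_measure (x w) A))).
    rewrite -RintegralZl//; last first.
      apply: (bounded_integrable m (M := 1)) => [|z].
        apply: measurable_funM; first exact: measurable_indic.
        apply: measurable_funB; last exact: measurable_cst.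
        apply: (measurableT_comp (@measurable_indic _ _ R setT _ mA)).
        exact: measurable_inner_map (inner_map_cocycle sigma B n _).
      rewrite normrM; have /andP[? ?] := indic01 U z.
      rewrite ger0_norm// mulr_ile1// ler_norml.
      have /andP[? ?] := harm01 w; have /andP[? ?] := indic01 A (Tn n (iter n sigmaV w) z).
      by apply/andP; split; lra.
    apply: eq_Rintegral => z _; rewrite /F /psi /q/= iter_sigmaK.
    by rewrite -mulrBr mulrCA.
  apply/cvgrPdist_le => e e0.
  have [N _ hN] := (@cvgrPdist_le _ _ _ _ _ _ _).1 hm _ e0.
  exists N => // n /hN /=; rewrite !sub0r !normrN normr_id E0 normrM.
  apply: le_trans; have /andP[? ?] := indic01 E w.
  by rewrite ger0_norm// ler_piMl.
rewrite Rintegral_cst// mul0r in cv.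
apply/cvgrPdist_le => e e0.
have [N _ hN] := (@cvgrPdist_le _ _ _ _ _ _ _).1 cv _ e0.
exists N => // n /hN /=; rewrite !sub0r !normrN; apply: le_trans.
have mG : measurable_fun setT (fun p : Omega * circle R => \1_(E' `*` U) p * psi n p).
  apply: measurable_funM; last exact: mpsi.
  by apply: measurable_indic; exact: measurableX.
have G1 p : `|\1_(E' `*` U) p * psi n p| <= 1.
  rewrite normrM; have /andP[? ?] := indic01 (E' `*` U) p.
  by rewrite ger0_norm// mulr_ile1.
have GI w : \int[m]_z (\1_(E' `*` U) (w, z) * psi n (w, z)) = \1_E' w * I n w.
  rewrite -RintegralZl//; last first.
    apply: (bounded_integrable m (M := 1)) => [|z]; last exact: F1.
    exact: (measurableT_comp (mF n)).
  apply: eq_Rintegral => z _; rewrite /F mulrA; congr (_ * _).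
  by rewrite !indicE in_setX -natrM mulnb.
have Epr : \int[lam]_p (\1_(E' `*` U) p * psi n p) = \int[P]_w (\1_E' w * I n w).
  apply: (etrans (@Rintegral_prod _ _ _ _ _ P m _ 1 mG G1)).
  by apply: eq_Rintegral => w _; exact: GI.
rewrite Epr.
have iI : P.-integrable setT (EFin \o (fun w => `|I n w|)).
  apply: (bounded_integrable P (M := 1)) => [|w]; last by rewrite normr_id.
  by apply: measurableT_comp => //.
have iEI : P.-integrable setT (EFin \o (fun w => \1_E' w * I n w)).
  apply: (bounded_integrable P (M := 1)) => [|w].
    by apply: measurable_funM => //; exact: measurable_indic.
  rewrite normrM; have /andP[? ?] := indic01 E' w.
  by rewrite ger0_norm// mulr_ile1.
apply: (le_trans (le_normr_Rintegral measurableT iEI)).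
have mnI : measurable_fun setT (fun w => `|I n w|) by apply: measurableT_comp => //.
have -> : `|\int[P]_w `|I n (iter n sigmaV w)| | = \int[P]_w `|I n w|.
  rewrite ger0_norm; last by apply: Rintegral_ge0.
  exact: esym (Rintegral_transport (measurable_iter_sigmaV n) (@iter_sigmaV_mpt n) mnI).
apply: (le_Rintegral measurableT) => //; first exact: (integrable_norm iEI).
move=> w _; rewrite normrM; have /andP[? ?] := indic01 E' w.
by rewrite ger0_norm// ler_piMl.
Qed.

(** The integral of [psi n] under nu is the difference of the two masses, for every n by invariance.
    It is also the integral of [psi n] against the fixed density of nu with respect to [P \x m],
    which tends to 0. *)
Lemma fiber_measure_unique_rectangle : nu (E `*` A) = mu (E `*` A).
Proof.
have dom : nu `<< lam by exact: fiber_measure_dominated nu_ac.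
pose rn := Radon_Nikodym (charge_of_finite_measure nu) lam.
have irn : lam.-integrable setT rn by exact: Radon_Nikodym_integrable.
have rnf p : rn p \is a fin_num by exact: Radon_Nikodym_fin_num.
pose f p := fine (rn p).
have fE : EFin \o f = rn by apply/funext => p; rewrite /f/= fineK.
have intf : lam.-integrable setT (EFin \o f) by rewrite fE.
have cov n : \int[nu]_p psi n p = \int[lam]_p (f p * psi n p).
  have ipsi : nu.-integrable setT (EFin \o psi n).
    by apply: bounded_integrable (mpsi n) (psi1 n).
  have := Radon_Nikodym_change_of_variables dom measurableT ipsi.
  move=> h; rewrite /Rintegral -[X in fine X = _]h; congr fine.
  apply: eq_integral => p _; rewrite -/rn -fE /= -EFinM mulrC //.
have E0 n : \int[nu]_p psi n p = fine (nu (E `*` A)) - fine (mu (E `*` A)).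
  rewrite -(integral_phi n) -(integral_q n).
  have i1 : nu.-integrable setT (EFin \o phi n).
    apply: (bounded_integrable nu (M := 1)) => [|p]; first exact: mphi.
    by rewrite phiE; have /andP[? ?] := indic01 [set p | iter n sigma p.1 \in E /\ Tn n p.1 p.2 \in A] p; rewrite ger0_norm.
  have i2 : nu.-integrable setT (EFin \o (fun p => q (iter n sigma p.1))).
    apply: (bounded_integrable nu (M := 1)) => [|p].
      apply: (measurableT_comp mq).
      exact: (measurableT_comp (measurable_iter_sigma n) measurable_fst).
    by have /andP[? ?] := q01 (iter n sigma p.1); rewrite ger0_norm.
  by rewrite -(RintegralB measurableT i1 i2).
have fm : nu (E `*` A) \is a fin_num by exact: fin_num_measure (measurableX mE mA).
have fm' : mu (E `*` A) \is a fin_num by exact: fin_num_measure (measurableX mE mA).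
suff : fine (nu (E `*` A)) - fine (mu (E `*` A)) = 0.
  by move=> /eqP; rewrite subr_eq0 => /eqP h; rewrite -(fineK fm) -(fineK fm') h.
have h := weak_null_integrable mpsi psi1 weak_null_psi intf.
apply: (cvg_unique (@Rhausdorff R) _ h).
rewrite (_ : (fun n => _) = cst (fine (nu (E `*` A)) - fine (mu (E `*` A)))).
  exact: cvg_cst.
by apply/funext => n; rewrite -cov E0.
Qed.

End rectangle.

Lemma fiber_measure_unique D : measurable D -> nu D = mu D.
Proof.
apply: (measure_unique [set A `*` B | A in measurable & B in measurable]
  (fun=> setT)).
- exact: measurable_prod_measurableType.
- move=> _ _ [E1 mE1 [A1 mA1 <-]] [E2 mE2 [A2 mA2 <-]].
  exists (E1 `&` E2); first exact: measurableI.
  by exists (A1 `&` A2); [exact: measurableI|rewrite setXI].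
- by move=> _; exists setT => //; exists setT => //; rewrite setXTT.
- by rewrite bigcup_const.
- by move=> _ [E mE [A mA <-]]; exact: fiber_measure_unique_rectangle.
- by move=> _; rewrite -ge0_fin_numE//; exact: fin_num_measure.
Qed.

End uniqueness.

Theorem theorem1p2 (R : realType) (d : measure_display)
    (Omega : measurableType d) (P : probability Omega R)
    (sigma sigmaV : Omega -> Omega) (B : blaschke_cocycle Omega R)
    (hsigma : invertible_mpt P sigma sigmaV) (herg : ergodic P sigma)
    (hadm : admissible B P) :
  exists (mu : {measure set (Omega * circle R) -> \bar R})
         (mu_ : Omega -> probability (circle R) R),
    let h := density mu_ in
    let L := fun w => transfer (bcircle B w) in
    [/\ random_acim P sigma B mu mu_,
        (forall nu nu_, random_acim P sigma B nu nu_ ->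
          forall A, measurable A -> nu A = mu A),
        (exists x : Omega -> R[i],
          [/\ (forall w, normc (x w) < 1),
              measurable_fun [set: Omega] (x : Omega -> borelC R),
              {ae P, forall w,
                (forall z, normc z < 1 ->
                  cocycle sigma (bmap B) n (iter n sigmaV w) z
                    @[n --> \oo] --> x w) /\
                ae_eq (@haar R) [set: circle R] (h w) (EFin \o poisson (x w))} &
              {ae P, forall w,
                ae_eq (@haar R) [set: circle R] (L w (h w)) (h (sigma w))}]) &
        {ae P, forall w, forall hs : circle R -> R,
          (circle_var hs < +oo)%E ->
          {ae @haar R, forall z, 0 <= hs z} ->
          ('N[@haar R]_1[EFin \o hs] = 1)%E ->
          exists (n0 : nat) (r : R), r < 1 /\
            forall n, (n0 <= n)%N ->
              ('N[@haar R]_+oo[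
                 cocycle sigma L n (iter n sigmaV w) (EFin \o hs) \- h w]
               <= (r ^+ n)%:E)%E}].
Proof.
have [x [x1 mx hx heq]] := random_fixed_point hsigma herg hadm.
have mh := measurable_harmonic_measure x1 mx.
have hdens w : ae_eq (@haar R) [set: circle R]
    (density (fun w => harmonic_measure (x w)) w) (EFin \o poisson (x w)).
  have := harmonic_measure_density (x w); rewrite to_discE//; exact.
exists (fiber_measure P (measurable_harmonic_measure x1 mx)),
  (fun w => harmonic_measure (x w)) => h L; split.
- split.
  + by split => // A mA; exact: mh.
  + apply: filterS heq => w E A mA; rewrite -E.
    exact: harmonic_measure_inner_map (inner_map_bmap B w) (x1 w) mA.
  + by apply: aeW => w; exact: harmonic_measure_dominates.
- move=> nu nu_ [[mnu nuE] ninv nac] A mA; rewrite nuE//.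
  exact: (fiber_measure_unique hsigma x1 mx hx mnu ninv nac mA).
- exists x; split => //.
  + exact/measurable_borelC.
  + apply: filterS hx => w hw; split; last exact: hdens.
    move=> z z1; apply/cvg_cocycleP; exact: backward_attractor_cvg hw z1.
  + apply: filterS heq => w E; rewrite /h /L /density -E.
    exact: transfer_harmonic_measure.
- apply: filterS hx => w hw hs hvar hs0 hs1.
  exact: random_exponential_decay hw (hdens w) hvar hs0 hs1.
Qed.
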